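(* For all $f,g,h,k\in L^2(\Xi)$ the functions $M^B_h(f)$ and $M^B_k(g)$ belong to $L^2(\Xi\times\Xi)$ and $$\big\langle\!\big\langle\,\overline{M^B_{h}(f)},\,M^B_{k}(g)\,\big\rangle\!\big\rangle=\langle\overline h,k\rangle\,\langle\overline f,g\rangle .$$ In particular, for $h\neq 0$, $\frac{1}{\|h\|}M^B_{h}:L^2(\Xi)\to L^2(\Xi\times\Xi)$ is an isometry.
   Context: Let $N\ge 1$, $\mathcal X=\mathbb R^N$ with dual $\mathcal X^*$, and $\Xi=\mathcal X\times\mathcal X^*$, with points $X=(x,\xi)$, $Y=(y,\eta)$, $Z=(z,\zeta)$ and symplectic form $\sigma(X,Y)=y\cdot\xi-x\cdot\eta$. Set $\mathfrak e_X(Z)=\exp\{-i\sigma(X,Z)\}$. Measures: $\Xi$ carries the measure $d\mu(X)=(2\pi)^{-N}dX$ ($dX$ Lebesgue measure), $\Xi\times\Xi$ carries $\mu\otimes\mu$, and $L^2(\Xi)$, $L^2(\Xi\times\Xi)$ and their norms refer to these measures. The pairings are bilinear: $\langle f,g\rangle=\int_\Xi f(X)g(X)\,d\mu(X)$ and $\langle\!\langle F,G\rangle\!\rangle=\int_\Xi\int_\Xi F(X,Y)G(X,Y)\,d\mu(X)d\mu(Y)$. Magnetic field: $B$ is a closed $2$-form on $\mathcal X$ with continuous components $B_{jk}=-B_{kj}:\mathcal X\to\mathbb R$ (closed in the sense of distributions). $\Gamma^B(\langle a,b,c\rangle)=\int_{\langle a,b,c\rangle}B$ is the flux of $B$ through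 the oriented triangle with vertices $a,b,c$. A vector potential is a $1$-form $A$ with continuous components such that $dA=B$ (one always exists), and $\Gamma^A([x,y])=\int_0^1 (y-x)\cdot A(x+s(y-x))\,ds$ is its circulation along the segment from $x$ to $y$. Magnetic Weyl calculus: for a vector potential $A$, $$[\mathfrak{Op}^A(f)u](x)=(2\pi)^{-N}\int_{\mathcal X}\int_{\mathcal X^*}dy\,d\xi\,e^{i(x-y)\cdot\xi}e^{-i\Gamma^A([x,y])}f\big(\tfrac{x+y}{2},\xi\big)u(y).$$ It defines a bijection from $L^2(\Xi)$ onto the Hilbert–Schmidt operators on $L^2(\mathcal X)$ (with $L^2(\mathcal X)$ taken with Lebesgue measure). Moreover $\mathfrak{Op}^A(\mathfrak e_{Y})=\mathfrak{op}^A(Y)$ is the unitary operator $[\mathfrak{op}^A(y,\eta)u](x)=e^{-i(x+y/2)\cdot\eta}e^{-i\Gamma^A([x,x+y])}u(x+y)$. Magnetic composition: for Schwartz functions $f,g$ on $\Xi$, $$(f\#^Bg)(X)=\pi^{-2N}\int_\Xi dY\int_\Xi dZ\,e^{-2i\sigma(X-Y,X-Z)}e^{-i\Gamma^B(\langle x-y+z,\,y-z+x,\,z-x+y\rangle)}f(Y)g(Z)$$ (Lebesgue measures). It extends continuously to $L^2(\Xi)$ and is characterized by $\mathfrak{Op}^A(f\#^Bg)=\mathfrak{Op}^A(f)\mathfrak{Op}^A(g)$. Products of $f\in L^2(\Xi)$ with $\mathfrak e_X$ are the elements of $L^2(\Xi)$ determined by $\mathfrak{Op}^A(\mathfrak e_X\#^Bf)=\mathfrak{op}^A(X)\mathfrak{Op}^A(f)$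 and $\mathfrak{Op}^A(f\#^B\mathfrak e_X)=\mathfrak{Op}^A(f)\mathfrak{op}^A(X)$. None of these products depends on the choice of $A$ with $dA=B$. Magnetic modulation mapping associated to $h\in L^2(\Xi)$: for $f\in L^2(\Xi)$, $$[M^B_h(f)](X,Y)=\big\langle \mathfrak e_{-X}\#^Bf\#^B\mathfrak e_{X-Y},\,h\big\rangle,\qquad X,Y\in\Xi.$$ *)

(* Defs.v *)
From HB Require Import structures.
From mathcomp Require Import all_boot all_order all_algebra.
From mathcomp Require Import all_classical all_reals all_analysis.
From mathcomp Require Import complex.

Set Implicit Arguments.
Unset Strict Implicit.
Unset Printing Implicit Defensive.

Import Order.TTheory GRing.Theory Num.Theory.
Import numFieldNormedType.Exports.

Local Open Scope classical_set_scope.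
Local Open Scope ring_scope.
Local Open Scope complex_scope.

(* 'rV[R]_n carries the product sigma-algebra of the Borel sets of R, that is
   the Borel sigma-algebra of R^n (the same encoding as for n.-tuple R). *)
Definition rV_display : measure_display.
Proof. exact: default_measure_display. Qed.

Section measurable_rV.
Context {R : realType} {n : nat}.

Definition rV_coord (i : 'I_n) (v : 'rV[R]_n) : measurableTypeR R := v ord0 i.

Let rV_set0 : g_sigma_preimage rV_coord set0.
Proof. exact: sigma_algebra0. Qed.

Let rV_setC A : g_sigma_preimage rV_coord A -> g_sigma_preimage rV_coord (~` A).
Proof. exact: sigma_algebraC. Qed.

Let rV_bigcup (F : _^nat) : (forall i, g_sigma_preimage rV_coord (F i)) ->
  g_sigma_preimage rV_coord (\bigcup_i (F i)).
Proof. exact: sigma_algebra_bigcup. Qed.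

HB.instance Definition _ := @isMeasurable.Build rV_display
  'rV[R]_n (g_sigma_preimage rV_coord) rV_set0 rV_setC rV_bigcup.

Lemma measurable_rV_coord (i : 'I_n) : measurable_fun setT (rV_coord i).
Proof.
move=> _ Y mY; rewrite setTI; apply: sub_sigma_algebra => /=.
rewrite -bigcup_seq/=; exists i => /=; first by rewrite mem_index_enum.
by exists Y => //; rewrite setTI.
Qed.

Lemma measurable_fun_rVP d (T : measurableType d) (f : T -> 'rV[R]_n) :
  (forall i, measurable_fun setT (rV_coord i \o f)) -> measurable_fun setT f.
Proof.
move=> mf; have sub : g_sigma_preimage (fun i => rV_coord i \o f) `<=` measurable.
  apply: smallest_sub; first exact: sigma_algebra_measurable.
  rewrite -bigcup_seq; apply: bigcup_sub => i _ A [C mC <-]; exact: mf.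
move: sub; rewrite g_sigma_preimage_comp => sub _ A mA.
by apply: sub; exists A.
Qed.

End measurable_rV.

(* The canonical sigma-finite structure of m1 \x m2 is only inferred for finite
   measures, hence this lemma. *)
Lemma sigma_finite_product (R : realType) d1 d2 (T1 : measurableType d1)
    (T2 : measurableType d2) (m1 : {sigma_finite_measure set T1 -> \bar R})
    (m2 : {sigma_finite_measure set T2 -> \bar R}) :
  sigma_finite setT (m1 \x m2)%E.
Proof.
have /sigma_finiteP[F [TF ndF Foo]] := sigma_finiteT m1.
have /sigma_finiteP[G [TG ndG Goo]] := sigma_finiteT m2.
exists (fun n => F n `*` G n).
  rewrite -setXTT TF TG predeqE => -[x y]; split.
    move=> [/= [n _ Fnx] [k _ Gky]]; exists (maxn n k) => //; split.
    - by move: x Fnx; exact/subsetPset/ndF/leq_maxl.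
    - by move: y Gky; exact/subsetPset/ndG/leq_maxr.
  by move=> [n _ []/= ? ?]; split; exists n.
move=> k; have [? ?] := Foo k; have [? ?] := Goo k.
split; first exact: measurableX.
by rewrite product_measure1E// lte_mul_pinfty// ge0_fin_numE.
Qed.

Section lebesgue_rV.
Context {R : realType}.

Definition rV_cons n (p : measurableTypeR R * 'rV[R]_n) : 'rV[R]_n.+1 :=
  \row_i (if unlift ord0 i is Some j then p.2 ord0 j else p.1).

Definition rV_uncons n (v : 'rV[R]_n.+1) : measurableTypeR R * 'rV[R]_n :=
  (v ord0 ord0, \row_j v ord0 (lift ord0 j)).

Lemma rV_consK n : cancel (@rV_cons n) (@rV_uncons n).
Proof.
move=> [a v]; rewrite /rV_uncons /rV_cons !mxE unlift_none/=; congr pair.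
by apply/rowP => j; rewrite !mxE liftK.
Qed.

Lemma measurable_rV_cons n : measurable_fun setT (@rV_cons n).
Proof.
apply: measurable_fun_rVP => i.
have [j ij|i0] := unliftP ord0 i.
- rewrite (_ : _ \o _ = rV_coord j \o snd); last first.
    by apply/funext => p; rewrite /= /rV_coord mxE ij liftK.
  by apply: measurableT_comp => //; exact: measurable_rV_coord.
- rewrite (_ : _ \o _ = fst)//.
  by apply/funext => p; rewrite /= /rV_coord mxE i0 unlift_none.
Qed.

Lemma measurable_rV_uncons n : measurable_fun setT (@rV_uncons n).
Proof.
apply: measurable_fun_pair; first exact: (measurable_rV_coord ord0).
apply: measurable_fun_rVP => j.
rewrite (_ : _ \o _ = rV_coord (lift ord0 j)); last first.
  by apply/funext => v; rewrite /= /rV_coord mxE.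
exact: measurable_rV_coord.
Qed.

Section lebesgue_rVS.
Context n (m : {sigma_finite_measure set 'rV[R]_n -> \bar R}).

Definition lebesgue_rVS : set 'rV[R]_n.+1 -> \bar R :=
  pushforward (lebesgue_measure \x m)%E (@rV_cons n).


Let mcons : {measure set 'rV[R]_n.+1 -> \bar R} :=
  measure_function_pushforward__canonical__measure_function_Measure
    (lebesgue_measure \x m)%E (@measurable_rV_cons n).

Let lebesgue_rVS_sigma_finite : sigma_finite setT lebesgue_rVS.
Proof.
have [F FT F_fin] := sigma_finite_product lebesgue_measure m.
exists (fun i => @rV_uncons n @^-1` F i).
  by rewrite -preimage_bigcup -FT preimage_setT.
move=> i; have [mF Foo] := F_fin i; split.
  by rewrite -[X in measurable X]setTI; exact: measurable_rV_uncons.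
rewrite /lebesgue_rVS /pushforward -comp_preimage.
by rewrite (_ : _ \o _ = id) ?preimage_id//; exact/funext/rV_consK.
Qed.

HB.instance Definition _ := isMeasure.Build _ _ _ lebesgue_rVS
  (measure0 mcons) (measure_ge0 mcons) (@measure_semi_sigma_additive _ _ _ mcons).
HB.instance Definition _ := Measure_isSigmaFinite.Build _ _ _ lebesgue_rVS
  lebesgue_rVS_sigma_finite.

End lebesgue_rVS.

(* Lebesgue measure on R^n, as the n-fold product of lebesgue_measure; for
   n = 0 it is the unit mass. *)
Fixpoint lebesgue_rV n : {sigma_finite_measure set 'rV[R]_n -> \bar R} :=
  match n with
  | 0 => \d_(0 : 'rV[R]_0)
  | n'.+1 => lebesgue_rVS (lebesgue_rV n')
  end.

End lebesgue_rV.

Section complex_L2.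
Context {R : realType} d (T : measurableType d).
Variable m : {measure set T -> \bar R}.
Local Notation C := R[i].

Definition cmeasurable (f : T -> C) : Prop :=
  measurable_fun setT (fun x => complex.Re (f x)) /\
  measurable_fun setT (fun x => complex.Im (f x)).

Definition cintegral (f : T -> C) : C :=
  (\int[m]_x complex.Re (f x)) +i* (\int[m]_x complex.Im (f x)).

Definition L2norm (f : T -> C) : \bar R :=
  Lnorm m 2%:E (fun x => (ComplexField.Normc.normc (f x))%:E).

(* Square-integrable functions; elements of the Hilbert space L^2 are
   represented by such functions and compared with = %[ae m]. *)
Definition L2 (f : T -> C) : Prop := cmeasurable f /\ (L2norm f < +oo)%E.

Definition pairing (f g : T -> C) : C := cintegral (fun x => f x * g x).

End complex_L2.
Arguments L2norm {R d T} m f.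

Definition L2_isometry (R : realType) d1 d2 (T1 : measurableType d1)
    (T2 : measurableType d2) (m1 : {measure set T1 -> \bar R})
    (m2 : {measure set T2 -> \bar R}) (Phi : (T1 -> R[i]) -> (T2 -> R[i])) :=
  [/\ forall f, L2 m1 f -> L2 m2 (Phi f),
      forall (a : R[i]) f g, L2 m1 f -> L2 m1 g ->
        Phi (fun x => a * f x + g x) =
          (fun y => a * Phi f y + Phi g y) %[ae m2]
    & forall f, L2 m1 f -> L2norm m2 (Phi f) = L2norm m1 f].

Section magnetic.
Context {R : realType} {N : nat}.

Local Notation C := R[i].
(* The dual X^* is identified with R^N through the dot product. *)
Local Notation X := 'rV[R]_N.
Local Notation Xi := (X * X)%type.

Definition dot (x y : X) : R := \sum_i x ord0 i * y ord0 i.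

Definition cis (t : R) : C := cos t +i* sin t.

Definition partial (j : 'I_N) (phi : X -> R) : X -> R :=
  fun x => 'D_(delta_mx ord0 j) phi x.

Definition iter_partial (s : seq 'I_N) (phi : X -> R) : X -> R :=
  foldr partial phi s.

Definition smooth (phi : X -> R) : Prop :=
  forall s, continuous (iter_partial s phi) /\
    forall j x, derivable (iter_partial s phi) x (delta_mx ord0 j).

Definition test_function (phi : X -> R) : Prop :=
  smooth phi /\ compact (closure [set x | phi x != 0]).

Definition magnetic_field (B : X -> 'M[R]_N) : Prop :=
  [/\ forall j k, continuous (fun x => B x j k),
      forall x j k, B x j k = - B x k j
    & forall phi, test_function phi -> forall j k l,
        \int[lebesgue_rV N]_x (B x k l * partial j phi x +
          B x l j * partial k phi x + B x j k * partial l phi x) = 0].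

(* dA = B in the sense of distributions, with (dA)_jk = d_j A_k - d_k A_j. *)
Definition vector_potential (B : X -> 'M[R]_N) (A : X -> X) : Prop :=
  (forall j, continuous (fun x => A x ord0 j)) /\
  forall phi, test_function phi -> forall j k,
    \int[lebesgue_rV N]_x (B x j k * phi x) =
    - \int[lebesgue_rV N]_x
        (A x ord0 k * partial j phi x - A x ord0 j * partial k phi x).

Definition circulation (A : X -> X) (x y : X) : R :=
  \int[lebesgue_measure]_(s in `[0, 1]) dot (y - x) (A (x + s *: (y - x))).

Lemma two_pi_expN_ge0 : 0 <= (2 * pi) ^- N :> R.
Proof. by rewrite invr_ge0 exprn_ge0// mulr_ge0// pi_ge0. Qed.

Definition mu : set Xi -> \bar R :=
  mscale (NngNum two_pi_expN_ge0) (lebesgue_rV N \x lebesgue_rV N)%E.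

HB.instance Definition _ := Measure.on mu.

Let mu_sigma_finite : sigma_finite setT mu.
Proof.
have [F FT F_fin] :=
  @sigma_finite_product R _ _ _ _ (lebesgue_rV N) (lebesgue_rV N).
exists F => // i; have [mF Foo] := F_fin i; split => //.
by apply: lte_mul_pinfty Foo; rewrite ?lee_fin ?two_pi_expN_ge0.
Qed.
HB.instance Definition _ := Measure_isSigmaFinite.Build _ _ _ mu
  mu_sigma_finite.


Definition op (A : X -> X) (Y : Xi) (u : X -> C) : X -> C :=
  fun x => cis (- dot (x + 2^-1 *: Y.1) Y.2) *
           cis (- circulation A x (x + Y.1)) * u (x + Y.1).

Definition Op_int (A : X -> X) (f : Xi -> C) (u : X -> C) : X -> C :=
  fun x => ((2 * pi) ^- N)%:C *
    cintegral (lebesgue_rV N) (fun y =>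
      cintegral (lebesgue_rV N) (fun xi =>
        cis (dot (x - y) xi) * cis (- circulation A x y) *
        f (2^-1 *: (x + y), xi) * u y)).

Definition cutoff (n : nat) (f : Xi -> C) : Xi -> C :=
  fun Z => if `|Z.2| <= n%:R then f Z else 0.

(* For f and u square-integrable the integral in xi need not converge
   absolutely; it is the L^2 limit of its truncations to the cubes `|xi| <= n,
   each of which converges absolutely for every x. *)
Definition Op (A : X -> X) (f : Xi -> C) (u : X -> C) : X -> C :=
  xget (cst 0) [set v | L2 (lebesgue_rV N) v /\
    (fun n => L2norm (lebesgue_rV N)
      (fun x => v x - Op_int A (cutoff n f) u x)) @ \oo --> 0%E].

(* The products e_Z # f and f # e_Z, where Op A (e_Z) = op A Z for
   e_Z = exp(-i sigma(Z, .)). *)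
Definition moyal_el (A : X -> X) (Z : Xi) (f : Xi -> C) : Xi -> C :=
  xget (cst 0) [set k | L2 mu k /\
    forall u, L2 (lebesgue_rV N) u ->
      Op A k u = op A Z (Op A f u) %[ae lebesgue_rV N]].

Definition moyal_er (A : X -> X) (f : Xi -> C) (Z : Xi) : Xi -> C :=
  xget (cst 0) [set k | L2 mu k /\
    forall u, L2 (lebesgue_rV N) u ->
      Op A k u = Op A f (op A Z u) %[ae lebesgue_rV N]].

(* M^B_h(f), computed with a vector potential A of B:
   (X, Y) |-> < e_{-X} # f # e_{X-Y}, h >. *)
Definition modulation (A : X -> X) (h f : Xi -> C) : Xi * Xi -> C :=
  fun P => pairing mu (moyal_er A (moyal_el A (- P.1) f) (P.1 - P.2)) h.

End magnetic.

(* Main.v *)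
Require Import Defs.
From HB Require Import structures.
From mathcomp Require Import all_boot all_order all_algebra.
From mathcomp Require Import all_classical all_reals all_analysis.
From mathcomp Require Import complex.
From mathcomp Require Import measurable_realfun.
From mathcomp Require Import ring lra.

(** The magnetic Weyl calculus is read through integral kernels. [Op A f] is the
    integral operator with kernel K(x, y) = (2 pi)^-N e^{-i Gamma^A([x, y])}
    F((x + y)/2, x - y), where F is the Fourier transform of f in the
    momentum variable. Up to a phase, f |-> K is a partial Fourier transform
    followed by a volume-preserving substitution; by the Plancherel formula
    it is an isometry of L^2(mu) onto L^2(X x X) ([ker_norm], [ker_surj]),
    and an operator determines its kernel ([kernel_op_eq]). Since [op A Z]
    is a translation times a phase, the products e_Z # f and f # e_Z have as
    kernels K translated in one of its variables, times a phase
    ([moyal_el_ker], [moyal_er_ker]). Hence M_h f (X, Y) is the inner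
    product of H, the kernel of the conjugate of h, with an explicit phase
    times a translate of K ([modulation_ker]).

    Write X = (p, a) and Y = (q, b). The momenta a and b enter this inner
    product only through the characters e^{i x.a} and e^{i y.(b - a)}, so
    that, up to a phase, M_h f (X, Y) is the Fourier transform at (a, b - a)
    of the function of (x, y) whose modulus is |H(x, y)| |K(x - p, y - p +
    q)| ([modulation_fourier]). The Plancherel formula in the momenta, for
    fixed p and q, and then Tonelli, because (p, q) |-> (x - p, y - p + q)
    preserves Lebesgue measure for fixed (x, y), give ||M_h f||^2 = ||H||^2
    ||K||^2 = ||h||^2 ||f||^2; the powers of 2 pi cancel against the
    normalization of mu ([sqn_modulation_ker]). As M_h f is linear in f and
    in h, polarizing first in f and then in h turns this equality of norms
    into the orthogonality relation ([ip_modulation]). The magnetic field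
    enters through the flux phases alone, which have modulus 1.

    The analytic input is the Plancherel formula. On the line it comes from
    the Poisson kernel P_k, the Fourier transform of e^{-k |xi|}: by Fubini,
    int P_k(r) ||f(. + r) - f||^2 dr + 2 int e^{-k |xi|} |f^(xi)|^2 dxi is
    equal to 4 pi ||f||^2 ([poisson_identity]), and the first integral
    vanishes as k -> 0 since translations are continuous in L^2. Products of
    Plancherel pairs are Plancherel pairs ([plancherel_prod]), which gives
    R^n by induction. The L^2 theory of the partial transform rests on the
    completeness of L^2 ([L2_complete]); its surjectivity follows from the
    formula for the opposite phase ([FT_surj]). *)

Set Implicit Arguments.
Unset Strict Implicit.
Unset Printing Implicit Defensive.

Import Order.TTheory GRing.Theory Num.Theory.
Import numFieldNormedType.Exports.

Local Open Scope classical_set_scope.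
Local Open Scope ring_scope.
Local Open Scope complex_scope.
Local Notation "x ^*" := (conjc x) : ring_scope.

(** * Complex numbers and measurable complex functions *)

Section squared_modulus.
Context {R : realType}.
Implicit Types z w : R[i].

Definition nsq z : R := complex.Re z ^+ 2 + complex.Im z ^+ 2.

(** Equivalent to the modulus, additive in the two real parts and free of
    square roots, hence the convenient bound for integrability. *)
Definition n1 z : R := `|complex.Re z| + `|complex.Im z|.

Lemma nsq_ge0 z : 0 <= nsq z.
Proof. by rewrite addr_ge0 ?sqr_ge0. Qed.

Lemma n1_ge0 z : 0 <= n1 z.
Proof. by rewrite addr_ge0. Qed.

Lemma nsq0 : nsq 0 = 0.
Proof. by rewrite /nsq /= expr0n /= addr0. Qed.

Lemma nsq_eq0 z : nsq z = 0 -> z = 0.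
Proof.
move: z => [a b]; rewrite /nsq /= => /eqP.
by rewrite paddr_eq0 ?sqr_ge0// !sqrf_eq0 => /andP[/eqP -> /eqP ->].
Qed.

Lemma nsqM z w : nsq (z * w) = nsq z * nsq w.
Proof. by move: z w => [a b] [c d]; rewrite /nsq /=; ring. Qed.

Lemma nsqN z : nsq (- z) = nsq z.
Proof. by move: z => [a b]; rewrite /nsq /=; ring. Qed.

Lemma nsqJ z : nsq z^* = nsq z.
Proof. by move: z => [a b]; rewrite /nsq /=; ring. Qed.

Lemma conjM z w : (z * w)^* = z^* * w^*.
Proof. exact: (rmorphM (@conjc R)). Qed.

Lemma nsqR (a : R) : nsq a%:C = a ^+ 2.
Proof. by rewrite /nsq /=; ring. Qed.

Lemma mulJc z : z^* * z = (nsq z)%:C.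
Proof.
by move: z => [a b]; rewrite /nsq /=; apply/eqP; rewrite eq_complex /=;
  apply/andP; split; apply/eqP; ring.
Qed.

Lemma nsqD_le z w : nsq (z + w) <= 2 * nsq z + 2 * nsq w.
Proof.
move: z w => [a b] [c d]; rewrite /nsq /=.
have := sqr_ge0 (a - c); have := sqr_ge0 (b - d); nra.
Qed.

Lemma nsqB z w : nsq (z - w) = (complex.Re z - complex.Re w) ^+ 2 +
  (complex.Im z - complex.Im w) ^+ 2.
Proof. by move: z w => [a b] [c d]. Qed.

(** The expansion behind the Cauchy-Schwarz inequality: z and w are the
    values of two functions at a point, p is their pairing. *)
Lemma nsqB_scale z w (p : R[i]) (t : R) :
  nsq (z - t%:C * p * w^*) =
  nsq z - 2 * t * complex.Re (p^* * (z * w)) + t ^+ 2 * nsq p * nsq w.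
Proof. by move: z w p => [a b] [c d] [e f]; rewrite /nsq /=; ring. Qed.

Lemma normc_sqr z : ComplexField.Normc.normc z ^+ 2 = nsq z.
Proof. by move: z => [a b]; rewrite /= sqr_sqrtr// addr_ge0 ?sqr_ge0. Qed.

Lemma normc_ge0 z : 0 <= ComplexField.Normc.normc z.
Proof. by move: z => [a b]; rewrite /= sqrtr_ge0. Qed.

Lemma polarization z w : 4%:R * (z^* * w) =
  (nsq (z + w))%:C - (nsq (z - w))%:C
  - 'i * (nsq (z + 'i * w))%:C + 'i * (nsq (z - 'i * w))%:C.
Proof.
rewrite (_ : 4%:R = (4%:R : R)%:C) ?rmorph_nat//.
move: z w => [a b] [c d]; rewrite /nsq /=; apply/eqP; rewrite eq_complex /=.
by apply/andP; split; apply/eqP; ring.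
Qed.

Lemma n1M z w : n1 (z * w) <= n1 z * n1 w.
Proof.
move: z w => [a b] [c d]; rewrite /n1 /= mulrDl !mulrDr.
have := ler_normB (a * c) (b * d); have := ler_normD (a * d) (b * c).
rewrite !normrM; lra.
Qed.

Lemma n1D z w : n1 (z + w) <= n1 z + n1 w.
Proof.
move: z w => [a b] [c d]; rewrite /n1 /=.
have := ler_normD a c; have := ler_normD b d; lra.
Qed.

Lemma n1J z : n1 z^* = n1 z.
Proof. by move: z => [a b]; rewrite /n1 /= normrN. Qed.

Lemma n1_le_nsq z w : n1 (z * w) <= nsq z + nsq w.
Proof.
apply: (le_trans (n1M _ _)).
have n1z u : n1 u ^+ 2 <= 2 * nsq u.
  move: u => [a b]; rewrite /n1 /nsq /= -(real_normK (num_real a)) -(real_normK (num_real b)).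
  by have := sqr_ge0 (`|a| - `|b|); nra.
have := n1z z; have := n1z w; have := sqr_ge0 (n1 z - n1 w); nra.
Qed.

Lemma nsq_le_n1 z : nsq z <= n1 z ^+ 2.
Proof.
move: z => [a b]; rewrite /n1 /nsq /= -(real_normK (num_real a)) -(real_normK (num_real b)).
have : 0 <= `|a| * `|b| by rewrite mulr_ge0.
by nra.
Qed.

Lemma nsq_cis (t : R) : nsq (cis t) = 1.
Proof. exact: cos2Dsin2. Qed.

Lemma n1_cis (t : R) : n1 (cis t) <= 2.
Proof. by rewrite /n1 /=; have := cos_max t; have := sin_max t; lra. Qed.

Lemma cisD (s t : R) : cis (s + t) = cis s * cis t.
Proof.
rewrite /cis cosD sinD; apply/eqP; rewrite eq_complex /=.
by apply/andP; split; apply/eqP; ring.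
Qed.

Lemma cisN (t : R) : cis (- t) = (cis t)^*.
Proof. by rewrite /cis cosN sinN. Qed.

Lemma cis0 : cis (0 : R) = 1.
Proof. by rewrite /cis cos0 sin0. Qed.

Lemma cisJM (t : R) : (cis t)^* * cis t = 1.
Proof. by rewrite mulJc nsq_cis. Qed.

End squared_modulus.

Section cmeasurable_theory.
Context {R : realType} d (T : measurableType d).
Implicit Types f g : T -> R[i].

Lemma cmeasurable_cst (c : R[i]) : cmeasurable (fun _ : T => c).
Proof. by split; exact: measurable_cst. Qed.

Lemma cmeasurableD f g : cmeasurable f -> cmeasurable g ->
  cmeasurable (fun x => f x + g x).
Proof.
move=> [f1 f2] [g1 g2]; split.
- rewrite (_ : (fun x => _) = (fun x => complex.Re (f x) + complex.Re (g x))).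
    exact: measurable_funD.
  by apply/funext => x; case: (f x) (g x) => [? ?] [? ?].
- rewrite (_ : (fun x => _) = (fun x => complex.Im (f x) + complex.Im (g x))).
    exact: measurable_funD.
  by apply/funext => x; case: (f x) (g x) => [? ?] [? ?].
Qed.

Lemma cmeasurableM f g : cmeasurable f -> cmeasurable g ->
  cmeasurable (fun x => f x * g x).
Proof.
move=> [f1 f2] [g1 g2]; split.
- rewrite (_ : (fun x => _) = (fun x => complex.Re (f x) * complex.Re (g x)
     - complex.Im (f x) * complex.Im (g x))).
    by apply: measurable_funB; exact: measurable_funM.
  by apply/funext => x; case: (f x) (g x) => [? ?] [? ?].
- rewrite (_ : (fun x => _) = (fun x => complex.Re (f x) * complex.Im (g x)
     + complex.Im (f x) * complex.Re (g x))).
    by apply: measurable_funD; exact: measurable_funM.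
  by apply/funext => x; case: (f x) (g x) => [? ?] [? ?].
Qed.

Lemma cmeasurableZ (c : R[i]) f : cmeasurable f -> cmeasurable (fun x => c * f x).
Proof. by move=> mf; apply: cmeasurableM => //; exact: cmeasurable_cst. Qed.

Lemma cmeasurableN f : cmeasurable f -> cmeasurable (fun x => - f x).
Proof.
move=> mf; rewrite (_ : (fun x => _) = (fun x => -1 * f x)).
  exact: cmeasurableZ.
by apply/funext => x; rewrite mulN1r.
Qed.

Lemma cmeasurableB f g : cmeasurable f -> cmeasurable g ->
  cmeasurable (fun x => f x - g x).
Proof. by move=> mf mg; apply: cmeasurableD => //; exact: cmeasurableN. Qed.

Lemma cmeasurableJ f : cmeasurable f -> cmeasurable (fun x => (f x)^*).
Proof.
move=> [f1 f2]; split.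
- rewrite (_ : (fun x => _) = (fun x => complex.Re (f x)))//.
  by apply/funext => x; case: (f x) => [? ?].
- rewrite (_ : (fun x => _) = (fun x => - complex.Im (f x))).
    exact: (measurableT_comp (@oppr_measurable R setT)).
  by apply/funext => x; case: (f x) => [? ?].
Qed.

Lemma cmeasurableR (f : T -> R) : measurable_fun setT f ->
  cmeasurable (fun x => (f x)%:C).
Proof. by move=> mf; split => //; exact: measurable_cst. Qed.

Lemma cmeasurable_cis (f : T -> R) : measurable_fun setT f ->
  cmeasurable (fun x => cis (f x)).
Proof.
move=> mf; split => /=; apply: measurableT_comp => //.
- by apply: continuous_measurable_fun; exact: continuous_cos.
- by apply: continuous_measurable_fun; exact: continuous_sin.
Qed.

Lemma cmeasurable_nsq f : cmeasurable f -> measurable_fun setT (fun x => nsq (f x)).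
Proof. by move=> [f1 f2]; apply: measurable_funD; exact: measurable_funX. Qed.

Lemma cmeasurable_n1 f : cmeasurable f -> measurable_fun setT (fun x => n1 (f x)).
Proof. by move=> [f1 f2]; apply: measurable_funD; exact: measurableT_comp. Qed.

Lemma cmeasurable_ensq f : cmeasurable f ->
  measurable_fun setT (fun x => (nsq (f x))%:E).
Proof. by move=> mf; apply/measurable_EFinP; exact: cmeasurable_nsq. Qed.

Lemma cmeasurable_en1 f : cmeasurable f ->
  measurable_fun setT (fun x => (n1 (f x))%:E).
Proof. by move=> mf; apply/measurable_EFinP; exact: cmeasurable_n1. Qed.

Lemma cmeasurable_if (P : T -> bool) f g : measurable_fun setT P ->
  cmeasurable f -> cmeasurable g -> cmeasurable (fun x => if P x then f x else g x).
Proof.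
move=> mP [f1 f2] [g1 g2]; split.
- rewrite (_ : (fun x => _) = (fun x => if P x then complex.Re (f x) else complex.Re (g x))).
    by apply: measurable_fun_ifT.
  by apply/funext => x; case: ifP.
- rewrite (_ : (fun x => _) = (fun x => if P x then complex.Im (f x) else complex.Im (g x))).
    by apply: measurable_fun_ifT.
  by apply/funext => x; case: ifP.
Qed.

End cmeasurable_theory.

Lemma cmeasurable_comp {R : realType} d d' (T : measurableType d)
  (U : measurableType d') (f : U -> R[i]) (h : T -> U) : cmeasurable f ->
  measurable_fun setT h -> cmeasurable (fun x => f (h x)).
Proof.
move=> [f1 f2] mh; split.
- exact: (measurableT_comp f1 mh).
- exact: (measurableT_comp f2 mh).
Qed.

(** * Complex integrals, square-integrability and Cauchy-Schwarz *)

Section integrals.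
Context {R : realType} d (T : measurableType d) (m : {measure set T -> \bar R}).
Implicit Types f g : T -> R[i].

(** Squared L^2 norm in the extended reals, so that Tonelli applies to it
    before square-integrability is known. *)
Definition sqn f : \bar R := (\int[m]_x (nsq (f x))%:E)%E.
Definition L1 f : Prop := cmeasurable f /\ (\int[m]_x (n1 (f x))%:E < +oo)%E.

Lemma sqn_ge0 f : (0 <= sqn f)%E.
Proof. by apply: integral_ge0 => x _; rewrite lee_fin nsq_ge0. Qed.

Lemma L2norm_sqn f : L2norm m f = poweR (sqn f) 2^-1.
Proof.
rewrite /L2norm unlock; congr poweR; apply: eq_integral => x _ /=.
by rewrite ger0_norm ?normc_ge0// powR_mulrn ?normc_ge0// normc_sqr.
Qed.

Lemma L2norm_fin f : (L2norm m f < +oo)%E <-> (sqn f < +oo)%E.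
Proof.
rewrite L2norm_sqn; have := sqn_ge0 f; case: (sqn f) => [r r0| |]//=.
- by rewrite !ltry.
- by move=> _; rewrite /poweR; case: eqP => // /eqP; rewrite invr_eq0 pnatr_eq0.
Qed.

Lemma L2P f : L2 m f <-> cmeasurable f /\ (sqn f < +oo)%E.
Proof. by rewrite /L2; split => -[mf] /L2norm_fin. Qed.

Lemma sqn_fin f : L2 m f -> sqn f \is a fin_num.
Proof. by move=> /L2P[_ sf]; rewrite ge0_fin_numE ?sqn_ge0. Qed.

Lemma L1_integrable f : L1 f ->
  m.-integrable setT (fun x => (complex.Re (f x))%:E) /\
  m.-integrable setT (fun x => (complex.Im (f x))%:E).
Proof.
move=> [mf fi]; split; apply/integrableP; split.
- exact/measurable_EFinP/mf.1.
- apply: le_lt_trans fi; apply: ge0_le_integral => //=.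
  + apply/measurable_EFinP; apply: measurableT_comp => //; exact: mf.1.
  + exact: cmeasurable_en1.
  + by move=> x _; rewrite lee_fin lerDl.
- exact/measurable_EFinP/mf.2.
- apply: le_lt_trans fi; apply: ge0_le_integral => //=.
  + apply/measurable_EFinP; apply: measurableT_comp => //; exact: mf.2.
  + exact: cmeasurable_en1.
  + by move=> x _; rewrite lee_fin lerDr.
Qed.

Lemma L1_dominated f (g : T -> \bar R) : cmeasurable f -> measurable_fun setT g ->
  (\int[m]_x g x < +oo)%E -> (forall x, ((n1 (f x))%:E <= g x)%E) -> L1 f.
Proof.
move=> mf mg gi fg; split=> //; apply: le_lt_trans gi.
apply: ge0_le_integral => //.
- by move=> x _; rewrite lee_fin n1_ge0.
- exact: cmeasurable_en1.
Qed.

Lemma L1D f g : L1 f -> L1 g -> L1 (fun x => f x + g x).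
Proof.
move=> [mf fi] [mg gi].
apply: (@L1_dominated _ (fun x => (n1 (f x))%:E + (n1 (g x))%:E)%E).
- exact: cmeasurableD.
- by apply: emeasurable_funD; exact: cmeasurable_en1.
- rewrite ge0_integralD//; first exact: lte_add_pinfty.
  + by move=> x _; rewrite lee_fin n1_ge0.
  + exact: cmeasurable_en1.
  + by move=> x _; rewrite lee_fin n1_ge0.
  + exact: cmeasurable_en1.
- by move=> x; rewrite -EFinD lee_fin n1D.
Qed.

Lemma L1_bounded f g (c : R) : L1 f -> cmeasurable g ->
  (forall x, n1 (g x) <= c) -> L1 (fun x => g x * f x).
Proof.
move=> [mf fi] mg gc.
apply: (@L1_dominated _ (fun x => `|c|%:E * (n1 (f x))%:E)%E).
- exact: cmeasurableM.
- by apply: emeasurable_funM => //; exact: cmeasurable_en1.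
- rewrite ge0_integralZl//.
  + by rewrite lte_mul_pinfty.
  + exact: cmeasurable_en1.
  + by move=> x _; rewrite lee_fin n1_ge0.
- move=> x; rewrite -EFinM lee_fin (le_trans (n1M _ _))//.
  by apply: ler_wpM2r; rewrite ?n1_ge0// (le_trans (gc x))// ler_norm.
Qed.

Lemma L1Z (c : R[i]) f : L1 f -> L1 (fun x => c * f x).
Proof.
by move=> fi; apply: (@L1_bounded _ (fun=> c) (n1 c)).
Qed.

Lemma L1N f : L1 f -> L1 (fun x => - f x).
Proof.
move=> fi; rewrite (_ : (fun x => _) = (fun x => -1 * f x)); first exact: L1Z.
by apply/funext => x; rewrite mulN1r.
Qed.

Lemma L1B f g : L1 f -> L1 g -> L1 (fun x => f x - g x).
Proof. by move=> fi gi; apply: L1D => //; exact: L1N. Qed.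

Lemma L1J f : L1 f -> L1 (fun x => (f x)^*).
Proof.
move=> [mf fi]; split; first exact: cmeasurableJ.
by under eq_integral do rewrite n1J.
Qed.

Lemma L1_cis f (h : T -> R) : L1 f -> measurable_fun setT h ->
  L1 (fun x => cis (h x) * f x).
Proof.
move=> fi mh; apply: (@L1_bounded _ _ 2) => //; last by move=> x; exact: n1_cis.
exact: cmeasurable_cis.
Qed.

Lemma cintegralD f g : L1 f -> L1 g ->
  cintegral m (fun x => f x + g x) = cintegral m f + cintegral m g.
Proof.
move=> /L1_integrable[f1 f2] /L1_integrable[g1 g2].
rewrite /cintegral; apply/eqP; rewrite eq_complex /=; apply/andP; split; apply/eqP.
- rewrite -RintegralD//; apply: eq_Rintegral => x _ /=.
  by case: (f x) (g x) => [? ?] [? ?].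
- rewrite -RintegralD//; apply: eq_Rintegral => x _ /=.
  by case: (f x) (g x) => [? ?] [? ?].
Qed.

Lemma cintegralZ (c : R[i]) f : L1 f ->
  cintegral m (fun x => c * f x) = c * cintegral m f.
Proof.
have sc (h : T -> R) r : m.-integrable setT (EFin \o h) ->
    m.-integrable setT (EFin \o (fun x => r * h x)).
  by move=> hi; rewrite (_ : _ \o _ = (fun x => r%:E * (EFin \o h) x)%E)//; exact: integrableZl.
move=> /L1_integrable[f1 f2]; move: c => [a b].
rewrite /cintegral; apply/eqP; rewrite eq_complex /=; apply/andP; split; apply/eqP.
- rewrite -!RintegralZl// -RintegralB//; [|exact: sc|exact: sc].
  by apply: eq_Rintegral => x _ /=; case: (f x) => [? ?].
- rewrite -!RintegralZl// -RintegralD//; [|exact: sc|exact: sc].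
  by apply: eq_Rintegral => x _ /=; case: (f x) => [? ?].
Qed.

Lemma cintegralN f : L1 f ->
  cintegral m (fun x => - f x) = - cintegral m f.
Proof.
move=> fi; rewrite -[RHS]mulN1r -cintegralZ//.
by congr cintegral; apply/funext => x; rewrite mulN1r.
Qed.

Lemma cintegralB f g : L1 f -> L1 g ->
  cintegral m (fun x => f x - g x) = cintegral m f - cintegral m g.
Proof. by move=> fi gi; rewrite cintegralD ?cintegralN//; exact: L1N. Qed.

Lemma cintegralJ f : L1 f -> cintegral m (fun x => (f x)^*) = (cintegral m f)^*.
Proof.
move=> /L1_integrable[f1 f2].
rewrite /cintegral; apply/eqP; rewrite eq_complex /=; apply/andP; split; apply/eqP.
- by apply: eq_Rintegral => x _ /=; case: (f x) => [? ?].
- rewrite -[RHS]mulN1r -RintegralZl//; apply: eq_Rintegral => x _ /=.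
  by rewrite mulN1r; case: (f x) => [? ?].
Qed.

Lemma cintegralR (f : T -> R) : cintegral m (fun x => (f x)%:C) = (\int[m]_x f x)%:C.
Proof.
rewrite /cintegral; apply/eqP; rewrite eq_complex /= eqxx /=; apply/eqP.
by rewrite /Rintegral integral0.
Qed.

Lemma eq_cintegral f g : f =1 g -> cintegral m f = cintegral m g.
Proof. by move=> /funext ->. Qed.

Lemma ae_eq_cintegral f g : cmeasurable f -> cmeasurable g ->
  f = g %[ae m] -> cintegral m f = cintegral m g.
Proof.
move=> [f1 f2] [g1 g2] fg; rewrite /cintegral /Rintegral.
by congr (fine _ +i* fine _); apply: ae_eq_integral => //;
  try exact/measurable_EFinP; apply: filterS fg => x /= /[apply] ->.
Qed.

Lemma ae_eq_sqn f g : cmeasurable f -> cmeasurable g ->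
  f = g %[ae m] -> sqn f = sqn g.
Proof.
move=> mf mg fg; rewrite /sqn.
by apply: ae_eq_integral => //; try exact: cmeasurable_ensq;
  apply: filterS fg => x /= /[apply] ->.
Qed.

Lemma n1_cintegral f : L1 f -> ((n1 (cintegral m f))%:E <= \int[m]_x (n1 (f x))%:E)%E.
Proof.
move=> fi; have [f1 f2] := L1_integrable fi; have [[m1 m2] _] := fi.
rewrite /n1 EFinD; under [leRHS]eq_integral do rewrite EFinD.
rewrite ge0_integralD//; last 2 first.
- exact/measurable_EFinP/measurableT_comp.
- exact/measurable_EFinP/measurableT_comp.
rewrite /cintegral /= !EFin_normr_Rintegral//.
by apply: leeD; apply: le_abse_integral => //; exact/measurable_EFinP.
Qed.

Lemma L2M f g : L2 m f -> L2 m g -> L1 (fun x => f x * g x).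
Proof.
move=> /L2P[mf fi] /L2P[mg gi].
apply: (@L1_dominated _ (fun x => (nsq (f x))%:E + (nsq (g x))%:E)%E).
- exact: cmeasurableM.
- by apply: emeasurable_funD; exact: cmeasurable_ensq.
- rewrite ge0_integralD//; first exact: lte_add_pinfty.
  + by move=> x _; rewrite lee_fin nsq_ge0.
  + exact: cmeasurable_ensq.
  + by move=> x _; rewrite lee_fin nsq_ge0.
  + exact: cmeasurable_ensq.
- by move=> x; rewrite -EFinD lee_fin n1_le_nsq.
Qed.

Lemma sqnZ (c : R[i]) f : cmeasurable f ->
  sqn (fun x => c * f x) = ((nsq c)%:E * sqn f)%E.
Proof.
move=> mf; rewrite /sqn -ge0_integralZl//.
- by apply: eq_integral => x _; rewrite nsqM EFinM.
- exact: cmeasurable_ensq.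
- by move=> x _; rewrite lee_fin nsq_ge0.
- by rewrite lee_fin nsq_ge0.
Qed.

Lemma sqnD_le f g : cmeasurable f -> cmeasurable g ->
  (sqn (fun x => f x + g x)%R <= 2%:E * sqn f + 2%:E * sqn g)%E.
Proof.
have p h : (forall x, setT x -> 0 <= (nsq (h x : R[i]))%:E)%E.
  by move=> x _; rewrite lee_fin nsq_ge0.
move=> mf mg; have mf' := cmeasurable_ensq mf; have mg' := cmeasurable_ensq mg.
have E h : measurable_fun setT (fun x => (nsq (h x : R[i]))%:E) ->
    (2%:E * sqn h)%E = (\int[m]_x (2%:E * (nsq (h x))%:E))%E.
  by move=> mh; rewrite ge0_integralZl//; exact: p.
rewrite !E// -ge0_integralD//.
- apply: ge0_le_integral => //.
  + exact: p.
  + exact/cmeasurable_ensq/cmeasurableD.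
  + by apply: emeasurable_funD; exact: emeasurable_funM.
  + by move=> x _; rewrite -!EFinM -EFinD lee_fin nsqD_le.
- by move=> x _; rewrite -EFinM lee_fin mulr_ge0// nsq_ge0.
- exact: emeasurable_funM.
- by move=> x _; rewrite -EFinM lee_fin mulr_ge0// nsq_ge0.
- exact: emeasurable_funM.
Qed.

Lemma L2_measurable f : L2 m f -> cmeasurable f.
Proof. by case. Qed.

Lemma L2Z (c : R[i]) f : L2 m f -> L2 m (fun x => c * f x).
Proof.
move=> /L2P[mf fi]; apply/L2P; split; first exact: cmeasurableZ.
by rewrite sqnZ// lte_mul_pinfty// lee_fin nsq_ge0.
Qed.

Lemma L2D f g : L2 m f -> L2 m g -> L2 m (fun x => f x + g x).
Proof.
move=> /L2P[mf fi] /L2P[mg gi]; apply/L2P; split; first exact: cmeasurableD.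
by rewrite (le_lt_trans (sqnD_le _ _))// lte_add_pinfty// lte_mul_pinfty.
Qed.

Lemma L2N f : L2 m f -> L2 m (fun x => - f x).
Proof.
move=> fi; rewrite (_ : (fun x => _) = (fun x => -1 * f x)); first exact: L2Z.
by apply/funext => x; rewrite mulN1r.
Qed.

Lemma L2B f g : L2 m f -> L2 m g -> L2 m (fun x => f x - g x).
Proof. by move=> fi gi; apply: L2D => //; exact: L2N. Qed.

Lemma sqnJ f : sqn (fun x => (f x)^*) = sqn f.
Proof. by apply: eq_integral => x _; rewrite nsqJ. Qed.

Lemma L2J f : L2 m f -> L2 m (fun x => (f x)^*).
Proof. by move=> /L2P[mf fi]; apply/L2P; rewrite sqnJ; split => //; exact: cmeasurableJ. Qed.

Lemma L2_dominated f g : cmeasurable f -> L2 m g ->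
  (forall x, nsq (f x) <= nsq (g x)) -> L2 m f.
Proof.
move=> mf /L2P[mg gi] fg; apply/L2P; split => //; apply: le_lt_trans gi.
apply: ge0_le_integral => //; do ?exact: cmeasurable_ensq.
- by move=> x _; rewrite lee_fin nsq_ge0.
- by move=> x _; rewrite lee_fin.
Qed.

Definition ip f g : R[i] := pairing m (fun x => (f x)^*) g.

Lemma ip_L1 f g : L2 m f -> L2 m g -> L1 (fun x => (f x)^* * g x).
Proof. by move=> fi gi; apply: L2M => //; exact: L2J. Qed.

Lemma ipxx f : L2 m f -> ip f f = (fine (sqn f))%:C.
Proof.
by move=> fi; rewrite -cintegralR; apply: eq_cintegral => x; rewrite mulJc.
Qed.

Lemma ipDr f g h : L2 m f -> L2 m g -> L2 m h ->
  ip f (fun x => g x + h x) = ip f g + ip f h.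
Proof.
move=> fi gi hi; rewrite /ip /pairing -cintegralD; do ?exact: ip_L1.
by apply: eq_cintegral => x; rewrite mulrDr.
Qed.

Lemma ipZr c f g : L2 m f -> L2 m g -> ip f (fun x => c * g x) = c * ip f g.
Proof.
move=> fi gi; rewrite /ip /pairing -cintegralZ; last exact: ip_L1.
by apply: eq_cintegral => x; rewrite mulrCA.
Qed.

Lemma ipJ f g : L2 m f -> L2 m g -> (ip f g)^* = ip g f.
Proof.
move=> fi gi; rewrite /ip /pairing -cintegralJ; last exact: ip_L1.
by apply: eq_cintegral => x; rewrite rmorphM /= conjcK mulrC.
Qed.

Lemma ipDl f g h : L2 m f -> L2 m g -> L2 m h ->
  ip (fun x => g x + h x) f = ip g f + ip h f.
Proof.
move=> fi gi hi; rewrite -(ipJ fi (L2D gi hi)) ipDr// rmorphD.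
by congr (_ + _); exact: ipJ.
Qed.

Lemma ipZl c f g : L2 m f -> L2 m g -> ip (fun x => c * g x) f = c^* * ip g f.
Proof.
move=> fi gi; rewrite -(ipJ fi (L2Z c gi)) ipZr// rmorphM.
by congr (_ * _); exact: ipJ.
Qed.

Lemma ipBr f g h : L2 m f -> L2 m g -> L2 m h ->
  ip f (fun x => g x - h x) = ip f g - ip f h.
Proof.
move=> fi gi hi; rewrite /ip /pairing -cintegralB; do ?exact: ip_L1.
by apply: eq_cintegral => x; rewrite mulrBr.
Qed.

(** Every inner product below is deduced from an identity between norms
    through this formula. The four terms have the common form [f x + a * g
    x], so that a hypothesis quantified over [a] rewrites all of them. *)
Lemma ip_polarization f g : L2 m f -> L2 m g -> 4%:R * ip f g =
  (fine (sqn (fun x => f x + 1 * g x)))%:C - (fine (sqn (fun x => f x + -1 * g x)))%:C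
  - 'i * (fine (sqn (fun x => f x + 'i * g x)))%:C
  + 'i * (fine (sqn (fun x => f x + - 'i * g x)))%:C.
Proof.
move=> fi gi; have ii := L2Z 'i gi.
rewrite (_ : (fun x => f x + 1 * g x) = (fun x => f x + g x)); last first.
  by apply/funext => x; rewrite mul1r.
rewrite (_ : (fun x => f x + -1 * g x) = (fun x => f x - g x)); last first.
  by apply/funext => x; rewrite mulN1r.
rewrite (_ : (fun x => f x + - 'i * g x) = (fun x => f x - 'i * g x)); last first.
  by apply/funext => x; rewrite mulNr.
have e h : L2 m h -> (fine (sqn h))%:C = cintegral m (fun x => (nsq (h x))%:C).
  by move=> hi; rewrite cintegralR.
have l h : L2 m h -> L1 (fun x => (nsq (h x))%:C).
  move=> hi; apply: (eq_ind _ (fun h => L1 h) (ip_L1 hi hi)).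
  by apply/funext => x; rewrite mulJc.
rewrite !e; [|exact: L2B|exact: L2D|exact: L2B|exact: L2D].
have l1 := l _ (L2D fi gi); have l2 := l _ (L2B fi gi).
have l3 := l _ (L2D fi ii); have l4 := l _ (L2B fi ii).
rewrite -(cintegralB l1 l2) -!cintegralZ//; last exact: ip_L1.
rewrite -cintegralB -?cintegralD//; last 4 first.
- by apply: L1B; [exact: L1B|exact: L1Z].
- exact: L1Z.
- exact: L1B.
- exact: L1Z.
by apply: eq_cintegral => x; rewrite polarization.
Qed.

(** With p the pairing of f and g, the squared norm of f - t p conj(g) is a
    quadratic polynomial in t that is nonnegative; it is evaluated at t = 1
    / ||g||^2, or at a large t when ||g|| = 0. *)
Lemma cauchy_schwarz f g : L2 m f -> L2 m g ->
  ((nsq (cintegral m (fun x => f x * g x)))%:E <= sqn f * sqn g)%E.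
Proof.
move=> fi gi; set p := cintegral _ _.
have fgi := L2M fi gi.
have a0 : 0 <= fine (sqn f) by rewrite fine_ge0// sqn_ge0.
have b0 : 0 <= fine (sqn g) by rewrite fine_ge0// sqn_ge0.
have key t : 0 <= fine (sqn f) - 2 * t * nsq p + t ^+ 2 * nsq p * fine (sqn g).
  have l h : L2 m h -> L1 (fun x => (nsq (h x))%:C).
    move=> hi; apply: (eq_ind _ (fun h => L1 h) (ip_L1 hi hi)).
    by apply/funext => x; rewrite mulJc.
  have lf := l _ fi; have lg := L1Z (t ^+ 2 * nsq p)%:C (l _ gi).
  have lp := L1Z (2 * t)%:C (L1Z p^* fgi).
  pose h x := (nsq (f x))%:C - (2 * t)%:C * (p^* * (f x * g x))
    + (t ^+ 2 * nsq p)%:C * (nsq (g x))%:C.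
  have hE : cintegral m h = (fine (sqn f) - 2 * t * nsq p
      + t ^+ 2 * nsq p * fine (sqn g))%:C.
    rewrite cintegralD//; last exact: L1B.
    rewrite cintegralB// !cintegralZ//; [|exact: l|exact: L1Z].
    by rewrite !cintegralR mulJc !(rmorphB, rmorphD, rmorphM).
  have : fine (sqn (fun x => f x - t%:C * p * (g x)^*)) = complex.Re (cintegral m h).
    apply: eq_Rintegral => x _; rewrite nsqB_scale /h.
    move: (p^* * (f x * g x)) => [a b] /=; ring.
  by rewrite hE /= => <-; rewrite fine_ge0// sqn_ge0.
rewrite -(fineK (sqn_fin fi)) -(fineK (sqn_fin gi)) -EFinM lee_fin.
have p0 := nsq_ge0 p.
have [b1|b1] := ltP 0 (fine (sqn g)).
  have := key (fine (sqn g))^-1.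
  set b := fine (sqn g) in b1 *; set a := fine (sqn f).
  move=> h; have : 0 <= b * (a - 2 * b^-1 * nsq p + b^-1 ^+ 2 * nsq p * b).
    by rewrite mulr_ge0.
  by rewrite (_ : b * _ = a * b - nsq p) ?subr_ge0//; field; rewrite gt_eqF.
have b00 : fine (sqn g) = 0 by apply/eqP; rewrite eq_le b0 b1.
rewrite b00 mulr0; rewrite leNgt; apply/negP => p1.
have := key ((fine (sqn f) + 1) / (2 * nsq p)).
rewrite b00 mulr0 addr0 (_ : 2 * _ * _ = fine (sqn f) + 1); first lra.
by field; rewrite gt_eqF.
Qed.

End integrals.

(** * Hilbert norm and completeness of L^2 *)

Section hilbert_norm.
Context {R : realType} d (T : measurableType d) (m : {measure set T -> \bar R}).
Implicit Types f g : T -> R[i].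

Definition hnorm f : R := Num.sqrt (fine (sqn m f)).

Lemma hnorm_ge0 f : 0 <= hnorm f.
Proof. exact: sqrtr_ge0. Qed.

Lemma hnorm_sqr f : hnorm f ^+ 2 = fine (sqn m f).
Proof. by rewrite sqr_sqrtr// fine_ge0// sqn_ge0. Qed.

Lemma sqn_hnorm f : L2 m f -> sqn m f = (hnorm f ^+ 2)%:E.
Proof. by move=> fi; rewrite hnorm_sqr fineK// sqn_fin. Qed.

Lemma L2norm_hnorm f : L2 m f -> L2norm m f = (hnorm f)%:E.
Proof.
move=> fi; rewrite L2norm_sqn (sqn_hnorm fi) poweR_EFin; congr EFin.
by rewrite powR12_sqrt ?sqr_ge0// sqrtr_sqr ger0_norm// hnorm_ge0.
Qed.

Lemma hnormZ (c : R[i]) f : L2 m f ->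
  hnorm (fun x => c * f x) = Num.sqrt (nsq c) * hnorm f.
Proof.
move=> fi; rewrite /hnorm sqnZ; last exact: (L2_measurable fi).
by rewrite fineM ?sqn_fin//= sqrtrM// nsq_ge0.
Qed.

Lemma hnormN f : hnorm (fun x => - f x) = hnorm f.
Proof. by rewrite /hnorm /sqn; under eq_integral do rewrite nsqN. Qed.

Lemma nsq_cintegral_le f g : L2 m f -> L2 m g ->
  nsq (cintegral m (fun x => f x * g x)) <= (hnorm f * hnorm g) ^+ 2.
Proof.
move=> fi gi; have := cauchy_schwarz fi gi.
by rewrite !sqn_hnorm// -EFinM lee_fin exprMn.
Qed.

Lemma hnormD f g : L2 m f -> L2 m g ->
  hnorm (fun x => f x + g x) <= hnorm f + hnorm g.
Proof.
move=> fi gi; rewrite -ler_sqr ?nnegrE ?addr_ge0 ?hnorm_ge0//.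
have e : (hnorm (fun x => f x + g x) ^+ 2)%:C =
    ip m f f + ip m f g + (ip m g f + ip m g g).
  rewrite hnorm_sqr -ipxx; last exact: L2D.
  by rewrite ipDr ?ipDl//; [rewrite addrACA|exact: L2D].
have eR : hnorm (fun x => f x + g x) ^+ 2 =
    hnorm f ^+ 2 + hnorm g ^+ 2 + 2 * complex.Re (ip m f g).
  move: e; rewrite -(ipJ fi gi) !ipxx// -!hnorm_sqr => /(congr1 (@complex.Re R)) /= ->.
  by case: (ip m f g) => a b /=; ring.
have : complex.Re (ip m f g) <= hnorm f * hnorm g.
  have := nsq_cintegral_le (L2J fi) gi; rewrite /ip /pairing.
  rewrite (_ : hnorm (fun x => (f x)^*) = hnorm f); last by rewrite /hnorm sqnJ.
  case: (cintegral _ _) => a b; rewrite /nsq /= => h.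
  have := mulr_ge0 (hnorm_ge0 f) (hnorm_ge0 g).
  by have := sqr_ge0 b; nra.
rewrite eR; nra.
Qed.

Lemma hnormB f g : L2 m f -> L2 m g -> `|hnorm f - hnorm g| <= hnorm (fun x => f x - g x).
Proof.
move=> fi gi; rewrite ler_distlC; apply/andP; split.
- rewrite lerBlDr; have := hnormD gi (L2B fi gi).
  by rewrite (_ : (fun x => _) = f)//; apply/funext => x; ring.
- have := hnormD fi (L2N (L2B fi gi)).
  by rewrite hnormN (_ : (fun x => _) = g)//; apply/funext => x; ring.
Qed.

Definition L2cvg (g : nat -> T -> R[i]) f :=
  (fun n => hnorm (fun x => g n x - f x)) @ \oo --> (0 : R).

Lemma L2cvg_hnorm (g : nat -> T -> R[i]) f : (forall n, L2 m (g n)) -> L2 m f ->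
  L2cvg g f -> (fun n => hnorm (g n)) @ \oo --> hnorm f.
Proof.
move=> gi fi gf; apply/cvgrPdist_le => e e0.
move/cvgrPdist_le : gf => /(_ _ e0); apply: filterS => n /=.
rewrite sub0r normrN (ger0_norm (hnorm_ge0 _)); apply: le_trans.
by rewrite distrC; exact: hnormB.
Qed.

(** Dominated convergence, with |f|^2 as the bound. *)
Lemma L2cvg_trunc f (P : nat -> T -> bool) : L2 m f ->
  (forall n, measurable_fun setT (P n)) -> (forall x, \forall n \near \oo, P n x) ->
  L2cvg (fun n x => if P n x then f x else 0) f /\
  (forall n, L2 m (fun x => if P n x then f x else 0)).
Proof.
move=> fi mP Px; have mf := L2_measurable fi; have [_ ff] := (L2P m f).1 fi.
have fni n : L2 m (fun x => if P n x then f x else 0).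
  apply: L2_dominated fi _.
  - by apply: cmeasurable_if => //; exact: cmeasurable_cst.
  - by move=> x; case: ifP => // _; rewrite nsq0 nsq_ge0.
split => //; have di n := L2B (fni n) fi.
pose f_ n x := ((nsq ((if P n x then f x else 0) - f x))%:E : \bar R).
have mf_ n : measurable_fun setT (f_ n) by exact: cmeasurable_ensq (L2_measurable (di n)).
have cv : {ae m, forall x, setT x -> f_ ^~ x @ \oo --> cst 0%E x}.
  apply: aeW => x _; apply: cvg_near_cst; apply: filterS (Px x) => n Pn.
  by rewrite /f_ Pn subrr nsq0.
have dm : {ae m, forall x n, setT x -> (`|f_ n x| <= (nsq (f x))%:E)%E}.
  apply: aeW => x n _; rewrite /f_ gee0_abs ?lee_fin ?nsq_ge0//.
  by case: ifP => _; rewrite ?subrr ?nsq0 ?nsq_ge0// sub0r nsqN.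
have gi : m.-integrable setT (fun x => (nsq (f x))%:E).
  apply/integrableP; split; first exact: cmeasurable_ensq.
  by under eq_integral do rewrite gee0_abs ?lee_fin ?nsq_ge0//.
have [_ _] := dominated_convergence measurableT mf_ (measurable_cst _) cv gi dm.
rewrite integral0 => /fine_cvgP[_ /cvgrPdist_le h]; apply/cvgrPdist_le => e e0.
have e20 : 0 < e ^+ 2 by rewrite exprn_gt0.
apply: filterS (h _ e20) => n /=; rewrite !sub0r !normrN.
rewrite -/(sqn m _) -hnorm_sqr ger0_norm ?sqr_ge0// ger0_norm ?hnorm_ge0//.
by rewrite ler_sqr ?nnegrE ?(ltW e0) ?hnorm_ge0.
Qed.

Lemma ae_eq_hnorm f g : cmeasurable f -> cmeasurable g ->
  f = g %[ae m] -> hnorm f = hnorm g.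
Proof. by move=> mf mg fg; rewrite /hnorm (ae_eq_sqn mf mg fg). Qed.

Lemma hnorm0_ae f : L2 m f -> hnorm f = 0 -> f = (fun=> 0) %[ae m].
Proof.
move=> fi f0.
have /(ae_eq_integral_abs m measurableT (cmeasurable_ensq (L2_measurable fi))) :
    (\int[m]_x `| (nsq (f x))%:E | = 0)%E.
  under eq_integral do rewrite gee0_abs ?lee_fin ?nsq_ge0//.
  by rewrite -/(sqn m f) (sqn_hnorm fi) f0 expr0n.
by apply: filterS => x /= /[apply] -[]; exact: nsq_eq0.
Qed.

Lemma ae_eq_L2 f g : L2 m f -> cmeasurable g -> f = g %[ae m] -> L2 m g.
Proof.
move=> /L2P[mf fi] mg fg; apply/L2P; split => //.
by rewrite -(ae_eq_sqn mf mg fg).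
Qed.

End hilbert_norm.

Section completeness.
Context {R : realType} d (T : measurableType d) (m : {measure set T -> \bar R}).

(** The increments are O((3/4)^k), because 2^-k is at most (3/4)^(2k). *)
Lemma geometric_increments_cvg (b : nat -> R) (s : R) :
  (forall k, 2 ^+ k * (b k.+1 - b k) ^+ 2 <= s) -> cvgn b.
Proof.
move=> bs; have s0 : 0 <= s by apply: le_trans (bs 0%N); rewrite mulr_ge0// sqr_ge0.
have -> : b = (fun n => b 0%N + series (telescope b) n).
  by apply/funext => n; exact: eq_sum_telescope.
apply: is_cvgD; first exact: is_cvg_cst.
apply: normed_cvg.
apply: (@series_le_cvg _ _ (geometric (Num.sqrt s) (3 / 4))).
- by move=> n /=.
- by move=> n; apply: geometric_ge0; rewrite ?sqrtr_ge0//; lra.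
- move=> n /=; rewrite -ler_sqr ?nnegrE//.
  rewrite real_normK ?num_real// exprMn sqr_sqrtr// -exprM mulnC exprM.
  have p2 : (0 : R) < 2 ^+ n by rewrite exprn_gt0.
  rewrite -(ler_pM2l p2) (le_trans (bs n))// mulrCA -exprMn ler_peMr// exprn_ege1//.
  by lra.
- by apply: is_cvg_geometric_series; rewrite ger0_norm; lra.
Qed.

Lemma limn_einf_le (u : nat -> \bar R) (c : \bar R) :
  (exists N, forall n, (N <= n)%N -> (u n <= c)%E) -> (limn_einf u <= c)%E.
Proof.
move=> [N uc]; rewrite limn_einf_lim; apply: lime_le; first exact: is_cvg_einfs.
exists N => // n /= Nn; apply: le_trans (uc n Nn).
by apply: ereal_inf_lbound; exists n => /=.
Qed.

Lemma nsq_cvg (z l : R[i]) (w : nat -> R[i]) :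
  (fun k => complex.Re (w k)) @ \oo --> complex.Re l ->
  (fun k => complex.Im (w k)) @ \oo --> complex.Im l ->
  (fun k => (nsq (z - w k))%:E) @ \oo --> (nsq (z - l))%:E.
Proof.
move=> cR cI; rewrite (_ : (fun k => _) = EFin \o (fun k =>
  (complex.Re z - complex.Re (w k)) ^+ 2 +
  (complex.Im z - complex.Im (w k)) ^+ 2)); last first.
  by apply/funext => k /=; rewrite nsqB.
apply: cvg_EFin; first by exists 0%N.
have sq (u : nat -> R) (c a : R) : u @ \oo --> c ->
    (fun k => (a - u k) ^+ 2) @ \oo --> (a - c) ^+ 2.
  by move=> uc; have h : (fun k => a - u k) @ \oo --> a - c;
    [by apply: cvgB => //; exact: cvg_cst|exact: (cvgM h h)].
by rewrite nsqB; apply: cvgD; exact: sq.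
Qed.

(** Riesz-Fischer. Along a subsequence s with ||g_s(k+1) - g_s(k)|| <=
    2^-k, the weighted sum S = sum_k 2^k |g_s(k+1) - g_s(k)|^2 has a finite
    integral. Where S is finite, that is almost everywhere, the subsequence
    has geometric increments and converges; the lemma of Fatou turns this
    into convergence in norm. *)
Lemma L2_complete (g : nat -> T -> R[i]) : (forall n, L2 m (g n)) ->
  (forall e : R, 0 < e -> exists N, forall n k, (N <= n)%N -> (N <= k)%N ->
     hnorm m (fun x => g n x - g k x) <= e) ->
  exists2 v, L2 m v & L2cvg m g v.
Proof.
move=> gi gc.
have /choice[N0 N0P] : forall k, exists N, forall n j, (N <= n)%N -> (N <= j)%N ->
    hnorm m (fun x => g n x - g j x) <= 2^-1 ^+ k.
  by move=> k; apply: gc; rewrite exprn_gt0.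
pose s k := (\sum_(i < k.+1) N0 i + k)%N.
have sN k : (N0 k <= s k)%N.
  by rewrite /s big_ord_recr /= -addnA addnCA leq_addr.
have sS k : (s k <= s k.+1)%N.
  by rewrite /s [X in (_ <= X + _)%N]big_ord_recr /= leq_add// leq_addr.
pose a k x := g (s k.+1) x - g (s k) x.
have ai k : L2 m (a k) by exact: L2B.
pose t k x := ((2 ^+ k * nsq (a k x))%:E : \bar R).
have t0 k x : (0 <= t k x)%E by rewrite lee_fin mulr_ge0 ?exprn_ge0// nsq_ge0.
have mt k : measurable_fun setT (t k).
  apply/measurable_EFinP; apply: measurable_funM => //.
  exact/cmeasurable_nsq/(L2_measurable (ai k)).
pose S x := (\sum_(k <oo) t k x)%E.
have mS : measurable_fun setT S.
  by apply: ge0_emeasurable_sum => // k x _ _.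
have Sfin : (\int[m]_x S x < +oo)%E.
  rewrite /S integral_nneseries//.
  apply: (@le_lt_trans _ _ (\sum_(k <oo) (geometric 1 2^-1 k)%:E)%E).
    apply: lee_nneseries => [k _ _|k _]; first exact: integral_ge0.
    rewrite /t; under eq_integral do rewrite EFinM.
    rewrite ge0_integralZl//;
      do ?[exact: (cmeasurable_ensq (L2_measurable (ai k)))
          |by move=> x _; rewrite lee_fin nsq_ge0|by rewrite lee_fin exprn_ge0].
    rewrite -/(sqn m (a k)) (sqn_hnorm (ai k)) -EFinM lee_fin /= mul1r.
    have h := N0P k (s k.+1) (s k) (leq_trans (sN k) (sS k)) (sN k).
    have : hnorm m (a k) ^+ 2 <= (2^-1 ^+ k) ^+ 2.
      by rewrite ler_sqr ?nnegrE ?hnorm_ge0// exprn_ge0.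
    move=> /(ler_wpM2l (_ : 0 <= 2 ^+ k)) => /(_ (exprn_ge0 _ (ler0n _ _))) /le_trans; apply.
    by rewrite expr2 mulrA -exprMn mulfV// expr1n mul1r.
  have : cvgn (series (geometric (1 : R) 2^-1)).
    by apply: is_cvg_geometric_series; rewrite ger0_norm; lra.
  move=> h; rewrite (_ : (\sum_(k <oo) _)%E = (limn (series (geometric (1:R) 2^-1)))%:E) ?ltry//.
  rewrite -EFin_lim//; congr (limn _); apply/funext => n.
  by rewrite /series /= sumEFin.
have Sae : {ae m, forall x, (S x < +oo)%E}.
  have : m.-integrable setT S.
    apply/integrableP; split => //.
    by under eq_integral do rewrite gee0_abs ?nneseries_ge0//.
  move=> /(integrable_ae measurableT); apply: filterS => x /(_ I).
  by rewrite ge0_fin_numE// nneseries_ge0.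
(* Replacing the functions by 0 where S is infinite makes the subsequence
   converge everywhere, which gives a measurable limit. *)
pose E x := (S x < +oo)%E.
have mE : measurable_fun setT E.
  by apply: measurable_fun_lte.
pose g' n x := if E x then g n x else 0.
have mg' n : cmeasurable (g' n).
  by apply: cmeasurable_if => //; exact: (L2_measurable (gi _)).
have gg' n : g n = g' n %[ae m].
  by apply: filterS Sae => x Sx _; rewrite /g' /E Sx.
have gi' n : L2 m (g' n) by apply: ae_eq_L2 (gi n) _ (gg' n).
have bound x k : E x -> 2 ^+ k * nsq (a k x) <= fine (S x).
  move=> Ex; rewrite -lee_fin fineK; last by rewrite ge0_fin_numE// nneseries_ge0.
  have := @nneseries_lim_ge R (t ^~ x) xpredT 0 k.+1.
  rewrite big_nat_recr//=; move=> h; apply: le_trans (h _) => //.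
  by rewrite leeDr// sume_ge0.
have cR x : cvgn (fun k => complex.Re (g' (s k) x)).
  rewrite /g'; case: (boolP (E x)) => Ex; last exact: is_cvg_cst.
  apply: (@geometric_increments_cvg _ (fine (S x))) => k.
  apply: le_trans (bound x k Ex); rewrite ler_pM2l ?exprn_gt0// /nsq /a.
  by case: (g _ x) (g _ x) => [? ?] [? ?] /=; rewrite lerDl sqr_ge0.
have cI x : cvgn (fun k => complex.Im (g' (s k) x)).
  rewrite /g'; case: (boolP (E x)) => Ex; last exact: is_cvg_cst.
  apply: (@geometric_increments_cvg _ (fine (S x))) => k.
  apply: le_trans (bound x k Ex); rewrite ler_pM2l ?exprn_gt0// /nsq /a.
  by case: (g _ x) (g _ x) => [? ?] [? ?] /=; rewrite lerDr sqr_ge0.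
pose v x := limn (fun k => complex.Re (g' (s k) x)) +i*
            limn (fun k => complex.Im (g' (s k) x)).
have mv : cmeasurable v.
  split.
  - apply: (@measurable_fun_cvg _ _ R setT (fun k x => complex.Re (g' (s k) x))) => //.
    by move=> k; exact: (mg' _).1.
  - apply: (@measurable_fun_cvg _ _ R setT (fun k x => complex.Im (g' (s k) x))) => //.
    by move=> k; exact: (mg' _).2.
have fat n c : (exists K, forall k, (K <= k)%N -> hnorm m (fun x => g n x - g (s k) x) <= c) ->
    (sqn m (fun x => g' n x - v x)%R <= (c ^+ 2)%:E)%E.
  move=> [K Kc].
  have c0 : 0 <= c by apply: le_trans (Kc K (leqnn _)); exact: hnorm_ge0.
  pose h k x := (nsq (g' n x - g' (s k) x))%:E.
  have mh k : measurable_fun setT (h k) by exact/cmeasurable_ensq/cmeasurableB.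
  have -> : sqn m (fun x => g' n x - v x) = (\int[m]_x limn_einf (h ^~ x))%E.
    apply: eq_integral => x _; apply/esym.
    have [|-> _//] := @cvg_limn_einf_sup R (h ^~ x) (nsq (g' n x - v x))%:E.
    by apply: nsq_cvg; [exact: cR|exact: cI].
  apply: le_trans (fatou _ _ _ _) _ => //.
    by move=> k x _; rewrite lee_fin nsq_ge0.
  apply: limn_einf_le; exists K => k Kk.
  have -> : (\int[m]_x h k x)%E = sqn m (fun x => g n x - g (s k) x).
    apply: ae_eq_sqn; [exact: cmeasurableB| |].
      by apply: cmeasurableB; exact: (L2_measurable (gi _)).
    by apply: filterS Sae => x Sx _; rewrite /g' /E Sx.
  rewrite sqn_hnorm; last exact: L2B.
  by rewrite lee_fin ler_sqr ?nnegrE ?hnorm_ge0// Kc.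
have key e : 0 < e -> exists N, forall n, (N <= n)%N ->
    (sqn m (fun x => g' n x - v x)%R <= (e ^+ 2)%:E)%E.
  move=> e0; have [N Ne] := gc e e0; exists N => n Nn; apply: fat.
  exists N => k Nk; apply: Ne => //; apply: leq_trans Nk _.
  by rewrite /s leq_addl.
have di n e : (sqn m (fun x => g' n x - v x)%R <= (e ^+ 2)%:E)%E ->
    L2 m (fun x => g' n x - v x).
  move=> h; apply/L2P; split; first exact: cmeasurableB.
  by apply: le_lt_trans h _; rewrite ltry.
have vi : L2 m v.
  have [N NP] := key 1 ltr01.
  rewrite (_ : v = (fun x => g' N x - (g' N x - v x))); last by apply/funext => x; ring.
  by apply: L2B => //; apply: (di _ 1); exact: NP.
exists v => //; apply/cvgrPdist_le => e e0.
have [N NP] := key e e0; exists N => // n /= Nn.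
rewrite sub0r normrN (ger0_norm (hnorm_ge0 _ _)).
rewrite (@ae_eq_hnorm _ _ _ m _ (fun x => g' n x - v x)).
- rewrite -ler_sqr ?nnegrE ?hnorm_ge0 ?(ltW e0)// -lee_fin -sqn_hnorm; first exact: NP.
  by apply: (di _ e); exact: NP.
- by apply: cmeasurableB => //; exact: (L2_measurable (gi _)).
- exact: cmeasurableB.
- by apply: filterS Sae => x Sx _; rewrite /g' /E Sx.
Qed.

End completeness.

(** * Product measures and measure-preserving maps *)

Section product.
Context {R : realType} d1 d2 (T1 : measurableType d1) (T2 : measurableType d2).
Variables (m1 : {sigma_finite_measure set T1 -> \bar R}).
Variables (m2 : {sigma_finite_measure set T2 -> \bar R}).

(** A name for the product that carries its sigma-finite structure, so that
    products can be iterated. *)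
Definition prodm : set (T1 * T2) -> \bar R := (m1 \x m2)%E.

HB.instance Definition _ := Measure.on prodm.
HB.instance Definition _ := Measure_isSigmaFinite.Build _ _ _ prodm
  (sigma_finite_product m1 m2).

Implicit Types F : T1 * T2 -> R[i].

Lemma cmeasurable_sec1 F x : cmeasurable F -> cmeasurable (fun y => F (x, y)).
Proof. by move=> mF; apply: cmeasurable_comp mF _; exact: pair1_measurable. Qed.

Lemma cmeasurable_sec2 F y : cmeasurable F -> cmeasurable (fun x => F (x, y)).
Proof. by move=> mF; apply: cmeasurable_comp mF _; exact: pair2_measurable. Qed.

Lemma measurable_Rintegral1 (f : T1 * T2 -> R) : measurable_fun setT f ->
  measurable_fun setT (fun x => \int[m2]_y f (x, y)).
Proof.
move=> mf; have mf' : measurable_fun setT (EFin \o f) by exact/measurable_EFinP.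
apply: measurableT_comp => //.
rewrite (_ : (fun x => _) = (fun x => \int[m2]_y ((EFin \o f)^\+ (x, y)) -
   \int[m2]_y ((EFin \o f)^\- (x, y)))%E).
  apply: emeasurable_funB.
  - by apply: measurable_fun_fubini_tonelli_F => //; exact: measurable_funepos.
  - by apply: measurable_fun_fubini_tonelli_F => //; exact: measurable_funeneg.
by apply/funext => x; rewrite integralE; congr (_ - _)%E;
  apply: eq_integral => y _; rewrite ?funeposE ?funenegE.
Qed.

Lemma measurable_Rintegral2 (f : T1 * T2 -> R) : measurable_fun setT f ->
  measurable_fun setT (fun y => \int[m1]_x f (x, y)).
Proof.
move=> mf; have mf' : measurable_fun setT (EFin \o f) by exact/measurable_EFinP.
apply: measurableT_comp => //.
rewrite (_ : (fun x => _) = (fun y => \int[m1]_x ((EFin \o f)^\+ (x, y)) -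
   \int[m1]_x ((EFin \o f)^\- (x, y)))%E).
  apply: emeasurable_funB.
  - by apply: measurable_fun_fubini_tonelli_G => //; exact: measurable_funepos.
  - by apply: measurable_fun_fubini_tonelli_G => //; exact: measurable_funeneg.
by apply/funext => x; rewrite integralE; congr (_ - _)%E;
  apply: eq_integral => y _; rewrite ?funeposE ?funenegE.
Qed.

Lemma cmeasurable_cintegral1 F : cmeasurable F ->
  cmeasurable (fun x => cintegral m2 (fun y => F (x, y))).
Proof.
move=> [F1 F2]; split => /=.
- exact: (measurable_Rintegral1 F1).
- exact: (measurable_Rintegral1 F2).
Qed.

Lemma cmeasurable_cintegral2 F : cmeasurable F ->
  cmeasurable (fun y => cintegral m1 (fun x => F (x, y))).
Proof.
move=> [F1 F2]; split => /=.
- exact: (measurable_Rintegral2 F1).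
- exact: (measurable_Rintegral2 F2).
Qed.

Lemma tonelli1 (f : T1 * T2 -> \bar R) : measurable_fun setT f ->
  (forall z, (0 <= f z)%E) -> (\int[prodm]_z f z = \int[m1]_x \int[m2]_y f (x, y))%E.
Proof. by move=> mf f0; exact: fubini_tonelli1. Qed.

Lemma tonelli2 (f : T1 * T2 -> \bar R) : measurable_fun setT f ->
  (forall z, (0 <= f z)%E) -> (\int[prodm]_z f z = \int[m2]_y \int[m1]_x f (x, y))%E.
Proof. by move=> mf f0; exact: fubini_tonelli2. Qed.

Lemma sqn_prod1 F : cmeasurable F ->
  sqn prodm F = (\int[m1]_x sqn m2 (fun y => F (x, y))%R)%E.
Proof.
move=> mF; rewrite /sqn tonelli1//; first exact: cmeasurable_ensq.
by move=> z; rewrite lee_fin nsq_ge0.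
Qed.

Lemma sqn_prod2 F : cmeasurable F ->
  sqn prodm F = (\int[m2]_y sqn m1 (fun x => F (x, y))%R)%E.
Proof.
move=> mF; rewrite /sqn tonelli2//; first exact: cmeasurable_ensq.
by move=> z; rewrite lee_fin nsq_ge0.
Qed.

Lemma measurable_sqn1 F : cmeasurable F ->
  measurable_fun setT (fun x => sqn m2 (fun y => F (x, y))).
Proof.
move=> mF; apply: (measurable_fun_fubini_tonelli_F (fun z => (nsq (F z))%:E)).
  exact: cmeasurable_ensq.
by move=> z; rewrite lee_fin nsq_ge0.
Qed.

Lemma measurable_sqn2 F : cmeasurable F ->
  measurable_fun setT (fun y => sqn m1 (fun x => F (x, y))).
Proof.
move=> mF; apply: (measurable_fun_fubini_tonelli_G (fun z => (nsq (F z))%:E)).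
  exact: cmeasurable_ensq.
by move=> z; rewrite lee_fin nsq_ge0.
Qed.

Lemma measurable_n11 F : cmeasurable F ->
  measurable_fun setT (fun x => \int[m2]_y (n1 (F (x, y)))%:E)%E.
Proof.
move=> mF; apply: (measurable_fun_fubini_tonelli_F (fun z => (n1 (F z))%:E)).
  exact: cmeasurable_en1.
by move=> z; rewrite lee_fin n1_ge0.
Qed.

Lemma measurable_n12 F : cmeasurable F ->
  measurable_fun setT (fun y => \int[m1]_x (n1 (F (x, y)))%:E)%E.
Proof.
move=> mF; apply: (measurable_fun_fubini_tonelli_G (fun z => (n1 (F z))%:E)).
  exact: cmeasurable_en1.
by move=> z; rewrite lee_fin n1_ge0.
Qed.

End product.

Lemma ae_lty {R : realType} d (T : measurableType d) (m : {measure set T -> \bar R})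
  (g : T -> \bar R) : measurable_fun setT g -> (forall x, (0 <= g x)%E) ->
  (\int[m]_x g x < +oo)%E -> {ae m, forall x, (g x < +oo)%E}.
Proof.
move=> mg g0 gi; have : m.-integrable setT g.
  apply/integrableP; split => //.
  by under eq_integral do rewrite gee0_abs//.
move=> /(integrable_ae measurableT); apply: filterS => x /(_ I).
by rewrite ge0_fin_numE.
Qed.

Section fubini.
Context {R : realType} d1 d2 (T1 : measurableType d1) (T2 : measurableType d2).
Variables (m1 : {sigma_finite_measure set T1 -> \bar R}).
Variables (m2 : {sigma_finite_measure set T2 -> \bar R}).
Implicit Types F : T1 * T2 -> R[i].

Lemma L2_sec1 F : L2 (prodm m1 m2) F -> {ae m1, forall x, L2 m2 (fun y => F (x, y))}.
Proof.
move=> /L2P[mF]; rewrite sqn_prod1// => Fi.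
have := ae_lty (measurable_sqn1 m2 mF) (fun x => sqn_ge0 _ _) Fi.
by apply: filterS => x xi; apply/L2P; split => //; exact: cmeasurable_sec1.
Qed.

Lemma L2_sec2 F : L2 (prodm m1 m2) F -> {ae m2, forall y, L2 m1 (fun x => F (x, y))}.
Proof.
move=> /L2P[mF]; rewrite sqn_prod2// => Fi.
have := ae_lty (measurable_sqn2 m1 mF) (fun x => sqn_ge0 _ _) Fi.
by apply: filterS => x xi; apply/L2P; split => //; exact: cmeasurable_sec2.
Qed.

Lemma L1_prodP1 F : cmeasurable F ->
  (\int[m1]_x \int[m2]_y (n1 (F (x, y)))%:E < +oo)%E -> L1 (prodm m1 m2) F.
Proof.
move=> mF Fi; split => //; rewrite tonelli1//; first exact: cmeasurable_en1.
by move=> z; rewrite lee_fin n1_ge0.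
Qed.

Let n1_int2 F : L1 (prodm m1 m2) F ->
  (\int[m2]_y \int[m1]_x (n1 (F (x, y)))%:E < +oo)%E.
Proof.
move=> [mF]; rewrite tonelli2//; first exact: cmeasurable_en1.
by move=> z; rewrite lee_fin n1_ge0.
Qed.

Lemma L1_sec2 F : L1 (prodm m1 m2) F -> {ae m2, forall y, L1 m1 (fun x => F (x, y))}.
Proof.
move=> Fi; have mF := Fi.1.
have := ae_lty (measurable_n12 m1 mF) (fun x => integral_ge0 _ _) (n1_int2 Fi).
move=> h; apply: filterS (h _) => [x xi|x y _]; last by rewrite lee_fin n1_ge0.
by split => //; exact: cmeasurable_sec2.
Qed.

Lemma cfubini1 F : L1 (prodm m1 m2) F ->
  cintegral (prodm m1 m2) F = cintegral m1 (fun x => cintegral m2 (fun y => F (x, y))).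
Proof.
move=> Fi; have [F1 F2] := L1_integrable Fi.
have h (f : T1 * T2 -> R) : (prodm m1 m2).-integrable setT (fun x => (f x)%:E) ->
    \int[prodm m1 m2]_z f z = \int[m1]_x \int[m2]_y f (x, y).
  move=> fi; rewrite {1}/Rintegral -(integral12_prod_meas1 fi) /fubini_F.
  congr fine; apply: ae_eq_integral => //.
  - exact: (measurable_fubini_F fi).
  - apply/measurable_EFinP; apply: measurable_Rintegral1.
    by apply/measurable_EFinP; exact: (measurable_int _ fi).
  - have := ae_integrable1 fi; apply: filterS => x /= xi _.
    by rewrite /Rintegral fineK// (integrable_fin_num _ xi).
by rewrite /cintegral !h.
Qed.

Lemma cfubini2 F : L1 (prodm m1 m2) F ->
  cintegral (prodm m1 m2) F = cintegral m2 (fun y => cintegral m1 (fun x => F (x, y))).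
Proof.
move=> Fi; have [F1 F2] := L1_integrable Fi.
have h (f : T1 * T2 -> R) : (prodm m1 m2).-integrable setT (fun x => (f x)%:E) ->
    \int[prodm m1 m2]_z f z = \int[m2]_y \int[m1]_x f (x, y).
  move=> fi; rewrite {1}/Rintegral -(integral21_prod_meas1 fi) /fubini_G.
  congr fine; apply: ae_eq_integral => //.
  - exact: (measurable_fubini_G fi).
  - apply/measurable_EFinP; apply: measurable_Rintegral2.
    by apply/measurable_EFinP; exact: (measurable_int _ fi).
  - have := ae_integrable2 fi; apply: filterS => x /= xi _.
    by rewrite /Rintegral fineK// (integrable_fin_num _ xi).
by rewrite /cintegral !h.
Qed.

End fubini.

Section measure_preserving.
Context {R : realType}.

(** phi transports m1 to m2, in the form of a change of variables that
    rewrites integrals directly. *)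
Definition mpres d1 d2 (T1 : measurableType d1) (T2 : measurableType d2)
    (m1 : {measure set T1 -> \bar R}) (m2 : {measure set T2 -> \bar R})
    (phi : T1 -> T2) :=
  measurable_fun setT phi /\
  forall f : T2 -> \bar R, measurable_fun setT f -> (forall x, (0 <= f x)%E) ->
    (\int[m2]_y f y = \int[m1]_x f (phi x))%E.

Section theory.
Context d1 d2 (T1 : measurableType d1) (T2 : measurableType d2).
Variables (m1 : {measure set T1 -> \bar R}) (m2 : {measure set T2 -> \bar R}).
Variable (phi : T1 -> T2).
Hypothesis phiP : mpres m1 m2 phi.

Lemma mpres_sqn (f : T2 -> R[i]) : cmeasurable f ->
  sqn m2 f = sqn m1 (fun x => f (phi x)).
Proof.
by move=> mf; apply: phiP.2; [exact: cmeasurable_ensq|move=> x; rewrite lee_fin nsq_ge0].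
Qed.

Lemma mpres_L2 (f : T2 -> R[i]) : L2 m2 f -> L2 m1 (fun x => f (phi x)).
Proof.
move=> /L2P[mf fi]; apply/L2P; rewrite -mpres_sqn//; split => //.
exact: cmeasurable_comp mf phiP.1.
Qed.

Lemma mpres_L1 (f : T2 -> R[i]) : L1 m2 f -> L1 m1 (fun x => f (phi x)).
Proof.
move=> [mf fi]; split; first exact: cmeasurable_comp mf phiP.1.
rewrite -(phiP.2 (fun x => (n1 (f x))%:E))//; first exact: cmeasurable_en1.
by move=> x; rewrite lee_fin n1_ge0.
Qed.

Lemma mpres_cintegral (f : T2 -> R[i]) : cmeasurable f ->
  cintegral m2 f = cintegral m1 (fun x => f (phi x)).
Proof.
have h (g : T2 -> R) : measurable_fun setT g -> \int[m2]_y g y = \int[m1]_x g (phi x).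
  move=> mg; have mg' : measurable_fun setT (EFin \o g) by exact/measurable_EFinP.
  rewrite /Rintegral; congr fine; rewrite integralE [RHS]integralE; congr (_ - _)%E.
  - rewrite (phiP.2 ((EFin \o g)^\+)%E)//; last exact: measurable_funepos.
    by apply: eq_integral => x _; rewrite !funeposE.
  - rewrite (phiP.2 ((EFin \o g)^\-)%E)//; last exact: measurable_funeneg.
    by apply: eq_integral => x _; rewrite !funenegE.
by move=> [f1 f2]; rewrite /cintegral (h _ f1) (h _ f2).
Qed.

Lemma mpres_ae (P : T2 -> Prop) : {ae m2, forall y, P y} -> {ae m1, forall x, P (phi x)}.
Proof.
move=> [N [mN N0 NP]]; exists (phi @^-1` N); split.
- by rewrite -[X in measurable X]setTI; exact: phiP.1.
- have := phiP.2 (fun y => (\1_N y)%:E); rewrite integral_indic// setIT N0 => -> //.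
  + rewrite (_ : (fun x => _) = (fun x => (\1_(phi @^-1` N) x)%:E))//.
    rewrite integral_indic ?setIT//.
    by rewrite -[X in measurable X]setTI; exact: phiP.1.
  + by apply/measurable_EFinP; exact: measurable_indic.
- by move=> x Px; apply: NP.
Qed.

End theory.

Lemma mpres_comp d1 d2 d3 (T1 : measurableType d1) (T2 : measurableType d2)
    (T3 : measurableType d3) (m1 : {measure set T1 -> \bar R})
    (m2 : {measure set T2 -> \bar R}) (m3 : {measure set T3 -> \bar R}) phi psi :
  mpres m1 m2 phi -> mpres m2 m3 psi -> mpres m1 m3 (fun x => psi (phi x)).
Proof.
move=> [mphi phiP] [mpsi psiP]; split; first exact: measurableT_comp.
by move=> f mf f0; rewrite psiP// phiP//; exact: measurableT_comp.
Qed.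

Section products.
Context d1 d2 (T1 : measurableType d1) (T2 : measurableType d2).
Variables (m1 : {sigma_finite_measure set T1 -> \bar R}).
Variables (m2 : {sigma_finite_measure set T2 -> \bar R}).

Lemma mpres_swap : mpres (prodm m1 m2) (prodm m2 m1) (fun z => (z.2, z.1)).
Proof.
have ms : measurable_fun setT (fun z : T1 * T2 => (z.2, z.1)).
  exact: measurable_swap.
split => // f mf f0; rewrite tonelli1// tonelli2//.
exact: (measurableT_comp mf ms).
Qed.

Lemma mpres_shear1 (h : T1 * T2 -> T1) : measurable_fun setT h ->
  (forall y, mpres m1 m1 (fun x => h (x, y))) ->
  mpres (prodm m1 m2) (prodm m1 m2) (fun z => (h z, z.2)).
Proof.
move=> mh hP; have ms : measurable_fun setT (fun z : T1 * T2 => (h z, z.2)).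
  exact: measurable_fun_pair.
split => // f mf f0; rewrite (tonelli2 m1 m2 mf f0).
rewrite (tonelli2 m1 m2 (f := fun z => f (h z, z.2)) (measurableT_comp mf ms) (fun z => f0 _)).
apply: eq_integral => y _.
by apply: (hP y).2 => //; exact: measurableT_comp mf (pair2_measurable _).
Qed.

Lemma mpres_shear2 (h : T1 * T2 -> T2) : measurable_fun setT h ->
  (forall x, mpres m2 m2 (fun y => h (x, y))) ->
  mpres (prodm m1 m2) (prodm m1 m2) (fun z => (z.1, h z)).
Proof.
move=> mh hP; have ms : measurable_fun setT (fun z : T1 * T2 => (z.1, h z)).
  exact: measurable_fun_pair.
split => // f mf f0; rewrite (tonelli1 m1 m2 mf f0).
rewrite (tonelli1 m1 m2 (f := fun z => f (z.1, h z)) (measurableT_comp mf ms) (fun z => f0 _)).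
apply: eq_integral => x _.
by apply: (hP x).2 => //; exact: measurableT_comp mf (pair1_measurable _).
Qed.

End products.

End measure_preserving.

(** * Fourier integrals and Plancherel pairs *)

Section plancherel_pairs.
Context {R : realType}.

Definition fourier d d' (T : measurableType d) (T' : measurableType d')
    (m : {measure set T -> \bar R}) (th : T -> T' -> R) (f : T -> R[i]) (xi : T') : R[i] :=
  cintegral m (fun x => cis (th x xi) * f x).

(** The Plancherel formula for the phase th with constant c, on functions
    that are both integrable and square-integrable. Keeping the phase and
    the two measures as parameters makes the formula stable under products
    and changes of variables, which carry it from the line to R^n and to
    phase space. *)
Definition plancherel d d' (T : measurableType d) (T' : measurableType d')
    (m : {measure set T -> \bar R}) (m' : {measure set T' -> \bar R})
    (th : T -> T' -> R) (c : R) :=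
  measurable_fun setT (fun p : T * T' => th p.1 p.2) /\
  forall f, L1 m f -> L2 m f -> (sqn m' (fourier m th f) = c%:E * sqn m f)%E.

Section theory.
Context d d' (T : measurableType d) (T' : measurableType d').
Variables (m : {sigma_finite_measure set T -> \bar R}).
Variables (th : T -> T' -> R).
Hypothesis mth : measurable_fun setT (fun p : T * T' => th p.1 p.2).

Lemma phase_sec1 xi : measurable_fun setT (fun x => th x xi).
Proof.
exact: (measurableT_comp mth (pair2_measurable xi)).
Qed.

Lemma cmeasurable_fourier f : cmeasurable f -> cmeasurable (fourier m th f).
Proof.
move=> mf; apply: (cmeasurable_cintegral2 m (F := fun p => cis (th p.1 p.2) * f p.1)).
apply: cmeasurableM; first exact: cmeasurable_cis.
exact: cmeasurable_comp mf measurable_fst.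
Qed.

Lemma L1_phase f xi : L1 m f -> L1 m (fun x => cis (th x xi) * f x).
Proof. by move=> fi; apply: L1_cis => //; exact: phase_sec1. Qed.

Lemma n1_fourier_le f xi : cmeasurable f ->
  ((n1 (fourier m th f xi))%:E <= 2%:E * \int[m]_x (n1 (f x))%:E)%E.
Proof.
(* The bound is infinite unless f is integrable. *)
move=> mf; have [fi|] := ltP (\int[m]_x (n1 (f x))%:E)%E +oo%E; last first.
  by rewrite leye_eq => /eqP ->; rewrite gt0_muley ?leey// lte_fin.
have Fi : L1 m f by [].
apply: (le_trans (n1_cintegral (L1_phase xi Fi))).
have m1 := cmeasurable_en1 mf; have m2 := cmeasurable_en1 (L1_phase xi Fi).1.
rewrite -ge0_integralZl//; last by move=> x _; rewrite lee_fin n1_ge0.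
apply: ge0_le_integral => //.
- by move=> x _; rewrite lee_fin n1_ge0.
- exact: emeasurable_funM.
- move=> x _; rewrite -EFinM lee_fin (le_trans (n1M _ _))//.
  by rewrite ler_wpM2r ?n1_ge0// n1_cis.
Qed.

Lemma fourierD f g xi : L1 m f -> L1 m g ->
  fourier m th (fun x => f x + g x) xi = fourier m th f xi + fourier m th g xi.
Proof.
move=> fi gi; rewrite /fourier -cintegralD; do ?exact: L1_phase.
by apply: eq_cintegral => x; rewrite mulrDr.
Qed.

Lemma fourierZ a f xi : L1 m f ->
  fourier m th (fun x => a * f x) xi = a * fourier m th f xi.
Proof.
move=> fi; rewrite /fourier -cintegralZ; last exact: L1_phase.
by apply: eq_cintegral => x; rewrite mulrCA.
Qed.

Lemma fourier_conj f xi : L1 m f ->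
  fourier m (fun x xi => - th x xi) f xi = (fourier m th (fun x => (f x)^*) xi)^*.
Proof.
move=> fi; rewrite /fourier -cintegralJ; last exact/L1_phase/L1J.
by apply: eq_cintegral => x; rewrite cisN rmorphM /= conjcK.
Qed.

End theory.

Lemma plancherel_opp d d' (T : measurableType d) (T' : measurableType d')
    (m : {sigma_finite_measure set T -> \bar R})
    (m' : {measure set T' -> \bar R}) th c :
  plancherel m m' th c -> plancherel m m' (fun x xi => - th x xi) c.
Proof.
move=> [mth P]; split; first exact: measurableT_comp.
move=> f f1 f2; rewrite (_ : fourier m _ f = (fun xi => (fourier m th (fun x => (f x)^*) xi)^*)).
  by rewrite sqnJ P ?sqnJ//; [exact: L1J|exact: L2J].
by apply/funext => xi; exact: fourier_conj.
Qed.

(** One variable is transformed at a time. The partial transform G in the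
    first variable has squared norm c1 ||f||^2 by Tonelli and is integrable
    in the second variable for every frequency, so that the second formula
    applies to almost every slice of G. *)
Lemma plancherel_prod d1 d1' d2 d2' (T1 : measurableType d1) (T1' : measurableType d1')
    (T2 : measurableType d2) (T2' : measurableType d2')
    (m1 : {sigma_finite_measure set T1 -> \bar R})
    (m1' : {sigma_finite_measure set T1' -> \bar R})
    (m2 : {sigma_finite_measure set T2 -> \bar R})
    (m2' : {sigma_finite_measure set T2' -> \bar R}) th1 th2 c1 c2 :
  0 <= c1 -> 0 <= c2 ->
  plancherel m1 m1' th1 c1 -> plancherel m2 m2' th2 c2 ->
  plancherel (prodm m1 m2) (prodm m1' m2')
    (fun x xi => th1 x.1 xi.1 + th2 x.2 xi.2) (c2 * c1).
Proof.
move=> c10 c20 [mth1 P1] [mth2 P2].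
have mth : measurable_fun setT (fun p : (T1 * T2) * (T1' * T2') =>
    th1 p.1.1 p.2.1 + th2 p.1.2 p.2.2).
  apply: measurable_funD.
  - apply: (measurableT_comp mth1 (g := fun p : (T1 * T2) * (T1' * T2') => (p.1.1, p.2.1))).
    by apply: measurable_fun_pair; apply: measurableT_comp.
  - apply: (measurableT_comp mth2 (g := fun p : (T1 * T2) * (T1' * T2') => (p.1.2, p.2.2))).
    by apply: measurable_fun_pair; apply: measurableT_comp.
split => // f f1 f2; have mf := f1.1.
pose G (p : T1' * T2) := fourier m1 th1 (fun x => f (x, p.2)) p.1.
have mG : cmeasurable G.
  apply: (cmeasurable_cintegral2 m1
    (F := fun q : T1 * (T1' * T2) => cis (th1 q.1 q.2.1) * f (q.1, q.2.2))).
  apply: cmeasurableM.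
  - apply: cmeasurable_cis.
    apply: (measurableT_comp mth1 (g := fun q : T1 * (T1' * T2) => (q.1, q.2.1))).
    by apply: measurable_fun_pair => //; apply: measurableT_comp.
  - apply: cmeasurable_comp mf _.
    by apply: measurable_fun_pair => //; apply: measurableT_comp.
have G1 xi : L1 m2 (fun y => G (xi, y)).
  apply: (@L1_dominated _ _ _ _ _ (fun y => 2%:E * \int[m1]_x (n1 (f (x, y)))%:E)%E).
  - exact: cmeasurable_sec1.
  - by apply: emeasurable_funM => //; exact: measurable_n12.
  - rewrite ge0_integralZl//; last 2 first.
    + exact: measurable_n12.
    + by move=> y _; apply: integral_ge0 => x _; rewrite lee_fin n1_ge0.
    rewrite -(tonelli2 m1 m2 (f := fun z => (n1 (f z))%:E)).
    + by rewrite lte_mul_pinfty//; exact: f1.2.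
    + exact: cmeasurable_en1.
    + by move=> z; rewrite lee_fin n1_ge0.
  - by move=> y; apply: n1_fourier_le => //; exact: cmeasurable_sec2.
have fourE xi : fourier (prodm m1 m2) (fun x xi => th1 x.1 xi.1 + th2 x.2 xi.2) f xi =
    fourier m2 th2 (fun y => G (xi.1, y)) xi.2.
  rewrite /fourier cfubini2; last first.
    by apply: (L1_phase (th := fun x xi => th1 x.1 xi.1 + th2 x.2 xi.2)).
  apply: ae_eq_cintegral.
  - apply: (cmeasurable_cintegral2 m1 (F := fun q => cis (th1 q.1 xi.1 + th2 q.2 xi.2) * f q)).
    apply: (L1_phase (th := fun x xi => th1 x.1 xi.1 + th2 x.2 xi.2) mth xi f1).1.
  - exact: (L1_phase mth2 xi.2 (G1 xi.1)).1.
  - apply: filterS (L1_sec2 f1) => y yi _.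
    rewrite -cintegralZ; last exact: (L1_phase mth1).
    by apply: eq_cintegral => x; rewrite /= cisD mulrCA mulrA.
have mfour : cmeasurable (fourier (prodm m1 m2) (fun x xi => th1 x.1 xi.1 + th2 x.2 xi.2) f).
  exact: cmeasurable_fourier.
have sG : sqn (prodm m1' m2) G = (c1%:E * sqn (prodm m1 m2) f)%E.
  rewrite sqn_prod2// sqn_prod2// -ge0_integralZl//; last 2 first.
  - exact: measurable_sqn2.
  - by move=> y _; exact: sqn_ge0.
  apply: ae_eq_integral => //.
  - exact: measurable_sqn2.
  - by apply: emeasurable_funM => //; exact: measurable_sqn2.
  - apply: filterS2 (L1_sec2 f1) (L2_sec2 f2) => y y1 y2 _.
    by rewrite -P1.
have G2 : L2 (prodm m1' m2) G.
  apply/L2P; split => //; rewrite sG lte_mul_pinfty//.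
  by have /L2P[] := f2.
rewrite EFinM -muleA -sG !sqn_prod1// -ge0_integralZl//; last 2 first.
- exact: measurable_sqn1.
- by move=> y _; exact: sqn_ge0.
apply: ae_eq_integral => //.
- exact: measurable_sqn1.
- by apply: emeasurable_funM => //; exact: measurable_sqn1.
- apply: filterS (L2_sec1 G2) => xi xi2 _.
  rewrite -P2//; apply: eq_integral => xi' _.
  by rewrite fourE.
Qed.

Lemma plancherel_mpres d1 d1' d2 d2' (T1 : measurableType d1) (T1' : measurableType d1')
    (T2 : measurableType d2) (T2' : measurableType d2')
    (m1 : {sigma_finite_measure set T1 -> \bar R})
    (m1' : {sigma_finite_measure set T1' -> \bar R})
    (m2 : {sigma_finite_measure set T2 -> \bar R})
    (m2' : {sigma_finite_measure set T2' -> \bar R}) th1 th2 c phi phi' :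
  mpres m1 m2 phi -> mpres m1' m2' phi' ->
  measurable_fun setT (fun p : T2 * T2' => th2 p.1 p.2) ->
  (forall x xi, th2 (phi x) (phi' xi) = th1 x xi) ->
  plancherel m1 m1' th1 c -> plancherel m2 m2' th2 c.
Proof.
move=> phiP phiP' mth2 thE [mth1 P1]; split => // f f1 f2.
rewrite (mpres_sqn phiP')//; last exact/cmeasurable_fourier/f1.1.
rewrite (mpres_sqn phiP) -?P1; [|exact: mpres_L1 f1|exact: mpres_L2 f2|exact: f1.1].
apply: eq_integral => xi _; congr (nsq _)%:E.
rewrite /fourier (mpres_cintegral phiP); last exact: (L1_phase mth2 _ f1).1.
by apply: eq_cintegral => x; rewrite thE.
Qed.

End plancherel_pairs.

(** * Continuity of translations in L^2(R) *)

Section translation_continuity.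
Context {R : realType}.
Local Notation leb := (@lebesgue_measure R).
Local Notation RR := (measurableTypeR R).

Lemma measurable_shift (a : R) : measurable_fun setT (fun x : RR => x + a : RR).
Proof. by apply: measurable_funD. Qed.

Lemma mpres_unique (phi : RR -> RR) : measurable_fun setT phi ->
  (forall a b : R, a <= b -> leb (phi @^-1` `]a, b]) = (b - a)%:E) -> mpres leb leb phi.
Proof.
move=> mphi h.
pose p : {measure set RR -> \bar R} :=
  measure_function_pushforward__canonical__measure_function_Measure leb mphi.
have pE A : measurable A -> leb A = p A.
  apply: lebesgue_measure_unique => _ [[a b]] _ <-.
  rewrite /p /= /pushforward.
  have [ab|ba] := leP a b.
    rewrite h// lebesgue_measure_itv/= lte_fin.
    by case: ltgtP ab => // -> _; rewrite subrr.
  by rewrite set_itv_ge ?preimage_set0 ?measure0// bnd_simp -leNgt ltW.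
split => // f mf f0.
rewrite (eq_measure_integral p); last by move=> A mA _; exact: pE.
by rewrite ge0_integral_pushforward// preimage_setT.
Qed.

Lemma mpres_shift (a : R) : mpres leb leb (fun x : RR => x + a : RR).
Proof.
apply: mpres_unique => [|x y xy]; first exact: measurable_shift.
rewrite (_ : _ @^-1` _ = `]x - a, y - a]%classic); last first.
  by apply/seteqP; split => z /=; rewrite !in_itv/= ltrBlDr lerBrDr.
rewrite lebesgue_measure_itv/= lte_fin ltrD2r.
case: ltgtP xy => // [xy _|-> _]; last by rewrite subrr.
by rewrite -EFinB; congr EFin; ring.
Qed.

Lemma mpres_opp : mpres leb leb (fun x : RR => - x : RR).
Proof.
have mo : measurable_fun setT (fun x : RR => - x : RR) by exact: oppr_measurable.
split => // f mf f0.
pose p : {measure set RR -> \bar R} :=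
  measure_function_pushforward__canonical__measure_function_Measure leb mo.
rewrite (eq_measure_integral p).
  by rewrite ge0_integral_pushforward// preimage_setT.
by move=> A mA _; exact: esym (lebesgue_measureN mA).
Qed.

Lemma leb_itv_lty (a b : R) : (leb `[a, b] < +oo)%E.
Proof. by rewrite lebesgue_measure_itv /=; case: ifP => _; rewrite ?ltry. Qed.

Lemma integrable_itv (c a b : R) :
  leb.-integrable setT (fun x : RR => (c%:E * (\1_(`[a, b]) x)%:E)%E).
Proof.
apply: integrableZl => //; apply/integrableP; split.
  by apply/measurable_EFinP; exact: measurable_indic.
under eq_integral do rewrite gee0_abs ?lee_fin//.
by rewrite integral_indic// setIT; exact: leb_itv_lty.
Qed.

Definition tau (r : R) (f : R -> R[i]) (x : RR) := f (x + r).

Lemma L2_tau r f : L2 leb f -> L2 leb (tau r f).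
Proof. by move=> fi; exact: (mpres_L2 (mpres_shift r) fi). Qed.

Lemma hnorm_tau r f : cmeasurable (f : RR -> _) -> hnorm leb (tau r f) = hnorm leb f.
Proof. by move=> mf; rewrite /hnorm (mpres_sqn (mpres_shift r) mf). Qed.

Definition translation_cont (f : R -> R[i]) := forall e : R, 0 < e ->
  exists2 d : R, 0 < d & forall r : R, `|r| < d -> hnorm leb (fun x => tau r f x - f x) <= e.

Lemma translation_contD f g : L2 leb f -> L2 leb g -> translation_cont f -> translation_cont g ->
  translation_cont (fun x => f x + g x).
Proof.
move=> fi gi fc gc e e0.
have [d1 d10 h1] := fc (e / 2) (divr_gt0 e0 (ltr0n _ 2)).
have [d2 d20 h2] := gc (e / 2) (divr_gt0 e0 (ltr0n _ 2)).
exists (Num.min d1 d2); first by rewrite lt_min d10.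
move=> r; rewrite lt_min => /andP[/h1 r1 /h2 r2].
rewrite (_ : (fun x => _) = (fun x => (tau r f x - f x) + (tau r g x - g x))).
  have H := hnormD (L2B (L2_tau r fi) fi) (L2B (L2_tau r gi) gi).
  refine (le_trans H _). lra.
by apply/funext => x; rewrite /tau; ring.
Qed.

Lemma translation_contZ a f : L2 leb f -> translation_cont f -> translation_cont (fun x => a * f x).
Proof.
move=> fi fc e e0; set c := Num.sqrt (nsq a).
have c0 : 0 <= c by exact: sqrtr_ge0.
have [d d0 h] := fc (e / (c + 1)) (divr_gt0 e0 (ltr_wpDl c0 ltr01)).
exists d => // r /h rd.
rewrite (_ : (fun x => _) = (fun x => a * (tau r f x - f x))).
  rewrite hnormZ; last exact: L2B (L2_tau r fi) fi.
  rewrite -/c; apply: le_trans (ler_wpM2l c0 rd) _.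
  by rewrite mulrCA ler_piMr ?(ltW e0)// ler_pdivrMr; lra.
by apply/funext => x; rewrite /tau mulrBr.
Qed.

(** Translations are isometries: the usual argument with three thirds of
    epsilon. *)
Lemma translation_cont_lim f : L2 leb f ->
  (forall e : R, 0 < e -> exists g, [/\ L2 leb g, translation_cont g &
     hnorm leb (fun x => f x - g x) <= e]) -> translation_cont f.
Proof.
move=> fi fa e e0; have [|g [gi gc fg]] := fa (e / 3); first by rewrite divr_gt0.
have [|d d0 h] := gc (e / 3); first by rewrite divr_gt0.
exists d => // r /h rd; have di := L2B fi gi.
rewrite (_ : (fun x => _) = (fun x => tau r (fun x => f x - g x) x +
   ((tau r g x - g x) - (f x - g x)))); last by apply/funext => x; rewrite /tau; ring.
have gt := L2B (L2_tau r gi) gi.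
apply: le_trans (hnormD (L2_tau r di) (L2B gt di)) _.
have := hnormD gt (L2N di); rewrite hnormN hnorm_tau; last exact: (L2_measurable di).
lra.
Qed.

Lemma sqn_real (h : R -> R) : sqn leb (fun x => (h x)%:C) = (\int[leb]_x (h x ^+ 2)%:E)%E.
Proof. by apply: eq_integral => x _; rewrite nsqR. Qed.

Lemma L2_supported (h : R -> R) (k : R) : measurable_fun setT (h : RR -> RR) ->
  (forall x, `|h x| <= k) -> (forall x, k < `|x| -> h x = 0) ->
  L2 leb (fun x => (h x)%:C).
Proof.
move=> mh hk h0; apply/L2P; split; first exact: cmeasurableR.
rewrite sqn_real.
apply: (@le_lt_trans _ _ (\int[leb]_x ((k ^+ 2)%:E * (\1_(`[- k, k]) x)%:E))%E).
  apply: ge0_le_integral => //.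
  - by move=> x _; rewrite lee_fin sqr_ge0.
  - by apply/measurable_EFinP; exact: measurable_funX.
  - apply: emeasurable_funM => //; apply/measurable_EFinP; exact: measurable_indic.
  - move=> x _; rewrite -EFinM lee_fin indicE mem_setE in_itv /= -ler_norml.
    have [xk|/h0 ->] := leP `|x| k; last by rewrite expr0n mulr0.
    by rewrite mulr1 -real_normK ?num_real// ler_sqr ?nnegrE// (le_trans (normr_ge0 _) (hk x)).
rewrite ge0_integralZl ?lee_fin ?sqr_ge0//; last first.
  by apply/measurable_EFinP; exact: measurable_indic.
rewrite integral_indic// setIT lte_mul_pinfty ?lee_fin ?sqr_ge0//.
exact: leb_itv_lty.
Qed.

(** Dominated convergence along a sequence of translations tending to 0:
    the truncation of g is continuous except at the two points k and -k. *)
Lemma translation_cont_continuous (g : R -> R) (k : R) : 0 < k -> continuous g ->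
  (forall x, `|g x| <= k) -> translation_cont (fun x => (if `|x| <= k then g x else 0)%:C).
Proof.
move=> k0 gc gk; set h := fun x => _.
have mh : measurable_fun setT (fun x : RR => (if `|x| <= k then g x else 0) : RR).
  apply: measurable_fun_ifT => //.
  - by apply: measurable_fun_ler => //; exact: measurableT_comp.
  - exact: continuous_measurable_fun.
have hi : L2 leb h.
  apply: (@L2_supported _ k mh) => x.
  - by case: ifP => // _; rewrite normr0 ltW.
  - by move=> xk; rewrite leNgt xk.
move=> e e0; apply: contrapT => hn.
have /choice[r rP] : forall n, exists r : R, `|r| < n.+1%:R^-1 /\
    e < hnorm leb (fun x => tau r h x - h x).
  move=> n; apply: contrapT => rn; apply: hn; exists n.+1%:R^-1.
    by rewrite invr_gt0.
  by move=> r rd; rewrite leNgt; apply/negP => er; apply: rn; exists r.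
have r0 : r @ \oo --> (0 : R).
  apply/cvgrPdist_lt => d d0; near=> n; rewrite sub0r normrN.
  apply: lt_trans (rP n).1 _; near: n.
  exact: near_infty_natSinv_lt (PosNum d0).
have r1 n : `|r n| <= 1 by rewrite ltW// (lt_le_trans (rP n).1)// invf_le1// ler1n.
pose f_ n x := ((nsq (tau (r n) h x - h x))%:E : \bar R).
have mf_ n : measurable_fun setT (f_ n).
  by apply: (@cmeasurable_ensq _ _ RR); exact: (L2_measurable (L2B (L2_tau (r n) hi) hi)).
have gi : leb.-integrable setT (fun x => (((2 * k) ^+ 2)%:E * (\1_(`[- (k + 1), k + 1]) x)%:E)%E).
  exact: integrable_itv.
have hk x : nsq (h x) <= k ^+ 2.
  rewrite /h nsqR; case: ifP => _; last by rewrite expr0n /= sqr_ge0.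
  by rewrite -real_normK ?num_real// ler_sqr ?nnegrE// (ltW k0).
have cv : {ae leb, forall x, setT x -> f_ ^~ x @ \oo --> cst 0%E x}.
  have : leb.-negligible [set k; - k].
    by apply: negligibleU; [exists [set k]|exists [set - k]]; split => //;
      exact: lebesgue_measure_set1.
  apply: negligibleS => x /= /not_implyP[_]; apply: contra_notP => /not_orP[xk xNk].
  have xk' : `|x| != k.
    by apply/eqP => xk1; have [x0|x0] := leP 0 x; [apply: xk|apply: xNk];
      rewrite -xk1 ?(ger0_norm x0)// ltr0_norm// opprK.
  suff hx : (fun n => (if `|x + r n| <= k then g (x + r n) else 0)) @ \oo -->
      (if `|x| <= k then g x else 0).
    apply: cvg_EFin; first exact: nearW.
    rewrite (_ : _ \o _ = (fun n => ((if `|x + r n| <= k then g (x + r n) else 0) -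
       (if `|x| <= k then g x else 0)) ^+ 2)); last first.
      by apply/funext => n; rewrite /= /tau /h -rmorphB nsqR.
    have h1 : (fun n => (if `|x + r n| <= k then g (x + r n) else 0) -
       (if `|x| <= k then g x else 0)) @ \oo --> (0 : R).
      by rewrite -[X in _ --> X](subrr (if `|x| <= k then g x else 0)); apply: cvgB => //; exact: cvg_cst.
    by rewrite -[X in _ --> X](mulr0 0); exact: (cvgM h1 h1).
  have xr : (fun n => x + r n) @ \oo --> x.
    by rewrite -[X in _ --> X]addr0; apply: cvgD => //; exact: cvg_cst.
  case: ltgtP xk' => // xk1 _.
  + apply: cvg_trans (cvg_comp _ _ xr (gc x)); apply: near_eq_cvg.
    have : (fun n => `|x + r n|) @ \oo --> `|x| by exact: cvg_norm.
    move=> /cvgr_lt/(_ _ xk1); apply: filterS => n /= xn.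
    by rewrite ltW.
  + apply: cvg_near_cst.
    have : (fun n => `|x + r n|) @ \oo --> `|x| by exact: cvg_norm.
    move=> /cvgr_gt/(_ _ xk1); apply: filterS => n /= xn.
    by rewrite leNgt xn.
have dm : {ae leb, forall x n, setT x -> (`|f_ n x| <= ((2 * k) ^+ 2)%:E * (\1_(`[(- (k + 1))%R, (k + 1)%R]) x)%:E)%E}.
  apply: aeW => x n _; rewrite /f_ gee0_abs; last by rewrite lee_fin nsq_ge0.
  rewrite -EFinM lee_fin.
  rewrite indicE mem_setE in_itv /= -ler_norml.
  have [xk|xk] := leP `|x| (k + 1).
    rewrite mulr1; have := nsqD_le (tau (r n) h x) (- h x).
    by rewrite nsqN; have := hk (x + r n); have := hk x; rewrite /tau; nra.
  rewrite mulr0 /tau /h; have xk' : k < `|x| by lra.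
  have xrk : k < `|x + r n|.
    have := lerB_dist x (- r n); rewrite opprK normrN; have := r1 n; lra.
  by rewrite [`|x + r n| <= k]leNgt xrk [`|x| <= k]leNgt xk' /= subrr nsq0.
have [_ _] := dominated_convergence measurableT mf_ (measurable_cst _) cv gi dm.
rewrite integral0 => /fine_cvgP[_ /cvgrPdist_lt/(_ (e ^+ 2))].
rewrite exprn_gt0// => /(_ isT)[n _ /(_ n (leqnn n))] /=.
rewrite sub0r normrN; apply/negP; rewrite -leNgt.
rewrite -/(sqn leb _) -hnorm_sqr ger0_norm ?sqr_ge0// ler_sqr ?nnegrE ?(ltW e0) ?hnorm_ge0//.
exact: (ltW (rP n).2).
Unshelve. all: by end_near. Qed.

(** A bounded function of bounded support is close in L^1 to a continuous
    function. Clamping that function to [-k, k] does not increase its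
    distance to h, and makes the squared L^2 distance at most 2k times the
    L^1 distance. *)
Lemma translation_cont_bounded (h : R -> R) (k : R) : 0 < k ->
  measurable_fun setT (h : RR -> RR) ->
  (forall x, `|h x| <= k) -> (forall x, k < `|x| -> h x = 0) ->
  translation_cont (fun x => (h x)%:C).
Proof.
move=> k0 mh hk h0; have hi := L2_supported mh hk h0.
apply: translation_cont_lim => // e e0.
have ih : leb.-integrable `[- k, k] (EFin \o h).
  apply: measurable_bounded_integrable => //.
  - exact: leb_itv_lty.
  - exact: measurable_funTS.
  - by exists k; split; rewrite ?num_real// => M kM x _ /=; apply: le_trans (hk x) _; exact: ltW.
have [g_ [gc _ gh]] := approximation_continuous_integrable
  (measurable_itv `[- k, k]) (leb_itv_lty _ _) ih.
have [n nP] : exists n, (\int[leb]_(z in `[(- k)%R, k]) `|(h z - g_ n z)%:E| <= (e ^+ 2 / (2 * k))%:E)%E.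
  have ek : 0 < e ^+ 2 / (2 * k) by rewrite divr_gt0 ?exprn_gt0// mulr_gt0.
  move: gh => /fine_cvgP[[N1 _ h1] /cvgrPdist_le/(_ _ ek)[N2 _ h2]].
  exists (maxn N1 N2); have := h2 (maxn N1 N2) (leq_maxr _ _) => /=.
  rewrite sub0r normrN -lee_fin => H; apply: le_trans H.
  have f1 := h1 (maxn N1 N2) (leq_maxl _ _).
  by rewrite -[leLHS](fineK f1) lee_fin ler_norm.
(* The clamping of g_n to [-k, k]. *)
pose g x := (`|g_ n x + k| - `|g_ n x - k|) / 2.
have gE t : `|(`|t + k| - `|t - k|) / 2| <= k.
  rewrite normrM [X in _ * X]ger0_norm ?invr_ge0// ler_pdivrMr//.
  apply: (le_trans (ler_dist_dist _ _)).
  by rewrite (_ : _ - _ = k * 2); [rewrite ger0_norm// mulr_ge0// ltW|ring].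
have gS s t : `|s| <= k -> `|s - (`|t + k| - `|t - k|) / 2| <= `|s - t|.
  rewrite ler_norml => /andP[s1 s2].
  have [t1|t1] := leP t (- k).
    have h1 : t + k <= 0 by lra.
    have h2 : t - k <= 0 by lra.
    have h3 : 0 <= s + k by lra.
    have h4 : 0 <= s - t by lra.
    rewrite (ler0_norm h1) (ler0_norm h2) (_ : s - _ = s + k); last by field.
    by rewrite (ger0_norm h3) (ger0_norm h4); lra.
  have h1 : 0 <= t + k by lra.
  have [t2|t2] := leP t k.
    have h2 : t - k <= 0 by lra.
    by rewrite (ger0_norm h1) (ler0_norm h2) (_ : (_ - _) / 2 = t)//; field.
  have h2 : 0 <= t - k by lra.
  have h3 : s - k <= 0 by lra.
  have h4 : s - t <= 0 by lra.
  rewrite (ger0_norm h1) (ger0_norm h2) (_ : s - _ / 2 = s - k); last by field.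
  by rewrite (ler0_norm h3) (ler0_norm h4); lra.
have cg : continuous g.
  move=> x; apply: cvgM; last exact: cvg_cst.
  by apply: cvgB; apply: cvg_norm; [apply: cvgD|apply: cvgB]; try exact: cvg_cst; exact: gc.
exists (fun x => (if `|x| <= k then g x else 0)%:C).
have mg : measurable_fun setT (fun x : RR => (if `|x| <= k then g x else 0) : RR).
  apply: measurable_fun_ifT => //.
  - by apply: measurable_fun_ler => //; exact: measurableT_comp.
  - exact: continuous_measurable_fun.
have gi : L2 leb (fun x => (if `|x| <= k then g x else 0)%:C).
  apply: (L2_supported (k := k) mg) => x.
  - by case: ifP => _; rewrite ?gE// normr0 ltW.
  - by move=> xk; rewrite leNgt xk.
split => //.
  by apply: translation_cont_continuous => // x; exact: gE.
have di := L2B hi gi.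
rewrite -ler_sqr ?nnegrE ?hnorm_ge0 ?(ltW e0)// -lee_fin -sqn_hnorm//.
apply: (@le_trans _ _ ((2 * k)%:E * \int[leb]_(z in `[(- k)%R, k]) `|(h z - g_ n z)%:E|)%E); last first.
  apply: (le_trans (lee_wpmul2l _ nP)); first by rewrite lee_fin mulr_ge0// ltW.
  by rewrite -EFinM lee_fin mulrC divfK// mulf_neq0// gt_eqF.
have mgn : measurable_fun setT (g_ n : RR -> RR) by exact: continuous_measurable_fun.
have mn : measurable_fun setT (fun z : RR => `|(h z - g_ n z)%:E|%E).
  apply: (measurableT_comp (@abse_measurable R setT)); apply/measurable_EFinP.
  exact: measurable_funB.
rewrite -ge0_integralZl//; do ?[exact: measurable_funTS
  |by move=> z _; exact: abse_ge0|by rewrite lee_fin mulr_ge0// ltW].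
rewrite integral_mkcond; apply: ge0_le_integral => //.
- by move=> x _; rewrite lee_fin nsq_ge0.
- exact: cmeasurable_ensq (L2_measurable di).
- apply/(measurable_restrictT _ _).1 => //; apply: emeasurable_funM => //.
  exact: measurable_funTS.
- move=> x _; rewrite /patch mem_setE in_itv /= -ler_norml -rmorphB nsqR.
  have [xk|xk] := leP `|x| k; last by rewrite (h0 _ xk) subrr expr0n.
  rewrite -EFinM lee_fin -real_normK ?num_real// expr2.
  apply: ler_pM => //; last exact: gS.
  by apply: (le_trans (ler_normB _ _)); have := hk x; have := gE (g_ n x); rewrite /g; lra.
Qed.

(** Truncating f both in its argument and in its values reduces to the
    bounded case, for the real and the imaginary part separately. *)
Lemma translation_cont_L2 f : L2 leb f -> translation_cont f.
Proof.
move=> fi; have mf := L2_measurable fi; have [mf1 mf2] := mf.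
pose P n (x : RR) := (`|x| <= n%:R) && (n1 (f x) <= n%:R).
have mP n : measurable_fun setT (P n).
  apply: measurable_and.
  - by apply: measurable_fun_ler => //; exact: measurableT_comp.
  - by apply: measurable_fun_ler => //; exact: cmeasurable_n1.
have Pn x : \forall n \near \oo, P n x.
  near=> n; apply/andP; split; near: n; exact: nbhs_infty_ger.
have [cv fni] := L2cvg_trunc fi mP Pn.
apply: translation_cont_lim => // e e0.
move/cvgrPdist_le : cv => /(_ e e0)[n _ /(_ n.+1 (leqnSn n))].
rewrite /= sub0r normrN ger0_norm ?hnorm_ge0// => ne.
pose fn x := if P n.+1 x then f x else 0.
exists fn; split; first exact: fni; last first.
  rewrite -hnormN (_ : (fun x => _) = (fun x => fn x - f x))//.
  by apply/funext => x; rewrite opprB.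
have b (p : R[i] -> R) : (forall z, `|p z| <= n1 z) -> p 0 = 0 ->
    measurable_fun setT (fun x : RR => p (f x)) ->
    translation_cont (fun x => (p (fn x))%:C) /\ L2 leb (fun x => (p (fn x))%:C).
  move=> pn p0 mp.
  have h1 : measurable_fun setT (fun x : RR => p (fn x)).
    rewrite (_ : (fun x => _) = (fun x => if P n.+1 x then p (f x) else 0)).
      exact: measurable_fun_ifT.
    by apply/funext => x; rewrite /fn; case: ifP.
  have h2 x : `|p (fn x)| <= n.+1%:R.
    rewrite /fn /P; case: ifPn => [/andP[_ h]|_]; last by rewrite p0 normr0.
    exact: le_trans h.
  have h3 x : n.+1%:R < `|x| -> p (fn x) = 0.
    by rewrite /fn /P leNgt => -> /=.
  by split; [exact: (translation_cont_bounded (ltr0Sn _ n) h1 h2 h3)|exact: (L2_supported h1 h2 h3)].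
have [||c1 l1] := b (@complex.Re R) _ _ mf1; [by move=> z; rewrite lerDl|by []|].
have [||c2 l2] := b (@complex.Im R) _ _ mf2; [by move=> z; rewrite lerDr|by []|].
rewrite (_ : fn = (fun x => (complex.Re (fn x))%:C + 'i * (complex.Im (fn x))%:C)).
  by apply: translation_contD => //; [exact: L2Z|exact: translation_contZ].
by apply/funext => x; exact: complexE.
Unshelve. all: by end_near. Qed.

End translation_continuity.

(** * The Poisson kernel *)

Section derivatives.
Context {R : realType}.
Implicit Types (f g : R -> R) (x a b c : R).

Lemma is_deriveM_fun f g x a b : is_derive x 1 f a -> is_derive x 1 g b ->
  is_derive x 1 (fun t => f t * g t) (a * g x + f x * b).
Proof.
move=> fa gb; apply: (is_derive_eq (is_deriveM fa gb)).
by rewrite /GRing.scale /= addrC [g x * a]mulrC.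
Qed.

Lemma is_deriveB_fun f g x a b : is_derive x 1 f a -> is_derive x 1 g b ->
  is_derive x 1 (fun t => f t - g t) (a - b).
Proof. by move=> fa gb; exact: is_deriveB. Qed.

Lemma is_deriveZ_fun f x a c : is_derive x 1 f a ->
  is_derive x 1 (fun t => c * f t) (c * a).
Proof. by move=> fa; exact: is_deriveZ. Qed.

Lemma is_derive_lin x c : is_derive x 1 (fun t : R => c * t) c.
Proof. by apply: is_derive_eq (is_deriveZ_fun c (is_derive_id x 1)) _; rewrite mulr1. Qed.

Lemma is_derive_comp_lin f x a c : is_derive (c * x) 1 f a ->
  is_derive x 1 (fun t => f (c * t)) (a * c).
Proof.
move=> fa; apply: is_derive_eq (@is_derive1_comp _ f (fun t => c * t) x a c fa (is_derive_lin x c)) _.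
by rewrite ?[c *: _]/(c * _) ?[a *: _]/(a * _) 1?mulrC.
Qed.

Lemma is_deriveP f x a : is_derive x 1 f a -> derivable f x 1 /\ 'D_1 f x = a.
Proof. by case. Qed.

(** The fundamental theorem of calculus on the positive half-line, doubled
    by parity. The derivative of F has to agree with f there only: the
    integrands below involve |x|. *)
Lemma ge0_even_integral (f F g : R -> R) (l : R) : (forall x, 0 <= f x) ->
  continuous f -> (forall x, f (- x) = f x) ->
  (forall x, derivable F x 1 /\ 'D_1 F x = g x) -> (forall x, 0 < x -> g x = f x) ->
  F x @[x --> +oo] --> l ->
  (\int[@lebesgue_measure R]_x (f x)%:E = (2 * (l - F 0))%:E)%E.
Proof.
move=> f0 cf ef dF gf Fl.
rewrite ge0_symfun_integralT//; last by move=> x; rewrite /= ef.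
rewrite -set_itvcy (@ge0_continuous_FTC2y _ f F 0 l) -?EFinB ?EFinM//.
- exact: continuous_subspaceT.
- by move=> x _; exact: (dF x).1.
- apply: cvg_at_right_filter; apply: differentiable_continuous.
  apply/derivable1_diffP; exact: (dF 0).1.
- by move=> x; rewrite in_itv/= andbT => x0; rewrite derive1E -gf//; exact: (dF x).2.
Qed.

End derivatives.

Section poisson_kernel.
Context {R : realType}.
Local Notation leb := (@lebesgue_measure R).
Local Notation RR := (measurableTypeR R).

Definition abel (k xi : R) : R := expR (- (k * `|xi|)).
Definition poisson (k r : R) : R := 2 * k / (k ^+ 2 + r ^+ 2).

Lemma poisson_ge0 k r : 0 < k -> 0 <= poisson k r.
Proof.
move=> k0; rewrite /poisson divr_ge0// ?mulr_ge0 ?(ltW k0)//.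
by rewrite addr_ge0 ?sqr_ge0.
Qed.

Lemma continuous_abel k : continuous (abel k).
Proof.
move=> x; apply: continuous_comp; last exact: continuous_expR.
by apply: cvgN; apply: cvgM; [exact: cvg_cst|exact: cvg_norm].
Qed.

Lemma poisson_den_gt0 (k r : R) : 0 < k -> 0 < k ^+ 2 + r ^+ 2.
Proof. by move=> k0; rewrite ltr_wpDr ?sqr_ge0// exprn_gt0. Qed.

Lemma continuous_poisson k : 0 < k -> continuous (poisson k).
Proof.
move=> k0 x; apply: cvgM; first exact: cvg_cst.
apply: cvgV; first by rewrite gt_eqF// poisson_den_gt0.
by apply: cvgD; [exact: cvg_cst|exact: exprn_continuous].
Qed.

Lemma integral_poisson (k : R) : 0 < k -> (\int[leb]_r (poisson k r)%:E = (2 * pi)%:E)%E.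
Proof.
move=> k0; rewrite (@ge0_even_integral _ _ (fun r => 2 * atan (k^-1 * r)) (poisson k) pi)//.
- by rewrite mulr0 atan0 mulr0 subr0.
- by move=> r; exact: poisson_ge0.
- exact: continuous_poisson.
- by move=> r; rewrite /poisson sqrrN.
- move=> r; apply: is_deriveP.
  apply: (is_derive_eq (is_deriveZ_fun _ (is_derive_comp_lin (is_derive1_atan _)))).
  rewrite /poisson; have := poisson_den_gt0 r k0; set A := k ^+ 2 + _ => A0.
  have -> : 1 + (k^-1 * r) ^+ 2 = A / k ^+ 2 by rewrite /A; field; rewrite gt_eqF.
  by field; rewrite !gt_eqF.
- rewrite [X in _ --> X](_ : _ = 2 * (pi / 2)); last by field.
  apply: cvgM; first exact: cvg_cst.
  apply: (@cvg_comp _ _ _ (fun r => k^-1 * r) atan _ +oo); last exact: cvgy_atan.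
  by apply: gt0_cvgMry => //; rewrite invr_gt0.
Qed.

(** The cosine is shifted by 1 to make the integrand nonnegative, so that
    its integral can be computed before integrability is known. *)
Lemma integral_abel_cos (k r : R) : 0 < k ->
  (\int[leb]_xi (abel k xi * (1 + cos (r * xi)))%:E = (2 / k + poisson k r)%:E)%E.
Proof.
move=> k0; have A0 := poisson_den_gt0 r k0; set A := k ^+ 2 + r ^+ 2 in A0.
pose F xi := expR (- k * xi) * ((r / A) * sin (r * xi) - (k / A) * cos (r * xi) - k^-1).
rewrite (@ge0_even_integral _ _ F (fun xi => expR (- k * xi) * (1 + cos (r * xi))) 0).
- rewrite /F !mulr0 expR0 sin0 cos0; congr EFin; rewrite /poisson -/A.
  by field; rewrite !gt_eqF.
- by move=> x; rewrite mulr_ge0 ?expR_ge0//; have := cos_geN1 (r * x); lra.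
- move=> x; apply: cvgM; first exact: continuous_abel.
  apply: cvgD; first exact: cvg_cst.
  by apply: continuous_comp; [apply: cvgM => //; exact: cvg_cst|exact: continuous_cos].
- by move=> x; rewrite /abel normrN mulrN cosN.
- move=> x; apply: is_deriveP.
  apply: (is_derive_eq (is_deriveM_fun (is_derive_comp_lin (is_derive_expR (- k * x)))
    (is_deriveB_fun (is_deriveB_fun
      (is_deriveZ_fun (r / A) (is_derive_comp_lin (is_derive_sin (r * x))))
      (is_deriveZ_fun (k / A) (is_derive_comp_lin (is_derive_cos (r * x)))))
      (is_derive_cst k^-1 x 1)))).
  rewrite /=; set c := cos _; set s := sin _; set e := expR _.
  have -> : r / A * (c * r) - k / A * (- s * r) - 0 = (r ^+ 2 * c + k * r * s) / A.
    by field; rewrite gt_eqF.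
  rewrite {1}/A -/A; have AE : A = k ^+ 2 + r ^+ 2 by [].
  have kn : k != 0 by rewrite gt_eqF.
  have An : A != 0 by rewrite gt_eqF.
  have -> : e * - k * (r / A * s - k / A * c - k^-1) + e * ((r ^+ 2 * c + k * r * s) / A) =
     e * (1 + c * ((k ^+ 2 + r ^+ 2) / A)) by field; rewrite kn An.
  by rewrite -AE divff// mulr1.
- by move=> x x0; rewrite /abel gtr0_norm// mulNr.
- pose C := `|r / A| + `|k / A| + `|k^-1|.
  have e0 : (fun xi => C * expR (- (k * xi))) @ +oo --> (0 : R).
    rewrite -[X in _ --> X](mulr0 C); apply: cvgM; first exact: cvg_cst.
    apply: (@cvg_comp _ _ _ (fun x => k * x) (fun x => expR (- x)) _ +oo); last exact: cvgr_expR.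
    exact: gt0_cvgMry.
  apply: (@squeeze_cvgr _ _ _ _ (fun xi => - (C * expR (- (k * xi)))) (fun xi => C * expR (- (k * xi)))) => //.
    apply: nearW => x; rewrite -ler_norml /F normrM ger0_norm ?expR_ge0// mulNr mulrC.
    rewrite ler_wpM2r ?expR_ge0//; apply: (le_trans (ler_normB _ _)).
    rewrite lerD2r; apply: (le_trans (ler_normB _ _)).
    by apply: lerD; rewrite normrM ler_piMr// ?sin_max ?cos_max.
  by rewrite -[X in _ --> X]oppr0; exact: cvgN.
Qed.

Lemma measurable_abel k : measurable_fun setT (abel k : RR -> RR).
Proof. by apply: continuous_measurable_fun; exact: continuous_abel. Qed.

Lemma integral_abel (k : R) : 0 < k -> (\int[leb]_xi (abel k xi)%:E = (2 / k)%:E)%E.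
Proof.
move=> k0; have := integral_abel_cos 0 k0.
under eq_integral do rewrite mul0r cos0 mulrC EFinM.
rewrite ge0_integralZl//; last first.
- by move=> x _; rewrite lee_fin expR_ge0.
- by apply/measurable_EFinP; exact: measurable_abel.
have kn : k != 0 by rewrite gt_eqF.
rewrite (_ : 2 / k + poisson k 0 = (1 + 1) * (2 / k)); last first.
  by rewrite /poisson expr0n addr0; field.
case: (integral _ _ _) => [s| |]; rewrite ?gt0_muley ?gt0_muleNy ?lte_fin// -EFinM => -[h].
by congr EFin; apply: (mulfI _ h); rewrite -[1 + 1]/2%:R pnatr_eq0.
Qed.

Lemma L1_abel (k : R) : 0 < k -> L1 leb (fun xi : RR => (abel k xi)%:C).
Proof.
move=> k0; split; first by apply: cmeasurableR; exact: measurable_abel.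
rewrite (eq_integral (fun xi : RR => (abel k xi)%:E)) ?integral_abel ?ltry// => x _.
by rewrite /n1 /= normr0 addr0 ger0_norm ?expR_ge0.
Qed.

(** The transform is real by parity, and its real part is the difference of
    [integral_abel_cos] and [integral_abel]. *)
Lemma fourier_abel (k r : R) : 0 < k ->
  cintegral leb (fun xi : RR => cis (r * xi) * (abel k xi)%:C) = (poisson k r)%:C.
Proof.
move=> k0; set q := cintegral _ _.
have mr (s : R) : measurable_fun setT (fun x : RR => s * x : RR) by apply: measurable_funM.
have qi := L1_cis (L1_abel k0) (mr r).
have qJ : q = q^*.
  rewrite -(cintegralJ qi) /q (mpres_cintegral mpres_opp qi.1).
  apply: eq_cintegral => x.
  rewrite /abel normrN mulrN /cis cosN sinN; apply/eqP; rewrite eq_complex /=.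
  by apply/andP; split; apply/eqP; ring.
have qRe : complex.Re q = poisson k r.
  have wi : leb.-integrable setT (fun x => (abel k x)%:E).
    apply/integrableP; split; first by apply/measurable_EFinP; exact: measurable_abel.
    under eq_integral do rewrite gee0_abs ?lee_fin ?expR_ge0//.
    by rewrite integral_abel ?ltry.
  have [h1 _] := L1_integrable qi.
  have h : (\int[leb]_x ((abel k x)%:E + (complex.Re (cis (r * x) * (abel k x)%:C))%:E) =
       (2 / k + poisson k r)%:E)%E.
    rewrite -integral_abel_cos//; apply: eq_integral => x _.
    by rewrite -EFinD /=; congr EFin; ring.
  move: h; rewrite integralD// integral_abel//.
  have fi := integrable_fin_num measurableT h1.
  rewrite -[X in (_ + X)%E](fineK fi) -EFinD => -[/addrI].
  by [].
move: qJ qRe; case: (q) => a b /= [bN] ->.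
by congr (_ +i* _); lra.
Qed.

End poisson_kernel.

(** * The Plancherel formula on the line *)

Section tensor.
Context {R : realType} d1 d2 (T1 : measurableType d1) (T2 : measurableType d2).
Variables (m1 : {sigma_finite_measure set T1 -> \bar R}).
Variables (m2 : {sigma_finite_measure set T2 -> \bar R}).
Variables (a : T1 -> R[i]) (b : T2 -> R[i]).
Hypotheses (ai : L1 m1 a) (bi : L1 m2 b).

Lemma cmeasurable_tensor : cmeasurable (fun p : T1 * T2 => a p.1 * b p.2).
Proof.
apply: cmeasurableM.
- exact: cmeasurable_comp ai.1 measurable_fst.
- exact: cmeasurable_comp bi.1 measurable_snd.
Qed.

Lemma L1_tensor : L1 (prodm m1 m2) (fun p => a p.1 * b p.2).
Proof.
apply: L1_prodP1; first exact: cmeasurable_tensor.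
have [ma af] := ai; have [mb bf] := bi.
apply: (@le_lt_trans _ _ (\int[m1]_x ((n1 (a x))%:E * \int[m2]_y (n1 (b y))%:E))%E).
  apply: ge0_le_integral => //.
  - by move=> x _; apply: integral_ge0 => y _; rewrite lee_fin n1_ge0.
  - exact: (measurable_n11 m2 cmeasurable_tensor).
  - by apply: emeasurable_funM => //; exact: cmeasurable_en1.
  - move=> x _; rewrite -ge0_integralZl//; do ?[exact: cmeasurable_en1
      |by move=> y _; rewrite lee_fin n1_ge0|by rewrite lee_fin n1_ge0].
    apply: ge0_le_integral => //.
    + by move=> y _; rewrite lee_fin n1_ge0.
    + exact: (cmeasurable_en1 (cmeasurable_sec1 x cmeasurable_tensor)).
    + by apply: emeasurable_funM => //; exact: cmeasurable_en1.
    + by move=> y _; rewrite -EFinM lee_fin n1M.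
rewrite ge0_integralZr//; do ?[exact: cmeasurable_en1
  |by move=> y _; rewrite lee_fin n1_ge0].
- by rewrite lte_mul_pinfty ?integral_ge0// ?ge0_fin_numE ?integral_ge0// => x _; rewrite lee_fin n1_ge0.
- by apply: integral_ge0 => y _; rewrite lee_fin n1_ge0.
Qed.

Lemma cintegral_tensor :
  cintegral (prodm m1 m2) (fun p => a p.1 * b p.2) = cintegral m1 a * cintegral m2 b.
Proof.
rewrite (cfubini1 L1_tensor) mulrC -cintegralZ//.
by apply: eq_cintegral => x; rewrite /= cintegralZ// mulrC.
Qed.

End tensor.

Section plancherel_line.
Context {R : realType}.
Local Notation leb := (@lebesgue_measure R).
Local Notation RR := (measurableTypeR R).
Local Notation P := (prodm leb leb).
Local Notation th := (fun x xi : RR => x * xi : R).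

Lemma measurable_th : measurable_fun setT (fun p : RR * RR => p.1 * p.2 : RR).
Proof. by apply: measurable_funM. Qed.

Lemma poisson_even (k r : R) : poisson k (- r) = poisson k r.
Proof. by rewrite /poisson sqrrN. Qed.

Lemma measurable_poisson (k : R) : 0 < k -> measurable_fun setT (poisson k : RR -> RR).
Proof. by move=> k0; apply: continuous_measurable_fun; exact: continuous_poisson. Qed.

Lemma integral_poisson_shift (k x : R) : 0 < k ->
  (\int[leb]_y (poisson k (y - x))%:E = (2 * pi)%:E)%E.
Proof.
move=> k0; rewrite -(integral_poisson k0).
apply/esym/(mpres_shift (- x)).2.
- by apply/measurable_EFinP; exact: measurable_poisson.
- by move=> r; rewrite lee_fin poisson_ge0.
Qed.

Section identity.
Variables (f : RR -> R[i]) (k : R).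
Hypotheses (f1 : L1 leb f) (f2 : L2 leb f) (k0 : 0 < k).

Let K (z : RR * RR) : R := poisson k (z.1 - z.2).
Let mK : measurable_fun setT K.
Proof.
apply: (measurableT_comp (measurable_poisson k0) (g := fun z : RR * RR => z.1 - z.2 : RR)).
exact: measurable_funB.
Qed.

Let K_le z : K z <= 2 / k.
Proof.
rewrite /K /poisson ler_pdivrMr ?poisson_den_gt0//.
rewrite mulrDr (_ : 2 / k * k ^+ 2 = 2 * k); last by field; rewrite gt_eqF.
by rewrite lerDl mulr_ge0 ?sqr_ge0// divr_ge0// ltW.
Qed.

Let K_ge0 z : 0 <= K z.
Proof. exact: poisson_ge0. Qed.

Let fJ := L1J f1.

(** Fubini for the triple integral of e^{i (x - y) xi} f(x) conj(f(y))
    e^{-k |xi|}: integrating first in xi gives the left side, first in x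
    and y the right side. *)
Let abel_parseval :
  cintegral P (fun z => (f z.1 * conjc (f z.2)) * (K z)%:C) =
  (\int[leb]_xi (abel k xi * nsq (fourier leb th f xi)))%:C.
Proof.
pose F (p : (RR * RR) * RR) : R[i] :=
  cis ((p.1.1 - p.1.2) * p.2) * ((f p.1.1 * conjc (f p.1.2)) * (abel k p.2)%:C).
have FL : L1 (prodm P leb) F.
  apply: L1_cis.
    exact: (L1_tensor (L1_tensor f1 fJ) (L1_abel k0)).
  apply: measurable_funM => //; apply: measurable_funB; exact: measurableT_comp.
transitivity (cintegral (prodm P leb) F).
  rewrite [RHS](cfubini1 FL); apply: eq_cintegral => z; rewrite /F /=.
  rewrite -(fourier_abel _ k0) -cintegralZ.
    by apply: eq_cintegral => xi; rewrite mulrCA.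
  by apply: L1_cis (L1_abel k0) _; exact: measurable_funM.
rewrite (cfubini2 FL) -cintegralR; apply: eq_cintegral => xi.
have ph := L1_phase measurable_th xi f1.
have rcM (a b : R) : (a * b)%:C = a%:C * b%:C :> R[i] by exact: rmorphM.
rewrite rcM -mulJc [conjc _ * _]mulrC /fourier.
rewrite -(cintegralJ ph) -(cintegral_tensor ph (L1J ph)).
rewrite -cintegralZ; last exact: (L1_tensor ph (L1J ph)).
apply: eq_cintegral => z; rewrite /F /= mulrBl cisD cisN !conjM.
by ring.
Qed.

Let m1f : measurable_fun setT (fun z : RR * RR => nsq (f z.1)).
Proof.
exact: (cmeasurable_nsq (cmeasurable_comp (L2_measurable f2) measurable_fst)).
Qed.

Let m2f : measurable_fun setT (fun z : RR * RR => nsq (f z.2)).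
Proof.
exact: (cmeasurable_nsq (cmeasurable_comp (L2_measurable f2) measurable_snd)).
Qed.

Let int1 : (\int[P]_z (K z * nsq (f z.1))%:E = (2 * pi)%:E * sqn leb f)%E.
Proof.
have p0 := pi_ge0 R.
rewrite tonelli1; last 2 first.
- by apply/measurable_EFinP; exact: measurable_funM.
- by move=> z; rewrite lee_fin mulr_ge0 ?nsq_ge0.
rewrite /sqn -ge0_integralZl//; do ?[exact: (cmeasurable_ensq (L2_measurable f2))
  |by move=> x _; rewrite lee_fin nsq_ge0|by rewrite lee_fin mulr_ge0].
apply: eq_integral => x _; rewrite -(integral_poisson_shift x k0).
rewrite -ge0_integralZr//; do ?[by rewrite lee_fin nsq_ge0
  |by move=> y _; rewrite lee_fin poisson_ge0].
- by apply: eq_integral => y _; rewrite /K /= -poisson_even opprB EFinM.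
- apply/measurable_EFinP; apply: (measurableT_comp (measurable_poisson k0)).
  exact: measurable_funB.
Qed.

Let int2 : (\int[P]_z (K z * nsq (f z.2))%:E = (2 * pi)%:E * sqn leb f)%E.
Proof.
rewrite -int1 (mpres_swap leb leb).2.
- by apply: eq_integral => z _; rewrite /K /= -poisson_even opprB.
- by apply/measurable_EFinP; exact: measurable_funM.
- by move=> z; rewrite lee_fin mulr_ge0 ?nsq_ge0.
Qed.

(** Integrate |f(x) - f(y)|^2 + 2 Re (f(x) conj(f(y))) = |f(x)|^2 +
    |f(y)|^2 against the Poisson kernel of x - y: the first term gives the
    average of the increments of f, the second one is [abel_parseval], and
    the right side uses that the kernel has integral 2 pi. *)
Lemma poisson_identity :
  (\int[leb]_r ((poisson k r)%:E * sqn leb (fun x => tau r f x - f x)%R) +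
   2%:E * \int[leb]_xi (abel k xi * nsq (fourier leb th f xi))%:E =
   (4 * pi)%:E * sqn leb f)%E.
Proof.
have sf := sqn_fin f2.
have G1 : L1 P (fun z => (f z.1 * conjc (f z.2)) * (K z)%:C).
  rewrite (_ : (fun z => _) = (fun z => (K z)%:C * (f z.1 * conjc (f z.2)))).
    apply: (@L1_bounded _ _ _ _ _ _ (2 / k)).
    - exact: (L1_tensor f1 fJ).
    - exact: cmeasurableR.
    - by move=> z; rewrite /n1 /= normr0 addr0 ger0_norm.
  by apply/funext => z; rewrite mulrC.
have [g3 _] := L1_integrable G1.
pose h1 z := K z * nsq (f z.1) + K z * nsq (f z.2).
have mh1 : measurable_fun setT h1 by apply: measurable_funD; exact: measurable_funM.
have h10 z : 0 <= h1 z by rewrite addr_ge0// mulr_ge0 ?nsq_ge0.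
have ih1 : (\int[P]_z (h1 z)%:E = (4 * pi)%:E * sqn leb f)%E.
  rewrite /h1; under eq_integral do rewrite EFinD.
  rewrite ge0_integralD//; do ?[by move=> z _; rewrite lee_fin mulr_ge0 ?nsq_ge0
    |by apply/measurable_EFinP; exact: measurable_funM].
  rewrite int1 int2 -(fineK sf) -!EFinM -EFinD; congr EFin; ring.
have h1i : P.-integrable setT (fun z => (h1 z)%:E).
  apply/integrableP; split; first exact/measurable_EFinP.
  under eq_integral do rewrite gee0_abs ?lee_fin//.
  by rewrite ih1 -(fineK sf) -EFinM ltry.
have h2E : (\int[leb]_r ((poisson k r)%:E * sqn leb (fun x => tau r f x - f x)%R) =
    \int[P]_z (K z * nsq (f z.1 - f z.2))%:E)%E.
  have mf := L2_measurable f2.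
  have ms : measurable_fun setT (fun z : RR * RR => z.1 + z.2 : RR) by exact: measurable_funD.
  have sh : mpres P P (fun z : RR * RR => (z.1 + z.2 : RR, z.2)).
    by apply: mpres_shear1 => // y; exact: mpres_shift.
  rewrite [RHS]sh.2.
  - rewrite tonelli1.
    + apply: eq_integral => r _ /=; rewrite -ge0_integralZl//.
      * by apply: eq_integral => y _; rewrite /K /tau /= addrK EFinM [y + r]addrC.
      * apply: (@cmeasurable_ensq _ _ RR); apply: cmeasurableB => //.
        exact: cmeasurable_comp mf (measurable_shift r).
      * by move=> y _; rewrite lee_fin nsq_ge0.
      * by rewrite lee_fin poisson_ge0.
    + apply/measurable_EFinP; apply: measurable_funM.
        apply: (measurableT_comp mK (g := fun z : RR * RR => (z.1 + z.2 : RR, z.2))).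
        by apply: measurable_fun_pair => //; exact: measurable_funD.
      apply: cmeasurable_nsq; apply: cmeasurableB.
        exact: (cmeasurable_comp mf ms).
      exact: (cmeasurable_comp mf measurable_snd).
    + by move=> z; rewrite lee_fin mulr_ge0 ?nsq_ge0.
  - apply/measurable_EFinP; apply: measurable_funM => //.
    by apply: cmeasurable_nsq; apply: cmeasurableB; apply: cmeasurable_comp mf _.
  - by move=> z; rewrite lee_fin mulr_ge0 ?nsq_ge0.
rewrite h2E.
have -> : (\int[leb]_xi (abel k xi * nsq (fourier leb th f xi))%:E =
    \int[P]_z (complex.Re ((f z.1 * conjc (f z.2)) * (K z)%:C))%:E)%E.
  have hi : leb.-integrable setT (fun xi => (abel k xi * nsq (fourier leb th f xi))%:E).
    pose C := fine (2%:E * \int[leb]_x (n1 (f x))%:E)%E.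
    have nC xi : n1 (fourier leb th f xi) <= C.
      rewrite -lee_fin fineK; first by apply: n1_fourier_le f1.1; exact: measurable_th.
      rewrite ge0_fin_numE ?mule_ge0 ?integral_ge0//; last by move=> x _; rewrite lee_fin n1_ge0.
      by rewrite lte_mul_pinfty//; exact: f1.2.
    have := (@L1_bounded _ _ _ _ _ (fun xi : RR => (nsq (fourier leb th f xi))%:C) (C ^+ 2) (L1_abel k0)).
    case/(_ _ _)/L1_integrable => [||h _].
    - apply: cmeasurableR; apply: (@cmeasurable_nsq _ _ RR).
      exact: cmeasurable_fourier measurable_th _ f1.1.
    - move=> xi; rewrite /n1 /= normr0 addr0 ger0_norm ?nsq_ge0//.
      apply: (le_trans (nsq_le_n1 _)); rewrite ler_sqr ?nnegrE ?n1_ge0//.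
      exact: le_trans (n1_ge0 _) (nC xi).
    by apply: eq_integrable h => // xi _; rewrite /= mulr0 subr0 mulrC.
  rewrite -(fineK (integrable_fin_num measurableT hi)).
  rewrite -[RHS](fineK (integrable_fin_num measurableT g3)).
  by congr EFin; case: abel_parseval => h _; exact: esym h.
rewrite -ih1 -integralZl// -integralD//.
- apply: eq_integral => z _; rewrite -EFinM -EFinD; congr EFin; rewrite /h1 /nsq.
  by move: (f z.1) (f z.2) => [a b] [c d] /=; ring.
- rewrite (_ : (fun z => _) = (fun z => (h1 z)%:E - 2%:E * (complex.Re ((f z.1 * conjc (f z.2)) * (K z)%:C))%:E)%E).
    by apply: integrableB => //; exact: integrableZl.
  apply/funext => z; rewrite -EFinM -EFinB; congr EFin; rewrite /h1 /nsq.
  by move: (f z.1) (f z.2) => [a b] [c d] /=; ring.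
- exact: integrableZl.
Qed.

End identity.

Lemma sqn_increment_le f r : L2 leb f ->
  fine (sqn leb (fun x => tau r f x - f x)) <= 4 * fine (sqn leb f).
Proof.
move=> fi; have di := L2B (L2_tau r fi) fi.
rewrite -!hnorm_sqr; have := hnormD (L2_tau r fi) (L2N fi).
rewrite hnormN hnorm_tau; last exact: (L2_measurable fi).
have := hnorm_ge0 leb (fun x => tau r f x - f x); have := hnorm_ge0 leb f; nra.
Qed.

Lemma measurable_increment f : cmeasurable (f : RR -> R[i]) ->
  measurable_fun setT (fun r : RR => sqn leb (fun x => tau r f x - f x)).
Proof.
move=> mf; apply: (measurable_sqn1 leb (F := fun z : RR * RR => tau z.1 f z.2 - f z.2)).
apply: cmeasurableB; last exact: cmeasurable_comp mf measurable_snd.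
by apply: cmeasurable_comp mf _; exact: measurable_funD.
Qed.

(** The Poisson kernel concentrates at 0. For |r| < d the increment is
    small by continuity of translations; for |r| >= d it is at most 4
    ||f||^2 and poisson k r <= k (1 + d^-2) poisson 1 r, whose integral is
    O(k). *)
Lemma poisson_increment_cvg f : L2 leb f ->
  (\int[leb]_r ((poisson (n.+1%:R^-1) r)%:E * sqn leb (fun x => tau r f x - f x)%R))%E
    @[n --> \oo] --> 0%E.
Proof.
move=> fi; set M := fine (sqn leb f).
have M0 : 0 <= M by rewrite fine_ge0// sqn_ge0.
have p0 := pi_gt0 R.
have di r : L2 leb (fun x => tau r f x - f x) by exact: L2B (L2_tau r fi) fi.
have key (e : R) : 0 < e -> exists2 C : R, 0 <= C & forall k : R, 0 < k ->
   (\int[leb]_r ((poisson k r)%:E * sqn leb (fun x => tau r f x - f x)%R) <=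
     (2 * pi * e + k * C)%:E)%E.
  move=> e0; have se0 : 0 < Num.sqrt e by rewrite sqrtr_gt0.
  have [d d0 dP] := translation_cont_L2 fi se0.
  pose c := 4 * M * (1 + d ^- 2).
  have c0 : 0 <= c by rewrite !mulr_ge0// addr_ge0// invr_ge0 exprn_ge0// ltW.
  exists (c * (2 * pi)); first by rewrite mulr_ge0// mulr_ge0// ltW.
  move=> k k0.
  have mq (j a : R) : 0 < j -> measurable_fun setT (fun r : RR => (a%:E * (poisson j r)%:E)%E).
    by move=> j0; apply: emeasurable_funM => //; apply/measurable_EFinP; exact: measurable_poisson.
  have iq (j a : R) : 0 < j -> 0 <= a ->
      (\int[leb]_r (a%:E * (poisson j r)%:E) = (a * (2 * pi))%:E)%E.
    move=> j0 a0; rewrite ge0_integralZl ?integral_poisson//.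
    - by apply/measurable_EFinP; exact: measurable_poisson.
    - by move=> r _; rewrite lee_fin poisson_ge0.
  have -> : ((2 * pi * e + k * (c * (2 * pi)))%:E =
     \int[leb]_r (e%:E * (poisson k r)%:E + (k * c)%:E * (poisson 1 r)%:E))%E.
    have kc0 : 0 <= k * c by rewrite mulr_ge0// ltW.
    rewrite ge0_integralD//; do ?exact: mq;
      do ?[by move=> r _; rewrite -EFinM lee_fin mulr_ge0 ?poisson_ge0// ltW].
    rewrite !iq ?(ltW e0)// -EFinD; congr EFin; ring.
  apply: ge0_le_integral => //.
  - by move=> r _; rewrite mule_ge0 ?sqn_ge0// lee_fin poisson_ge0.
  - apply: emeasurable_funM.
      by apply/measurable_EFinP; exact: measurable_poisson.
    exact: measurable_increment (L2_measurable fi).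
  - by apply: emeasurable_funD; exact: mq.
  - move=> r _; rewrite -(fineK (sqn_fin (di r))) -!EFinM -EFinD lee_fin.
    have pk := poisson_ge0 r k0; have p1 := poisson_ge0 r (@ltr01 R).
    have [rd|rd] := ltP `|r| d.
      have h : fine (sqn leb (fun x => tau r f x - f x)) <= e.
        rewrite -hnorm_sqr -(sqr_sqrtr (ltW e0)) ler_sqr ?nnegrE ?hnorm_ge0 ?(ltW se0)//.
        exact: dP.
      rewrite [e * _]mulrC -[leLHS]addr0 lerD ?ler_wpM2l//.
      by rewrite mulr_ge0// mulr_ge0// ltW.
    rewrite -[leLHS]add0r lerD//; first by rewrite mulr_ge0// ltW.
    apply: (@le_trans _ _ (poisson k r * (4 * M))).
      by rewrite ler_wpM2l//; exact: sqn_increment_le.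
    have r20 : 0 < r ^+ 2 by rewrite -real_normK ?num_real// exprn_gt0// (lt_le_trans d0).
    have rd2 : d ^+ 2 <= r ^+ 2.
      by rewrite -[leRHS]real_normK ?num_real// ler_sqr ?nnegrE// ltW.
    have d20 : 0 < d ^+ 2 by rewrite exprn_gt0.
    have A1 : 0 < 1 + r ^+ 2 by rewrite ltr_wpDr// ltW.
    have A2 := poisson_den_gt0 r k0.
    have H : poisson k r <= k * (1 + d ^- 2) * poisson 1 r.
      rewrite /poisson expr1n mulr1 ler_pdivrMr//.
      have -> : k * (1 + d ^- 2) * (2 / (1 + r ^+ 2)) * (k ^+ 2 + r ^+ 2) =
         2 * k * (((1 + d ^- 2) * (k ^+ 2 + r ^+ 2)) / (1 + r ^+ 2)).
        by field; rewrite !gt_eqF.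
      rewrite ler_peMr ?mulr_ge0 ?(ltW k0)// ler_pdivlMr// mul1r.
      have : 1 <= d ^- 2 * r ^+ 2 by rewrite mulrC ler_pdivlMr// mul1r.
      have : 0 <= d ^- 2 * k ^+ 2 by rewrite mulr_ge0 ?sqr_ge0// invr_ge0 ltW.
      have := sqr_ge0 k; nra.
    rewrite (_ : k * c * poisson 1 r = k * (1 + d ^- 2) * poisson 1 r * (4 * M)).
      by rewrite ler_wpM2r// mulr_ge0.
    by rewrite /c; ring.
have E0 k : 0 < k -> (0 <= \int[leb]_r ((poisson k r)%:E * sqn leb (fun x => tau r f x - f x)%R))%E.
  move=> k0; apply: integral_ge0 => r _.
  by rewrite mule_ge0 ?sqn_ge0// lee_fin poisson_ge0.
have Ef k : 0 < k -> (\int[leb]_r ((poisson k r)%:E * sqn leb (fun x => tau r f x - f x)%R))%E \is a fin_num.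
  move=> k0; have [C C0 CP] := key 1 ltr01.
  by rewrite ge0_fin_numE ?E0// (le_lt_trans (CP k k0))// ltry.
have halfE (x : R) : 2 * pi * (x / (4 * pi)) = x / 2.
  have : pi != 0 :> R by rewrite gt_eqF.
  by move: (pi : R) => p pn; field.
have halfC (x C : R) : 0 <= C -> x / (2 * (C + 1)) * (C + 1) = x / 2.
  by move=> C0; field; rewrite gt_eqF// ltr_wpDl.
apply/fine_cvgP; split; first by apply: nearW => n; apply: Ef; rewrite invr_gt0.
apply/cvgrPdist_le => e e0.
have [C C0 CP] := key (e / (4 * pi)) (divr_gt0 e0 (mulr_gt0 (ltr0n _ 4) p0)).
have Ce : 0 < e / (2 * (C + 1)) by rewrite divr_gt0// mulr_gt0// ltr_wpDl.
near=> n; have kn : (0 : R) < n.+1%:R^-1 by rewrite invr_gt0.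
rewrite sub0r normrN /= ger0_norm ?fine_ge0 ?E0//.
rewrite -lee_fin (fineK (Ef _ kn)) (le_trans (CP _ kn))// lee_fin.
have ne : n.+1%:R^-1 < e / (2 * (C + 1)) by near: n; exact: near_infty_natSinv_lt (PosNum Ce).
rewrite halfE.
have : n.+1%:R^-1 * C <= e / 2.
  apply: (@le_trans _ _ (e / (2 * (C + 1)) * (C + 1))).
    by apply: ler_pM => //; rewrite ?lerDl// ltW.
  by rewrite halfC.
by move=> H; rewrite [leRHS](splitr e) lerD2l.
Unshelve. all: by end_near. Qed.

(** Let k tend to 0 in [poisson_identity]: the Abel means increase to the
    integral of |f^|^2, and the average of the increments vanishes. *)
Lemma plancherel_line : plancherel leb leb th (2 * pi).
Proof.
split; first exact: measurable_th.
move=> f f1 f2; have p0 := pi_gt0 R.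
have mF := cmeasurable_fourier leb measurable_th f1.1.
pose L n := (\int[leb]_xi (abel (n.+1%:R^-1) xi * nsq (fourier leb th f xi))%:E)%E.
have kn n : (0 : R) < n.+1%:R^-1 by rewrite invr_gt0.
have ma n : measurable_fun setT (fun xi : RR => (abel (n.+1%:R^-1) xi * nsq (fourier leb th f xi))%:E).
  apply/measurable_EFinP; apply: measurable_funM; first exact: measurable_abel.
  exact: cmeasurable_nsq.
have Lcvg : L n @[n --> \oo] --> sqn leb (fourier leb th f).
  rewrite (_ : sqn _ _ = \int[leb]_xi limn (fun n => (abel (n.+1%:R^-1) xi * nsq (fourier leb th f xi))%:E))%E.
    apply: cvg_monotone_convergence => //.
    - by move=> n xi _; rewrite lee_fin mulr_ge0 ?nsq_ge0 ?expR_ge0.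
    - move=> xi _ n j nj; rewrite lee_fin ler_wpM2r ?nsq_ge0// ler_expR lerN2.
      by rewrite ler_wpM2r// lef_pV2 ?posrE// ler_nat.
  apply: eq_integral => xi _; apply/esym/cvg_lim => //.
  apply: cvg_EFin; first exact: nearW.
  rewrite -[X in _ --> X]mul1r; apply: cvgM; last exact: cvg_cst.
  rewrite -[X in _ --> X](@expR0 R); apply: continuous_cvg; first exact: continuous_expR.
  rewrite -oppr0; apply: cvgN; rewrite -[X in _ --> X](mul0r `|xi|).
  by apply: cvgM; [exact: cvg_harmonic|exact: cvg_cst].
have Ecvg := poisson_increment_cvg f2.
have S2 : (0 + 2%:E * sqn leb (fourier leb th f) = (4 * pi)%:E * sqn leb f)%E.
  apply: (@cvg_unique _ (@ereal_hausdorff R) _ _ _ _ (cvgeD _ Ecvg (cvgeZl _ Lcvg))) => //.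
  apply: cvg_near_cst; apply: nearW => n.
  by rewrite -(poisson_identity f1 f2 (kn n)).
move: S2; rewrite add0e -(fineK (sqn_fin f2)) -EFinM.
have := sqn_ge0 leb (fourier leb th f); case: (sqn leb (fourier _ _ _)) => [s _|_|]//.
  by rewrite -!EFinM => -[h]; congr EFin; lra.
by rewrite gt0_muley ?lte_fin.
Qed.

End plancherel_line.

(** * Lebesgue measure and the Plancherel formula on R^n *)

Section rV_measurability.
Context {R : realType} d (T : measurableType d).

Lemma measurable_coord n (f : T -> 'rV[R]_n) (j : 'I_n) : measurable_fun setT f ->
  measurable_fun setT (fun x => f x ord0 j : measurableTypeR R).
Proof. by move=> mf; apply: (measurableT_comp (measurable_rV_coord j) mf). Qed.

Lemma measurable_rVP n (f : T -> 'rV[R]_n) :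
  (forall j, measurable_fun setT (fun x => f x ord0 j : measurableTypeR R)) ->
  measurable_fun setT f.
Proof. by move=> h; exact: measurable_fun_rVP. Qed.

Lemma measurable_rVD n (f g : T -> 'rV[R]_n) : measurable_fun setT f ->
  measurable_fun setT g -> measurable_fun setT (fun x => f x + g x).
Proof.
move=> mf mg; apply: measurable_rVP => j.
rewrite (_ : (fun x => _) = (fun x => f x ord0 j + g x ord0 j)).
  by apply: measurable_funD; exact: measurable_coord.
by apply/funext => x; rewrite mxE.
Qed.

Lemma measurable_rVN n (f : T -> 'rV[R]_n) : measurable_fun setT f ->
  measurable_fun setT (fun x => - f x).
Proof.
move=> mf; apply: measurable_rVP => j.
rewrite (_ : (fun x => _) = (fun x => - f x ord0 j)).
  by apply: measurableT_comp => //; exact: measurable_coord.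
by apply/funext => x; rewrite mxE.
Qed.

Lemma measurable_rVB n (f g : T -> 'rV[R]_n) : measurable_fun setT f ->
  measurable_fun setT g -> measurable_fun setT (fun x => f x - g x).
Proof. by move=> mf mg; apply: measurable_rVD => //; exact: measurable_rVN. Qed.

Lemma measurable_rVZ n (a : T -> R) (f : T -> 'rV[R]_n) :
  measurable_fun setT a -> measurable_fun setT f ->
  measurable_fun setT (fun x => a x *: f x).
Proof.
move=> ma mf; apply: measurable_rVP => j.
rewrite (_ : (fun x => _) = (fun x => a x * f x ord0 j)).
  by apply: measurable_funM => //; exact: measurable_coord.
by apply/funext => x; rewrite mxE.
Qed.

Lemma measurable_dot n (f g : T -> 'rV[R]_n) : measurable_fun setT f ->
  measurable_fun setT g -> measurable_fun setT (fun x => dot (f x) (g x)).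
Proof.
move=> mf mg; apply: measurable_sum => j.
by apply: measurable_funM; exact: measurable_coord.
Qed.

End rV_measurability.

Section dot_theory.
Context {R : realType} {n : nat}.
Implicit Types x y z : 'rV[R]_n.

Lemma dotC x y : dot x y = dot y x.
Proof. by apply: eq_bigr => i _; rewrite mulrC. Qed.

Lemma dotDl x y z : dot (x + y) z = dot x z + dot y z.
Proof. by rewrite -big_split; apply: eq_bigr => i _; rewrite mxE mulrDl. Qed.

Lemma dotNl x z : dot (- x) z = - dot x z.
Proof. by rewrite -sumrN; apply: eq_bigr => i _; rewrite mxE mulNr. Qed.

Lemma dotBl x y z : dot (x - y) z = dot x z - dot y z.
Proof. by rewrite dotDl dotNl. Qed.

Lemma dotNr x z : dot z (- x) = - dot z x.
Proof. by rewrite dotC dotNl (dotC z). Qed.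

Lemma rV_norm_le x (r : R) : 0 <= r -> (`|x| <= r) = [forall j, `|x ord0 j| <= r].
Proof.
move=> r0; rewrite (_ : `|x| = mx_norm x)// mx_normrE; apply/idP/forallP => [h j|h].
  by apply: le_trans h; exact: (le_bigmax _ (fun ij => `|x ij.1 ij.2|) (ord0, j)).
by apply: bigmax_le => // -[i j] _ /=; rewrite (ord1 i).
Qed.

End dot_theory.

Section lebesgue_rV_theory.
Context {R : realType}.
Local Notation leb := (@lebesgue_measure R).
Local Notation RR := (measurableTypeR R).
Local Notation lebn := (@lebesgue_rV R).

Lemma mpres_rV_cons n : mpres (prodm leb (lebn n)) (lebn n.+1) (@rV_cons R n).
Proof.
split; first exact: measurable_rV_cons.
move=> f mf f0.
have := @ge0_integral_pushforward _ _ _ _ R _ (@measurable_rV_cons R n)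
  (prodm leb (lebn n)) setT f measurableT mf (fun x _ => f0 x).
by rewrite preimage_setT.
Qed.

Lemma dot_rV_cons n (p q : RR * 'rV[R]_n) :
  dot (rV_cons p) (rV_cons q) = p.1 * q.1 + dot p.2 q.2.
Proof.
rewrite /dot big_ord_recl /rV_cons !mxE unlift_none; congr (_ + _).
by apply: eq_bigr => i _; rewrite !mxE liftK.
Qed.

Lemma rV0_eq (u v : 'rV[R]_0) : u = v.
Proof. by rewrite [u]thinmx0 [v]thinmx0. Qed.

Lemma measurable_rV0 (f : 'rV[R]_0 -> \bar R) : measurable_fun setT f.
Proof.
rewrite (_ : f = cst (f 0)); first exact: measurable_cst.
by apply/funext => x; rewrite (rV0_eq x 0).
Qed.

Lemma integral_rV0 (f : 'rV[R]_0 -> \bar R) : (forall x, (0 <= f x)%E) ->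
  (\int[lebn 0]_x f x = f 0%R)%E.
Proof.
by move=> f0; rewrite integral_dirac ?diracT ?mul1e//; exact: measurable_rV0.
Qed.

Lemma mpres_translation n (a : 'rV[R]_n) : mpres (lebn n) (lebn n) (fun v => v + a).
Proof.
elim: n a => [|n ih] a.
  split; first by apply: measurable_rVD.
  move=> f mf f0; apply: eq_integral => x _; congr f; exact: rV0_eq.
split; first by apply: measurable_rVD.
move=> f mf f0.
have [mc cP] := mpres_rV_cons n.
have s1 : mpres (prodm leb (lebn n)) (prodm leb (lebn n))
    (fun z => (z.1 + a ord0 ord0 : RR, z.2)).
  apply: (@mpres_shear1 _ _ _ _ _ leb (lebn n) (fun z => z.1 + a ord0 ord0)) => [|y].
    by apply: measurable_funD.
  exact: mpres_shift.
have s2 : mpres (prodm leb (lebn n)) (prodm leb (lebn n))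
    (fun z => (z.1, z.2 + \row_j a ord0 (lift ord0 j))).
  apply: (@mpres_shear2 _ _ _ _ _ leb (lebn n) (fun z => z.2 + \row_j a ord0 (lift ord0 j))) => [|y].
    by apply: measurable_rVD.
  exact: ih.
rewrite cP// (mpres_comp s1 s2).2//; last exact: measurableT_comp.
rewrite cP//; last by apply: measurableT_comp => //; exact: measurable_rVD.
apply: eq_integral => z _; congr f; apply/rowP => j; rewrite !mxE /=.
by case: unliftP => [i ->|->]; rewrite ?mxE.
Qed.

Lemma plancherel_rV n :
  plancherel (lebn n) (lebn n) (@dot R n) ((2 * pi) ^+ n).
Proof.
elim: n => [|n ih].
  split.
    by apply: measurable_dot.
  move=> f f1 f2; rewrite expr0 mul1e /sqn !integral_rV0; last 2 first.
  - by move=> x; rewrite lee_fin nsq_ge0.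
  - by move=> x; rewrite lee_fin nsq_ge0.
  congr EFin; congr nsq.
  have c0 (h : 'rV[R]_0 -> R) : \int[lebn 0]_x h x = h 0.
    by rewrite /Rintegral integral_dirac ?diracT ?mul1e//; exact: measurable_rV0.
  rewrite /fourier /cintegral !c0 /dot big_ord0 cis0 mul1r.
  by case: (f 0).
rewrite exprSr.
apply: (plancherel_mpres (mpres_rV_cons n) (mpres_rV_cons n)).
- by apply: measurable_dot.
- by move=> x xi; rewrite dot_rV_cons.
- have p0 := pi_ge0 R; apply: plancherel_prod => //; first by rewrite mulr_ge0.
  + by rewrite exprn_ge0// mulr_ge0.
  + exact: plancherel_line.
Qed.

Definition cube n (k : R) : set 'rV[R]_n := [set v | forall j, `|v ord0 j| <= k].
Arguments cube : clear implicits.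

Lemma measurable_cube n k : measurable (cube n k).
Proof.
rewrite (_ : cube n k = \bigcap_(j in setT) [set v | `|v ord0 j| <= k]); last first.
  by apply/seteqP; split => v /= h j; [move=> _; exact: h|exact: h j I].
apply: fin_bigcap_measurable => //.
move=> j _.
have : measurable_fun setT (fun v : 'rV[R]_n => (`|v ord0 j| <= k : bool)).
  apply: measurable_fun_ler => //; apply: measurableT_comp => //.
  exact: measurable_coord.
move=> /(_ measurableT [set true]); rewrite setTI => h; exact: h.
Qed.

Lemma cube_lty n k : (lebn n (cube n k) < +oo)%E.
Proof.
elim: n => [|n ih]; first by rewrite /= diracE; case: (_ \in _); rewrite ltry.
have -> : lebn n.+1 (cube n.+1 k) = (leb \x lebn n)%E (`[- k, k]%classic `*` cube n k).
  rewrite /= /lebesgue_rVS /pushforward; congr (_ _).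
  apply/seteqP; split => -[x v] /=.
  - move=> h; split => /=.
      by have := h ord0; rewrite /rV_cons mxE unlift_none /= in_itv/= -ler_norml.
    by move=> j; have := h (lift ord0 j); rewrite /rV_cons mxE liftK.
  - rewrite in_itv/= -ler_norml => -[h1 h2] j.
    by rewrite /rV_cons mxE; case: unliftP => [i _|_] //=; exact: h2.
rewrite product_measure1E//; last exact: measurable_cube.
by rewrite lte_mul_pinfty// ?ge0_fin_numE// leb_itv_lty.
Qed.

Lemma measurable_norm_le n (k : nat) :
  measurable_fun setT (fun v : 'rV[R]_n => (`|v| <= k%:R : bool)).
Proof.
apply: (measurable_fun_bool true); rewrite setTI.
rewrite (_ : _ @^-1` _ = cube n k%:R); first exact: measurable_cube.
by apply/seteqP; split => v /=; rewrite rV_norm_le// => /forallP.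
Qed.

(** Measurability refers to the sigma-algebra generated by the coordinates,
    so continuity has to be reduced to coordinate boxes: f is the limit of
    its compositions with the rounding to the grid (1/k) Z^n, and the
    rounding takes countably many values, each of them on a box. *)
Lemma measurable_rV_continuous n (f : 'rV[R]_n -> R) : continuous f ->
  measurable_fun setT (f : 'rV[R]_n -> RR).
Proof.
move=> cf.
pose G (k : nat) (x : 'rV[R]_n) : 'rV[int]_n := \row_j Num.floor (k.+1%:R * x ord0 j).
pose H (k : nat) (c : 'rV[int]_n) : 'rV[R]_n := \row_j ((c ord0 j)%:~R / k.+1%:R).
have mG k c : measurable (G k @^-1` [set c]).
  rewrite (_ : G k @^-1` [set c] =
    \bigcap_(j in setT) [set x | (c ord0 j)%:~R <= k.+1%:R * x ord0 j < (c ord0 j + 1)%:~R]); last first.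
    apply/seteqP; split => x /=.
      by move=> <- j _ /=; rewrite /G mxE; have := floor_itv (k.+1%:R * x ord0 j).
    move=> h; apply/rowP => j; rewrite /G mxE.
    exact/floor_def/h.
  apply: (@fin_bigcap_measurable _ _ 'I_n setT) => //.
  move=> j _.
  have mj : measurable_fun setT (fun v : 'rV[R]_n => k.+1%:R * v ord0 j : RR).
    by apply: measurable_funM => //; exact: measurable_coord.
  have : measurable_fun setT (fun v : 'rV[R]_n =>
     ((c ord0 j)%:~R <= k.+1%:R * v ord0 j < (c ord0 j + 1)%:~R : bool)).
    apply: measurable_and; first exact: measurable_fun_ler.
    exact: measurable_fun_ltr.
  move=> /(_ measurableT [set true]); rewrite setTI => h; exact: h.
pose F k x := f (H k (G k x)).
have mF k : measurable_fun setT (F k : 'rV[R]_n -> RR).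
  move=> _ Y mY; rewrite setTI.
  rewrite (_ : _ @^-1` _ = \bigcup_(c : 'rV[int]_n)
    (if `[< Y (f (H k c)) >] then G k @^-1` [set c] else set0)); last first.
    apply/seteqP; split => x /=.
      by move=> Yx; exists (G k x) => //; rewrite asboolT.
    by move=> [c _]; case: asboolP => // Yc Gx; rewrite /F Gx.
  apply: countable_bigcupT_measurable; first exact: countableP.
  by move=> c; case: asboolP.
apply: (measurable_fun_cvg (h := F) mF) => x _.
apply: (@cvg_comp _ _ _ (fun k => H k (G k x)) f _ (nbhs x)); last exact: cf.
apply/cvgrPdist_lt => e e0.
near=> k.
apply: (@le_lt_trans _ _ k.+1%:R^-1); last by near: k; exact: near_infty_natSinv_lt (PosNum e0).
rewrite rV_norm_le; last by rewrite invr_ge0.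
apply/forallP => j; rewrite !mxE.
have k0 : (0 : R) < k.+1%:R by [].
have /andP[h1 h2] := floor_itv (k.+1%:R * x ord0 j).
rewrite -(ler_pM2l k0) -[X in X * `|_|](gtr0_norm k0) -normrM mulrBr.
rewrite mulfV ?gt_eqF// mulrCA mulfV ?gt_eqF// mulr1.
move: h2; rewrite intrD => h2.
by rewrite ger0_norm; lra.
Unshelve. all: by end_near. Qed.

Lemma measurable_circulation n (A : 'rV[R]_n -> 'rV[R]_n) :
  (forall j, continuous (fun x => A x ord0 j)) ->
  measurable_fun setT (fun z : 'rV[R]_n * 'rV[R]_n => circulation A z.1 z.2).
Proof.
move=> cA.
have mA : measurable_fun setT A.
  by apply: measurable_rVP => j; exact: measurable_rV_continuous.
rewrite (_ : (fun z => _) = (fun z : 'rV[R]_n * 'rV[R]_n =>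
   \int[leb]_s ((if s \in `[0, 1] then dot (z.2 - z.1) (A (z.1 + s *: (z.2 - z.1))) else 0)))); last first.
  apply/funext => z; rewrite /circulation Rintegral_mkcond; apply: eq_Rintegral => s _.
  by rewrite /patch mem_setE.
apply: (measurable_Rintegral1 leb (f := fun w : ('rV[R]_n * 'rV[R]_n) * RR =>
   if w.2 \in `[0, 1] then dot (w.1.2 - w.1.1) (A (w.1.1 + w.2 *: (w.1.2 - w.1.1))) else 0)).
have m1 : measurable_fun setT (fun w : ('rV[R]_n * 'rV[R]_n) * RR => w.1.1).
  exact: measurableT_comp.
have m2 : measurable_fun setT (fun w : ('rV[R]_n * 'rV[R]_n) * RR => w.1.2).
  exact: measurableT_comp.
apply: measurable_fun_ifT => //.
- rewrite (_ : (fun w => _) = (fun w : ('rV[R]_n * 'rV[R]_n) * RR => (0 <= w.2) && (w.2 <= 1))).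
    by apply: measurable_and; exact: measurable_fun_ler.
  by apply/funext => w; rewrite in_itv.
- apply: measurable_dot; first exact: measurable_rVB.
  apply: (measurableT_comp mA); apply: measurable_rVD => //.
  by apply: measurable_rVZ => //; exact: measurable_rVB.
Qed.

End lebesgue_rV_theory.

(** * The partial Fourier transform in L^2 *)

Section L2_convergence.
Context {R : realType} d (T : measurableType d) (m : {measure set T -> \bar R}).
Implicit Types (f g : T -> R[i]) (u v : nat -> T -> R[i]).

Lemma ipBl f g h : L2 m f -> L2 m g -> L2 m h ->
  ip m (fun x => g x - h x) f = ip m g f - ip m h f.
Proof.
move=> fi gi hi; rewrite -(ipJ fi (L2B gi hi)) ipBr// rmorphB.
by congr (_ - _); exact: ipJ.
Qed.

Lemma nsq_ip_le f g : L2 m f -> L2 m g -> nsq (ip m f g) <= (hnorm m f * hnorm m g) ^+ 2.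
Proof.
move=> fi gi; have := nsq_cintegral_le (L2J fi) gi.
by rewrite (_ : hnorm m (fun x => conjc (f x)) = hnorm m f)// /hnorm sqnJ.
Qed.

Lemma hnorm_subZ f g (a : R) : L2 m f -> L2 m g ->
  hnorm m (fun x => f x - a%:C * g x) ^+ 2 =
  hnorm m f ^+ 2 - 2 * a * complex.Re (ip m f g) + a ^+ 2 * hnorm m g ^+ 2.
Proof.
move=> fi gi; have ai := L2Z a%:C gi; have di := L2B fi ai.
have : (hnorm m (fun x => f x - a%:C * g x) ^+ 2)%:C =
   ip m f f - a%:C * ip m f g - ((conjc a%:C * ip m g f) - a%:C * (conjc a%:C * ip m g g)).
  rewrite hnorm_sqr -ipxx// ipBr// !ipBl// ipZr// !ipZl//.
  by rewrite ipZr//; ring.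
rewrite -(ipJ fi gi) !ipxx// -!hnorm_sqr => /(congr1 (@complex.Re R)) /= ->.
by case: (ip m f g) => x y /=; ring.
Qed.

Lemma L2cvg_ae u v f : (forall n, L2 m (u n)) -> (forall n, cmeasurable (v n)) -> L2 m f ->
  (forall n, u n = v n %[ae m]) -> L2cvg m u f -> L2cvg m v f.
Proof.
move=> ui mv fi uv; rewrite /L2cvg.
rewrite (_ : (fun n => hnorm m (fun x => v n x - f x)) =
  (fun n => hnorm m (fun x => u n x - f x)))//.
apply/funext => n; apply/esym.
apply: ae_eq_hnorm.
- exact: (L2_measurable (L2B (ui n) fi)).
- exact: cmeasurableB (mv n) (L2_measurable fi).
- by apply: filterS (uv n) => x /= /[apply] ->.
Qed.

Lemma L2cvg_ae_lim u f g : (forall n, L2 m (u n)) -> L2 m f -> cmeasurable g ->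
  f = g %[ae m] -> L2cvg m u f -> L2cvg m u g.
Proof.
move=> ui fi mg fg; rewrite /L2cvg.
rewrite (_ : (fun n => hnorm m (fun x => u n x - g x)) =
  (fun n => hnorm m (fun x => u n x - f x)))//.
apply/funext => n; apply/esym.
apply: ae_eq_hnorm.
- exact: (L2_measurable (L2B (ui n) fi)).
- exact: cmeasurableB (L2_measurable (ui n)) mg.
- by apply: filterS fg => x /= /[apply] ->.
Qed.

Lemma L2cvg_lin (a : R[i]) u v f g : (forall n, L2 m (u n)) -> (forall n, L2 m (v n)) ->
  L2 m f -> L2 m g -> L2cvg m u f -> L2cvg m v g ->
  L2cvg m (fun n x => u n x + a * v n x) (fun x => f x + a * g x).
Proof.
move=> ui vi fi gi uf vg.
apply: (@squeeze_cvgr _ _ _ _ (fun=> 0) (fun n => hnorm m (fun x => u n x - f x) +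
   Num.sqrt (nsq a) * hnorm m (fun x => v n x - g x))).
- apply: nearW => n; rewrite hnorm_ge0/=.
  rewrite -hnormZ; last exact: L2B.
  apply: le_trans (hnormD (L2B (ui n) fi) (L2Z a (L2B (vi n) gi))).
  rewrite le_eqVlt; apply/orP; left; apply/eqP; congr hnorm.
  by apply/funext => x; ring.
- exact: cvg_cst.
- rewrite -[X in _ --> X](_ : 0 + Num.sqrt (nsq a) * 0 = 0); last by rewrite mulr0 addr0.
  by apply: cvgD => //; apply: cvgM => //; exact: cvg_cst.
Qed.

Lemma ip_cvg u v f g : (forall n, L2 m (u n)) -> (forall n, L2 m (v n)) ->
  L2 m f -> L2 m g -> L2cvg m u f -> L2cvg m v g ->
  (fun n => nsq (ip m (u n) (v n) - ip m f g)) @ \oo --> (0 : R).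
Proof.
move=> ui vi fi gi uf vg.
have vn := L2cvg_hnorm vi gi vg.
pose b n := 2 * ((hnorm m (fun x => u n x - f x) * hnorm m (v n)) *
                 (hnorm m (fun x => u n x - f x) * hnorm m (v n))) +
            2 * ((hnorm m f * hnorm m (fun x => v n x - g x)) *
                 (hnorm m f * hnorm m (fun x => v n x - g x))).
apply: (@squeeze_cvgr _ _ _ _ (fun=> 0) b).
- apply: nearW => n; rewrite nsq_ge0/=.
  have -> : ip m (u n) (v n) - ip m f g =
      ip m (fun x => u n x - f x) (v n) + ip m f (fun x => v n x - g x).
    by rewrite ipBl// ipBr//; ring.
  apply: (le_trans (nsqD_le _ _)); rewrite /b -!expr2.
  by apply: lerD; rewrite ler_wpM2l//; apply: nsq_ip_le => //; exact: L2B.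
- exact: cvg_cst.
- have h1 : (fun n => hnorm m (fun x => u n x - f x) * hnorm m (v n)) @ \oo --> (0 : R).
    by rewrite -[X in _ --> X](mul0r (hnorm m g)); exact: cvgM.
  have h2 : (fun n => hnorm m f * hnorm m (fun x => v n x - g x)) @ \oo --> (0 : R).
    by rewrite -[X in _ --> X](mulr0 (hnorm m f)); apply: cvgM => //; exact: cvg_cst.
  rewrite -[X in _ --> X](_ : 2 * (0 * 0) + 2 * (0 * 0) = 0); last by rewrite mul0r mulr0 addr0.
  by apply: cvgD; apply: cvgM; try exact: cvg_cst; apply: cvgM.
Qed.

End L2_convergence.

Lemma ae_prod_fst {R : realType} d1 d2 (T1 : measurableType d1) (T2 : measurableType d2)
  (m1 : {sigma_finite_measure set T1 -> \bar R})
  (m2 : {sigma_finite_measure set T2 -> \bar R}) (P : T1 -> Prop) :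
  {ae m1, forall x, P x} -> {ae prodm m1 m2, forall p, P p.1}.
Proof.
move=> [N [mN N0 NP]]; exists (N `*` setT); split.
- exact: measurableX.
- transitivity (m1 N * m2 setT)%E; first exact: product_measure1E.
  by rewrite N0 mul0e.
- by move=> p /= Pp; split => //; apply: NP.
Qed.

Section partial_fourier.
Context {R : realType} ds d d' (S : measurableType ds) (T : measurableType d)
  (T' : measurableType d').
Variables (ms : {sigma_finite_measure set S -> \bar R}).
Variables (m : {sigma_finite_measure set T -> \bar R}).
Variables (m' : {sigma_finite_measure set T' -> \bar R}).
Variables (th : T -> T' -> R) (c : R).
Hypotheses (c0 : 0 < c) (P : plancherel m m' th c).
Variable A : nat -> T -> bool.
Hypotheses (mA : forall n, measurable_fun setT (A n))
  (An : forall x, \forall n \near \oo, A n x)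
  (Afin : forall n, (m [set x | A n x] < +oo)%E).

Definition fourier_snd (f : S * T -> R[i]) (p : S * T') : R[i] :=
  fourier m th (fun x => f (p.1, x)) p.2.

Definition cut n (f : S * T -> R[i]) (p : S * T) : R[i] :=
  if A n p.2 then f p else 0.

Definition slice_L1 (f : S * T -> R[i]) := {ae ms, forall s, L1 m (fun x => f (s, x))}.

Let mth := P.1.

Lemma cmeasurable_fourier_snd f : cmeasurable f -> cmeasurable (fourier_snd f).
Proof.
move=> mf; apply: (cmeasurable_cintegral2 m
  (F := fun q : T * (S * T') => cis (th q.1 q.2.2) * f (q.2.1, q.1))).
apply: cmeasurableM.
- apply: cmeasurable_cis.
  apply: (measurableT_comp mth (g := fun q : T * (S * T') => (q.1, q.2.2))).
  by apply: measurable_fun_pair => //; exact: measurableT_comp.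
- apply: cmeasurable_comp mf _.
  by apply: measurable_fun_pair => //; exact: measurableT_comp.
Qed.

Lemma L2_cut n f : L2 (prodm ms m) f -> L2 (prodm ms m) (cut n f).
Proof.
move=> fi; apply: (L2_dominated _ fi).
- apply: cmeasurable_if.
  + exact: measurableT_comp (mA n) measurable_snd.
  + exact: (L2_measurable fi).
  + exact: cmeasurable_cst.
- by move=> x; rewrite /cut; case: ifP => // _; rewrite nsq0 nsq_ge0.
Qed.

Lemma cut_cvg f : L2 (prodm ms m) f -> L2cvg (prodm ms m) (fun n => cut n f) f.
Proof.
move=> fi; apply: (@L2cvg_trunc _ _ _ _ f (fun n p => A n p.2) fi _ _).1.
- by move=> n; exact: measurableT_comp (mA n) measurable_snd.
- by move=> p; exact: An.
Qed.

Lemma slice_cut n f : L2 (prodm ms m) f -> slice_L1 (cut n f).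
Proof.
move=> fi; have ui : L2 m (fun x => (if A n x then 1 else 0) : R[i]).
  apply/L2P; split.
    by apply: cmeasurable_if => //; exact: cmeasurable_cst.
  rewrite /sqn (_ : (fun x => _) = (fun x => (\1_[set x | A n x] x)%:E)).
    have mAn : measurable [set x | A n x].
      by have /(_ measurableT [set true]) := mA n; rewrite setTI => h; exact: h.
    by rewrite integral_indic// setIT; exact: Afin.
  apply/funext => x; rewrite indicE; case: ifPn => Anx.
    by rewrite mem_set// /nsq /= expr1n expr0n addr0.
  by rewrite memNset ?nsq0//; exact/negP.
apply: filterS (L2_sec1 fi) => s si.
rewrite (_ : (fun x => _) = (fun x => (if A n x then 1 else 0) * f (s, x))).
  exact: L2M.
by apply/funext => x; rewrite /cut /=; case: ifP => _; rewrite ?mul1r ?mul0r.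
Qed.

Lemma sqn_fourier_snd f : L2 (prodm ms m) f -> slice_L1 f ->
  (sqn (prodm ms m') (fourier_snd f) = c%:E * sqn (prodm ms m) f)%E.
Proof.
move=> fi f1; have mf := L2_measurable fi; have mF := cmeasurable_fourier_snd mf.
rewrite !sqn_prod1// -ge0_integralZl//; do ?[exact: measurable_sqn1
  |by move=> s _; exact: sqn_ge0|by rewrite lee_fin ltW].
apply: ae_eq_integral => //.
- exact: measurable_sqn1.
- by apply: emeasurable_funM => //; exact: measurable_sqn1.
- by apply: filterS2 f1 (L2_sec1 fi) => s s1 s2 _; rewrite -P.2.
Qed.

Lemma L2_fourier_snd f : L2 (prodm ms m) f -> slice_L1 f -> L2 (prodm ms m') (fourier_snd f).
Proof.
move=> fi f1; apply/L2P; split; first exact: cmeasurable_fourier_snd (L2_measurable fi).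
by rewrite sqn_fourier_snd// lte_mul_pinfty ?lee_fin ?(ltW c0)//; have /L2P[] := fi.
Qed.

Lemma hnorm_fourier_snd f : L2 (prodm ms m) f -> slice_L1 f ->
  hnorm (prodm ms m') (fourier_snd f) = Num.sqrt c * hnorm (prodm ms m) f.
Proof.
move=> fi f1; rewrite /hnorm sqn_fourier_snd// fineM ?sqn_fin//=.
by rewrite sqrtrM// ltW.
Qed.

Lemma fourier_snd_lin (a : R[i]) f g : slice_L1 f -> slice_L1 g ->
  fourier_snd (fun p => f p + a * g p) = (fun p => fourier_snd f p + a * fourier_snd g p)
    %[ae (prodm ms m')].
Proof.
move=> f1 g1; apply: filterS2 (ae_prod_fst m' f1) (ae_prod_fst m' g1) => p pf pg _.
rewrite /fourier_snd -(fourierZ mth _ _ pg) -fourierD//.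
exact: L1Z.
Qed.

Lemma slice_lin (a : R[i]) f g : slice_L1 f -> slice_L1 g ->
  slice_L1 (fun p => f p + a * g p).
Proof.
by move=> f1 g1; apply: filterS2 f1 g1 => s sf sg; apply: L1D => //; exact: L1Z.
Qed.

(** g is the L^2 limit of the transforms of the truncations of f. The
    truncations are the ones that define [Op], since [cutoff] is [cut] for
    the balls of momenta. *)
Definition isFT f g := [/\ L2 (prodm ms m) f, L2 (prodm ms m') g &
  L2cvg (prodm ms m') (fun n => fourier_snd (cut n f)) g].

(** The transforms of the truncations form a Cauchy sequence, because the
    transform multiplies norms by the square root of c. *)
Lemma FT_ex f : L2 (prodm ms m) f -> exists g, isFT f g.
Proof.
move=> fi; have ci n := L2_cut n fi; have c1 n := slice_cut n fi.
have [|e e0|g gi fg] := @L2_complete _ _ _ (prodm ms m') (fun n => fourier_snd (cut n f)).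
- by move=> n; exact: L2_fourier_snd.
- have s0 : 0 < Num.sqrt c by rewrite sqrtr_gt0.
  have e20 : 0 < e / (2 * Num.sqrt c) by rewrite divr_gt0// mulr_gt0.
  have /cvgrPdist_le/(_ _ e20)[N _ NP] := cut_cvg fi.
  exists N => n k /NP /= hn /NP /= hk.
  have {}hn : hnorm (prodm ms m) (fun x => cut n f x - f x) <= e / (2 * Num.sqrt c).
    by move: hn; rewrite sub0r normrN ger0_norm ?hnorm_ge0.
  have {}hk : hnorm (prodm ms m) (fun x => cut k f x - f x) <= e / (2 * Num.sqrt c).
    by move: hk; rewrite sub0r normrN ger0_norm ?hnorm_ge0.
  have di := L2D (ci n) (L2Z (-1) (ci k)).
  rewrite (@ae_eq_hnorm _ _ _ _ _ (fourier_snd (fun p => cut n f p + (-1) * cut k f p))).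
  + rewrite hnorm_fourier_snd//; last exact: slice_lin.
    rewrite (_ : (fun p => _) = (fun p => (cut n f p - f p) + - (cut k f p - f p))).
      have := hnormD (L2B (ci n) fi) (L2N (L2B (ci k) fi)); rewrite hnormN => h.
      apply: (@le_trans _ _ (Num.sqrt c * (e / (2 * Num.sqrt c) + e / (2 * Num.sqrt c)))).
        by rewrite ler_wpM2l ?sqrtr_ge0//; lra.
      rewrite le_eqVlt; apply/orP; left; apply/eqP.
      by move: (Num.sqrt c) s0 => s s0; field; rewrite gt_eqF.
    by apply/funext => p; ring.
  + by apply: cmeasurableB; apply: cmeasurable_fourier_snd; exact: (L2_measurable (ci _)).
  + by apply: cmeasurable_fourier_snd; exact: (L2_measurable di).
  + apply: filterS (fourier_snd_lin (-1) (c1 n) (c1 k)) => p /= /[apply] ->.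
    by rewrite mulN1r.
- by exists g; split.
Qed.

Lemma FT_norm f g : isFT f g -> hnorm (prodm ms m') g = Num.sqrt c * hnorm (prodm ms m) f.
Proof.
move=> [fi gi fg]; have ci n := L2_cut n fi; have c1 n := slice_cut n fi.
have h1 := L2cvg_hnorm (fun n => L2_fourier_snd (ci n) (c1 n)) gi fg.
have h2 : (fun n => hnorm (prodm ms m') (fourier_snd (cut n f))) @ \oo -->
    Num.sqrt c * hnorm (prodm ms m) f.
  rewrite (_ : (fun n => _) = (fun n => Num.sqrt c * hnorm (prodm ms m) (cut n f))).
    by apply: cvgM; [exact: cvg_cst|exact: L2cvg_hnorm ci fi (cut_cvg fi)].
  by apply/funext => n; exact: hnorm_fourier_snd.
exact: cvg_unique h1 h2.
Qed.

Lemma FT_lin (a : R[i]) f g f' g' : isFT f g -> isFT f' g' ->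
  isFT (fun p => f p + a * f' p) (fun p => g p + a * g' p).
Proof.
move=> [fi gi fg] [fi' gi' fg'].
have F1 n := L2_fourier_snd (L2_cut n fi) (slice_cut n fi).
have F2 n := L2_fourier_snd (L2_cut n fi') (slice_cut n fi').
have si := L2D fi (L2Z a fi'); have ti := L2D gi (L2Z a gi').
split => //; apply: (L2cvg_ae _ _ _ _ (L2cvg_lin a F1 F2 gi gi' fg fg')) => //.
- by move=> n; exact: L2D (F1 n) (L2Z a (F2 n)).
- by move=> n; apply: cmeasurable_fourier_snd; exact: (L2_measurable (L2_cut n si)).
- move=> n; apply: filterS (fourier_snd_lin a (slice_cut n fi) (slice_cut n fi')) => p /= /[apply] <-.
  congr (fourier_snd _ p); apply/funext => q; rewrite /cut.
  by case: ifP => _; rewrite ?mulr0 ?addr0.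
Qed.

Lemma FT_ae f g g' : isFT f g -> cmeasurable g' -> g = g' %[ae (prodm ms m')] -> isFT f g'.
Proof.
move=> [fi gi fg] mg' gg'; split => //; first exact: ae_eq_L2 gi mg' gg'.
apply: L2cvg_ae_lim gg' fg => // n.
by apply: L2_fourier_snd; [exact: L2_cut|exact: slice_cut].
Qed.

End partial_fourier.

(** * Surjectivity of the partial Fourier transform *)

Section fourier_inversion.
Context {R : realType} ds d d' (S : measurableType ds) (T : measurableType d)
  (T' : measurableType d').
Variables (ms : {sigma_finite_measure set S -> \bar R}).
Variables (m : {sigma_finite_measure set T -> \bar R}).
Variables (m' : {sigma_finite_measure set T' -> \bar R}).
Variables (th : T -> T' -> R) (c : R).
Hypotheses (c0 : 0 < c) (P : plancherel m m' th c).
Hypothesis P' : plancherel m' m (fun xi x => - th x xi) c.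
Variable A : nat -> T -> bool.
Hypotheses (mA : forall n, measurable_fun setT (A n))
  (An : forall x, \forall n \near \oo, A n x)
  (Afin : forall n, (m [set x | A n x] < +oo)%E).
Variable A' : nat -> T' -> bool.
Hypotheses (mA' : forall n, measurable_fun setT (A' n))
  (An' : forall x, \forall n \near \oo, A' n x)
  (Afin' : forall n, (m' [set x | A' n x] < +oo)%E).

Let th' := fun xi x => - th x xi.

(** Fubini for the double integral of conj(a(x)) e^{-i th(x, xi)} b(xi). *)
Lemma fourier_adjoint a b : L1 m a -> L1 m' b ->
  cintegral m' (fun xi => conjc (fourier m th a xi) * b xi) =
  cintegral m (fun x => conjc (a x) * fourier m' th' b x).
Proof.
move=> ai bi; have mth := P.1.
pose F (p : T * T') : R[i] := cis (- th p.1 p.2) * (conjc (a p.1) * b p.2).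
have FL : L1 (prodm m m') F.
  by apply: L1_cis (L1_tensor (L1J ai) bi) _; exact: measurableT_comp.
transitivity (cintegral (prodm m m') F).
  rewrite (cfubini2 FL); apply: eq_cintegral => xi.
  have ph := L1_phase mth xi ai.
  rewrite mulrC /fourier -(cintegralJ ph) -cintegralZ; last exact: L1J.
  by apply: eq_cintegral => x; rewrite /F /= conjM -cisN; ring.
rewrite (cfubini1 FL); apply: eq_cintegral => x.
rewrite /fourier -cintegralZ; last exact: (L1_phase P'.1).
by apply: eq_cintegral => xi; rewrite /F /th' /=; ring.
Qed.

Lemma fourier_snd_adjoint f k : L2 (prodm ms m) f -> slice_L1 ms m f ->
  L2 (prodm ms m') k -> slice_L1 ms m' k ->
  ip (prodm ms m') (fourier_snd m th f) k = ip (prodm ms m) f (fourier_snd m' th' k).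
Proof.
move=> fi f1 ki k1.
have Fi := L2_fourier_snd c0 P fi f1; have Ki := L2_fourier_snd c0 P' ki k1.
have L1' := ip_L1 Fi ki; have L1'' := ip_L1 fi Ki.
rewrite /ip /pairing (cfubini1 L1') (cfubini1 L1'').
apply: ae_eq_cintegral.
- exact: (cmeasurable_cintegral1 m' L1'.1).
- exact: (cmeasurable_cintegral1 m L1''.1).
- by apply: filterS2 f1 k1 => s s1 s2 _; exact: (fourier_adjoint s1 s2).
Qed.

Lemma FT_adjoint f g k h : isFT ms m m' th A f g -> isFT ms m' m th' A' k h ->
  ip (prodm ms m') g k = ip (prodm ms m) f h.
Proof.
move=> [fi gi fg] [ki hi kh].
have cf n := L2_cut mA n fi; have ck n := L2_cut mA' n ki.
have sf n := slice_cut mA Afin n fi; have sk n := slice_cut mA' Afin' n ki.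
have Ff n := L2_fourier_snd c0 P (cf n) (sf n); have Fk n := L2_fourier_snd c0 P' (ck n) (sk n).
have h1 := ip_cvg Ff ck gi ki fg (cut_cvg mA' An' ki).
have h2 := ip_cvg cf Fk fi hi (cut_cvg mA An fi) kh.
have e n : ip (prodm ms m') (fourier_snd m th (cut A n f)) (cut A' n k) =
    ip (prodm ms m) (cut A n f) (fourier_snd m' th' (cut A' n k)) by exact: fourier_snd_adjoint.
have h3 : (fun n : nat => nsq (ip (prodm ms m') g k - ip (prodm ms m) f h)) @ \oo --> (0 : R).
  apply: (@squeeze_cvgr _ _ _ _ (fun=> 0) (fun n =>
     2 * nsq (ip (prodm ms m') (fourier_snd m th (cut A n f)) (cut A' n k) - ip (prodm ms m') g k) +
     2 * nsq (ip (prodm ms m) (cut A n f) (fourier_snd m' th' (cut A' n k)) - ip (prodm ms m) f h))).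
  - apply: nearW => n; rewrite nsq_ge0/= -[in leRHS]nsqN.
    apply: le_trans (nsqD_le _ _); rewrite e le_eqVlt; apply/orP; left; apply/eqP.
    by congr nsq; ring.
  - exact: cvg_cst.
  - rewrite -[X in _ --> X](_ : 2 * 0 + 2 * 0 = 0); last by rewrite mulr0 addr0.
    by apply: cvgD; apply: cvgM => //; exact: cvg_cst.
apply/eqP; rewrite -subr_eq0; apply/eqP/nsq_eq0.
by apply: (cvg_unique _ _ h3) => //; exact: cvg_cst.
Qed.

(** Let h be the transform of g for the opposite phase, and g' the
    transform of h. By adjointness <g', g> = ||h||^2 = c ||g||^2, while
    ||g'||^2 = c^2 ||g||^2; hence ||g' - c g||^2 = 0, and g is the
    transform of c^-1 h. *)
Lemma FT_surj g : L2 (prodm ms m') g -> exists f, isFT ms m m' th A f g.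
Proof.
move=> gi.
have [h gh] := FT_ex c0 P' mA' An' Afin' gi.
have [_ hi _] := gh.
have [g' hg] := FT_ex c0 P mA An Afin hi.
have [_ gi' _] := hg.
have n1 := FT_norm c0 P' mA' An' Afin' gh.
have n2 := FT_norm c0 P mA An Afin hg.
have ipE := FT_adjoint hg gh.
have z : hnorm (prodm ms m') (fun p => g' p - c%:C * g p) = 0.
  apply/eqP; rewrite -sqrf_eq0; apply/eqP.
  have c2 : Num.sqrt c ^+ 2 = c by rewrite sqr_sqrtr// ltW.
  by rewrite hnorm_subZ// ipE ipxx//= -hnorm_sqr n2 n1 !exprMn c2; ring.
have ce : g' = (fun p => c%:C * g p) %[ae (prodm ms m')].
  have := hnorm0_ae (L2B gi' (L2Z c%:C gi)) z.
  by apply: filterS => p /= /[apply] /eqP; rewrite subr_eq0 => /eqP.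
have hg' := FT_ae c0 P mA Afin hg (L2_measurable (L2Z c%:C gi)) ce.
have H := FT_lin c0 P mA Afin (c^-1 - 1)%:C hg' hg'.
(* c^-1 h, written as the combination to which linearity applies. *)
exists (fun p => h p + (c^-1 - 1)%:C * h p).
rewrite (_ : g = (fun p => c%:C * g p + (c^-1 - 1)%:C * (c%:C * g p)))//.
apply/funext => p; rewrite mulrA -mulrDl -rmorphM -rmorphD /=.
by rewrite mulrBl mulVf ?gt_eqF// mul1r addrC subrK mul1r.
Qed.

End fourier_inversion.

(** * Integral operators with square-integrable kernels *)

Section sections.
Context {R : realType} d1 d2 (T1 : measurableType d1) (T2 : measurableType d2).
Variables (m1 : {sigma_finite_measure set T1 -> \bar R}).
Variables (m2 : {sigma_finite_measure set T2 -> \bar R}).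

(** Tonelli for the indicator of a null set. *)
Lemma ae_section (Q : T1 * T2 -> Prop) : {ae prodm m1 m2, forall p, Q p} ->
  {ae m1, forall x, {ae m2, forall y, Q (x, y)}}.
Proof.
move=> [N [mN N0 NQ]].
have mI : measurable_fun setT (fun p => (\1_N p)%:E : \bar R).
  by apply/measurable_EFinP; exact: measurable_indic.
have : (\int[prodm m1 m2]_p (\1_N p)%:E = 0)%E by rewrite integral_indic// setIT.
rewrite tonelli1// => h.
have mF : measurable_fun setT (fun x => \int[m2]_y (\1_N (x, y))%:E)%E.
  exact: (measurable_fun_fubini_tonelli_F (fun p => (\1_N p)%:E)).
have /(ae_eq_integral_abs m1 measurableT mF) :
   (\int[m1]_x `| \int[m2]_y (\1_N (x, y))%:E | = 0)%E.
  rewrite -[RHS]h; apply: eq_integral => x _; rewrite gee0_abs//.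
  exact: integral_ge0.
apply: filterS => x /(_ I) /= hx.
exists [set y | N (x, y)]; split.
- by rewrite -[X in measurable X]setTI; exact: pair1_measurable.
- rewrite -hx -[LHS]mule1 -[LHS]/(_ * _)%E.
  rewrite mule1 -[in LHS](setIT [set y | N (x, y)]) -integral_indic//.
  by rewrite -[X in measurable X]setTI; exact: pair1_measurable.
- by move=> y /= Qy; apply: NQ.
Qed.

Definition kernel_op (K : T1 * T2 -> R[i]) (u : T2 -> R[i]) (x : T1) : R[i] :=
  cintegral m2 (fun y => K (x, y) * u y).

Lemma cmeasurable_kernel_op K u : cmeasurable K -> cmeasurable u -> cmeasurable (kernel_op K u).
Proof.
move=> mK mu; apply: (cmeasurable_cintegral1 m2 (F := fun p => K p * u p.2)).
by apply: cmeasurableM => //; exact: cmeasurable_comp mu measurable_snd.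
Qed.

Lemma kernel_op_L1 K u : L2 (prodm m1 m2) K -> L2 m2 u ->
  {ae m1, forall x, L1 m2 (fun y => K (x, y) * u y)}.
Proof. by move=> Ki ui; apply: filterS (L2_sec1 Ki) => x xi; exact: L2M. Qed.

Lemma sqn_kernel_op_le K u : L2 (prodm m1 m2) K -> L2 m2 u ->
  (sqn m1 (kernel_op K u) <= sqn (prodm m1 m2) K * sqn m2 u)%E.
Proof.
move=> Ki ui; have mK := L2_measurable Ki; have mu := L2_measurable ui.
have mT := cmeasurable_kernel_op mK mu.
rewrite sqn_prod1// muleC -ge0_integralZl//; do ?[exact: measurable_sqn1
  |by move=> x _; exact: sqn_ge0|exact: sqn_ge0].
apply: ae_ge0_le_integral => //.
- by move=> x _; rewrite lee_fin nsq_ge0.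
- exact: cmeasurable_ensq.
- by move=> x _; rewrite mule_ge0 ?sqn_ge0.
- by apply: emeasurable_funM => //; exact: measurable_sqn1.
- by apply: filterS (L2_sec1 Ki) => x xi _; rewrite muleC; exact: cauchy_schwarz.
Qed.

Lemma L2_kernel_op K u : L2 (prodm m1 m2) K -> L2 m2 u -> L2 m1 (kernel_op K u).
Proof.
move=> Ki ui; apply/L2P; split.
  by apply: cmeasurable_kernel_op; [exact: (L2_measurable Ki)|exact: (L2_measurable ui)].
by apply: le_lt_trans (sqn_kernel_op_le Ki ui) _; rewrite !sqn_hnorm// -EFinM ltry.
Qed.

Lemma hnorm_kernel_op_le K u : L2 (prodm m1 m2) K -> L2 m2 u ->
  hnorm m1 (kernel_op K u) <= hnorm (prodm m1 m2) K * hnorm m2 u.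
Proof.
move=> Ki ui; rewrite -ler_sqr ?nnegrE ?mulr_ge0 ?hnorm_ge0//.
rewrite -lee_fin -sqn_hnorm; last exact: L2_kernel_op.
by rewrite exprMn EFinM -!sqn_hnorm//; exact: sqn_kernel_op_le.
Qed.

Lemma kernel_opB K K' u : L2 (prodm m1 m2) K -> L2 (prodm m1 m2) K' -> L2 m2 u ->
  kernel_op (fun p => K p - K' p) u = (fun x => kernel_op K u x - kernel_op K' u x) %[ae m1].
Proof.
move=> Ki Ki' ui; apply: filterS2 (kernel_op_L1 Ki ui) (kernel_op_L1 Ki' ui) => x x1 x2 _.
by rewrite /kernel_op -cintegralB//; apply: eq_cintegral => y; rewrite mulrBl.
Qed.

End sections.

(** * Midpoint coordinates and phase space *)

Section midpoint.
Context {R : realType} {N : nat}.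
Local Notation X := 'rV[R]_N.
Local Notation leb := (@lebesgue_rV R N).
Local Notation P := (prodm leb leb).

(** Up to a phase, the kernel of [Op A f] is a function of the midpoint and
    of the difference of its arguments. *)
Definition mid (z : X * X) : X * X := (2^-1 *: (z.1 + z.2), z.1 - z.2).
Definition unmid (z : X * X) : X * X := (z.1 + 2^-1 *: z.2, z.1 - 2^-1 *: z.2).

Lemma mpres_fst_shift (h : X -> X) : measurable_fun setT h ->
  mpres P P (fun z => (z.1 + h z.2, z.2)).
Proof.
move=> mh; apply: (@mpres_shear1 _ _ _ _ _ leb leb (fun z => z.1 + h z.2)).
  by apply: measurable_rVD => //; exact: measurableT_comp.
by move=> y; exact: (mpres_translation (h y)).
Qed.

Lemma mpres_snd_shift (h : X -> X) : measurable_fun setT h ->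
  mpres P P (fun z => (z.1, z.2 + h z.1)).
Proof.
move=> mh; apply: (@mpres_shear2 _ _ _ _ _ leb leb (fun z => z.2 + h z.1)).
  by apply: measurable_rVD => //; exact: measurableT_comp.
by move=> y; exact: (mpres_translation (h y)).
Qed.

Lemma halfD (x : X) : 2^-1 *: x + 2^-1 *: x = x.
Proof. by rewrite -scalerDl (_ : 2^-1 + 2^-1 = 1 :> R) ?scale1r//; lra. Qed.

(** The substitution is made of two shears and a swap: (x, y) |-> (x - y,
    y) |-> (x - y, y + (x - y)/2). *)
Lemma mpres_mid : mpres P P mid.
Proof.
have mN : measurable_fun setT (fun y : X => - y) by apply: measurable_rVN.
have mh : measurable_fun setT (fun y : X => 2^-1 *: y) by apply: measurable_rVZ.
have := mpres_comp (mpres_comp (mpres_fst_shift mN) (mpres_snd_shift mh)) (mpres_swap leb leb).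
rewrite (_ : (fun x => _) = mid)//; apply/funext => -[x y]; rewrite /mid /=.
congr pair; rewrite -{1}(halfD y) scalerBr scalerDr.
by rewrite addrACA subrr addr0 addrC.
Qed.

Lemma mpres_unmid : mpres P P unmid.
Proof.
have mh : measurable_fun setT (fun y : X => - (2^-1 *: y)).
  by apply: measurable_rVN; exact: measurable_rVZ.
have mi : measurable_fun setT (fun y : X => y) by [].
have := mpres_comp (mpres_comp (mpres_swap leb leb) (mpres_snd_shift mh)) (mpres_fst_shift mi).
rewrite (_ : (fun x => _) = unmid)//; apply/funext => -[x y]; rewrite /unmid /=.
congr pair; rewrite addrCA; congr (_ + _).
by rewrite -[X in X - _](halfD y) addrK.
Qed.

Lemma midK : cancel mid unmid.
Proof.
move=> [x y]; rewrite /mid /unmid /= !scalerDr !scalerN; congr pair.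
  by rewrite addrACA subrr addr0 halfD.
by rewrite opprD opprK addrACA subrr add0r halfD.
Qed.

Lemma mpres_reflection (a : X) : mpres leb leb (fun v => a - v).
Proof.
suff h : forall n, mpres (@lebesgue_rV R n) (@lebesgue_rV R n) (fun v => - v).
  have := mpres_comp (h N) (mpres_translation a).
  by rewrite (_ : (fun x => _) = (fun v => a - v))//; apply/funext => v; rewrite addrC.
elim=> [|n ih].
  split; first by apply: measurable_rVN.
  move=> f mf f0; apply: eq_integral => x _; congr f; exact: rV0_eq.
split; first by apply: measurable_rVN.
move=> f mf f0.
have [mc cP] := @mpres_rV_cons R n.
have s1 : mpres (prodm (@lebesgue_measure R) (@lebesgue_rV R n))
    (prodm (@lebesgue_measure R) (@lebesgue_rV R n))
    (fun z => (- z.1 : measurableTypeR R, z.2)).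
  apply: (@mpres_shear1 _ _ _ _ _ (@lebesgue_measure R) (@lebesgue_rV R n) (fun z => - z.1)) => [|y].
    exact: measurableT_comp.
  exact: mpres_opp.
have s2 : mpres (prodm (@lebesgue_measure R) (@lebesgue_rV R n))
    (prodm (@lebesgue_measure R) (@lebesgue_rV R n))
    (fun z => (z.1, - z.2)).
  apply: (@mpres_shear2 _ _ _ _ _ (@lebesgue_measure R) (@lebesgue_rV R n) (fun z => - z.2)) => [|y].
    by apply: measurable_rVN.
  exact: ih.
rewrite cP// (mpres_comp s1 s2).2//; last exact: measurableT_comp.
rewrite cP//; last by apply: measurableT_comp => //; exact: measurable_rVN.
apply: eq_integral => z _; congr f; apply/rowP => j; rewrite !mxE /=.
by case: unliftP => [i _|_]; rewrite ?mxE.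
Qed.

End midpoint.

Section phase_space.
Context {R : realType} {N : nat}.
Local Notation X := 'rV[R]_N.
Local Notation leb := (@lebesgue_rV R N).
Local Notation P := (prodm leb leb).
Local Notation muN := (@mu R N).

(** The density of Lebesgue measure with respect to mu. *)
Definition planck : R := (2 * pi) ^+ N.

Lemma planck_gt0 : 0 < planck.
Proof. by rewrite exprn_gt0// mulr_gt0// pi_gt0. Qed.

Lemma integral_mu (f : X * X -> \bar R) : measurable_fun setT f ->
  (forall x, (0 <= f x)%E) -> (\int[muN]_x f x = planck^-1%:E * \int[P]_x f x)%E.
Proof. by move=> mf f0; rewrite ge0_integral_mscale. Qed.

Lemma sqn_mu (f : X * X -> R[i]) : cmeasurable f ->
  (sqn muN f = planck^-1%:E * sqn P f)%E.
Proof.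
move=> mf; apply: integral_mu; first exact: cmeasurable_ensq.
by move=> x; rewrite lee_fin nsq_ge0.
Qed.

Lemma planckV_gt0 : 0 < planck^-1.
Proof. by rewrite invr_gt0 planck_gt0. Qed.

Lemma L2_mu (f : X * X -> R[i]) : L2 muN f <-> L2 P f.
Proof.
have p0 := planckV_gt0.
split=> /L2P[mf]; rewrite ?sqn_mu// => fi; apply/L2P; split => //; rewrite ?sqn_mu//.
- move: fi; have := sqn_ge0 P f; case: (sqn P f) => [r| |]//.
    by move=> _ _; rewrite ltry.
  by rewrite gt0_muley ?lte_fin.
- by rewrite lte_mul_pinfty// lee_fin ltW.
Qed.

Lemma hnorm_mu (f : X * X -> R[i]) : L2 P f ->
  hnorm muN f = Num.sqrt planck^-1 * hnorm P f.
Proof.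
move=> fi; rewrite /hnorm sqn_mu; last exact: (L2_measurable fi).
by rewrite fineM ?sqn_fin//= sqrtrM// ltW// planckV_gt0.
Qed.

End phase_space.

(** * Kernels of magnetic Weyl operators *)

Section kernels.
Context {R : realType} {N : nat}.
Local Notation X := 'rV[R]_N.
Local Notation leb := (@lebesgue_rV R N).
Local Notation P := (prodm leb leb).
Local Notation muN := (@mu R N).
Local Notation hc := (@planck R N).
Variable A : X -> X.
Hypothesis cA : forall j, continuous (fun x => A x ord0 j).

Definition in_ball (n : nat) (xi : X) : bool := `|xi| <= n%:R.

Lemma measurable_in_ball n : measurable_fun setT (in_ball n).
Proof. exact: measurable_norm_le. Qed.

Lemma in_ball_near xi : \forall n \near \oo, in_ball n xi.
Proof. by near=> n; rewrite /in_ball; near: n; exact: nbhs_infty_ger.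
Unshelve. all: by end_near. Qed.

Lemma in_ball_fin n : (leb [set xi | in_ball n xi] < +oo)%E.
Proof.
rewrite (_ : [set xi | in_ball n xi] = @cube R N n%:R); first exact: cube_lty.
by apply/seteqP; split => v /=; rewrite /in_ball rV_norm_le// => /forallP.
Qed.

Lemma plancherel_rV' : plancherel leb leb (fun r xi : X => - dot xi r) hc.
Proof.
rewrite (_ : (fun r xi : X => - dot xi r) = (fun x xi => - dot x xi)).
  exact: plancherel_opp (plancherel_rV N).
by apply/funext => r; apply/funext => xi; rewrite dotC.
Qed.

Definition isFT_momentum (f g : X * X -> R[i]) := isFT leb leb leb (@dot R N) in_ball f g.

Definition flux_phase (z : X * X) : R[i] := cis (- circulation A z.1 z.2).

Lemma cmeasurable_flux_phase : cmeasurable flux_phase.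
Proof.
by apply: cmeasurable_cis; apply: measurableT_comp => //; exact: measurable_circulation.
Qed.

Definition mkker (g : X * X -> R[i]) (z : X * X) : R[i] :=
  hc^-1%:C * (flux_phase z * g (mid z)).

(** K is the kernel of [Op A f]: the Fourier transform of f in the
    momentum, in midpoint coordinates, times the flux phase and (2 pi)^-N. *)
Definition isKer (f K : X * X -> R[i]) := exists2 g, isFT_momentum f g & K = mkker g.

Lemma L2_phase d (T : measurableType d) (m : {measure set T -> \bar R}) (u : T -> R[i]) (p : T -> R[i]) :
  L2 m u -> cmeasurable p -> (forall x, nsq (p x) = 1) -> L2 m (fun x => p x * u x).
Proof.
move=> ui mp p1; apply: (L2_dominated _ ui).
- exact: cmeasurableM mp (L2_measurable ui).
- by move=> x; rewrite nsqM p1 mul1r.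
Qed.

Lemma sqn_phase d (T : measurableType d) (m : {measure set T -> \bar R}) (u : T -> R[i]) (p : T -> R[i]) :
  (forall x, nsq (p x) = 1) -> sqn m (fun x => p x * u x) = sqn m u.
Proof. by move=> p1; apply: eq_integral => x _; rewrite nsqM p1 mul1r. Qed.

Lemma nsq_flux z : nsq (flux_phase z) = 1.
Proof. exact: nsq_cis. Qed.

Lemma L2_mkker g : L2 P g -> L2 P (mkker g).
Proof.
move=> gi; apply: L2Z.
exact: (L2_phase (mpres_L2 mpres_mid gi) cmeasurable_flux_phase nsq_flux).
Qed.

Lemma hnorm_mkker g : L2 P g -> hnorm P (mkker g) = hc^-1 * hnorm P g.
Proof.
move=> gi; have gm := mpres_L2 mpres_mid gi.
rewrite hnormZ; last exact: L2_phase gm cmeasurable_flux_phase nsq_flux.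
rewrite nsqR sqrtr_sqr ger0_norm ?(ltW planckV_gt0)//; congr (_ * _).
rewrite /hnorm sqn_phase; last exact: nsq_flux.
by rewrite -(mpres_sqn mpres_mid)//; exact: (L2_measurable gi).
Qed.

Lemma mkkerB g g' z : mkker g z - mkker g' z = mkker (fun p => g p - g' p) z.
Proof. by rewrite /mkker; ring. Qed.

Lemma ker_L2l f K : isKer f K -> L2 muN f.
Proof. by move=> [g [fi _ _] _]; apply/L2_mu. Qed.

Lemma ker_L2 f K : isKer f K -> L2 P K.
Proof. by move=> [g [_ gi _] ->]; exact: L2_mkker. Qed.

Lemma ker_ex f : L2 muN f -> exists K, isKer f K.
Proof.
move=> /L2_mu fi.
have [g fg] := FT_ex planck_gt0 (plancherel_rV N) measurable_in_ball in_ball_near in_ball_fin fi.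
by exists (mkker g); exists g.
Qed.

(** Each of the three steps from f to its kernel is an isometry up to a
    constant; for the measure mu the constants cancel. *)
Lemma ker_norm f K : isKer f K -> hnorm P K = hnorm muN f.
Proof.
move=> [g fg ->]; have [fi gi _] := fg; rewrite hnorm_mkker// hnorm_mu//.
rewrite (FT_norm planck_gt0 (plancherel_rV N) measurable_in_ball in_ball_near in_ball_fin fg).
rewrite mulrA; congr (_ * _).
rewrite sqrtrV ?(ltW planck_gt0)//.
have s0 : 0 < Num.sqrt hc by rewrite sqrtr_gt0 planck_gt0.
rewrite -{1}(sqr_sqrtr (ltW planck_gt0)).
by move: (Num.sqrt hc) s0 => s s0; field; rewrite gt_eqF.
Qed.

Lemma ker_lin (a : R[i]) f K f' K' : isKer f K -> isKer f' K' ->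
  isKer (fun p => f p + a * f' p) (fun p => K p + a * K' p).
Proof.
move=> [g fg ->] [g' fg' ->].
exists (fun p => g p + a * g' p).
  exact: (FT_lin planck_gt0 (plancherel_rV N) measurable_in_ball in_ball_fin a fg fg').
by apply/funext => z; rewrite /mkker; ring.
Qed.

(** Each of the three steps from f to its kernel can be reversed. *)
Lemma ker_surj K : L2 P K -> exists f, isKer f K.
Proof.
move=> Ki.
pose g p := hc%:C * (conjc (flux_phase (unmid p)) * K (unmid p)).
have gi : L2 P g.
  apply: L2Z; apply: (L2_phase (mpres_L2 mpres_unmid Ki)).
  - apply: (@cmeasurable_comp _ _ _ _ _ (fun z => conjc (flux_phase z)) unmid).
      exact: cmeasurableJ cmeasurable_flux_phase.
    exact: mpres_unmid.1.
  - by move=> x; rewrite nsqJ nsq_flux.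
have [f fg] := FT_surj planck_gt0 (plancherel_rV N) plancherel_rV' measurable_in_ball
  in_ball_near in_ball_fin measurable_in_ball in_ball_near in_ball_fin gi.
exists f; exists g => //; apply/funext => z; rewrite /mkker /g midK.
rewrite [flux_phase z * _]mulrCA [flux_phase z * _]mulrA [flux_phase z * _]mulrC cisJM mul1r.
rewrite mulrA (_ : hc^-1%:C * hc%:C = 1) ?mul1r//.
transitivity (hc^-1 * hc)%:C; first by rewrite rmorphM.
by rewrite mulVf// gt_eqF// planck_gt0.
Qed.

Lemma ker_sqn f K : isKer f K -> fine (sqn P K) = fine (sqn muN f).
Proof. by move=> fK; rewrite -!hnorm_sqr (ker_norm fK). Qed.

Lemma ker_ip f K g L : isKer f K -> isKer g L -> ip P K L = ip muN f g.
Proof.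
move=> fK gL.
have Ki := ker_L2 fK; have Li := ker_L2 gL; have fi := ker_L2l fK; have gi := ker_L2l gL.
have four0 : (4%:R : R[i]) != 0 by rewrite pnatr_eq0.
apply: (mulfI four0); rewrite !ip_polarization//.
have lin (a : R[i]) : fine (sqn P (fun p => K p + a * L p)) =
    fine (sqn muN (fun p => f p + a * g p)) by apply: ker_sqn; exact: ker_lin.
by rewrite (lin 1) (lin (-1)) (lin 'i) (lin (- 'i)).
Qed.

Lemma cutoffE n (f : X * X -> R[i]) : cutoff n f = cut in_ball n f.
Proof. by []. Qed.

Lemma cmeasurable_Op_int f u : cmeasurable f -> cmeasurable u ->
  cmeasurable (Op_int A f u).
Proof.
move=> mf mu; apply: cmeasurableZ.
pose F (z : X * X) := cintegral leb (fun xi => cis (dot (z.1 - z.2) xi) *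
  cis (- circulation A z.1 z.2) * f (2^-1 *: (z.1 + z.2), xi) * u z.2).
apply: (cmeasurable_cintegral1 leb (F := F)).
apply: (cmeasurable_cintegral1 leb (F := fun w : (X * X) * X =>
  cis (dot (w.1.1 - w.1.2) w.2) *
  cis (- circulation A w.1.1 w.1.2) * f (2^-1 *: (w.1.1 + w.1.2), w.2) * u w.1.2)).
have m1 : measurable_fun setT (fun w : (X * X) * X => w.1.1) by exact: measurableT_comp.
have m2 : measurable_fun setT (fun w : (X * X) * X => w.1.2) by exact: measurableT_comp.
apply: cmeasurableM; last exact: cmeasurable_comp mu m2.
apply: cmeasurableM; last first.
  apply: cmeasurable_comp mf _; apply: measurable_fun_pair => //.
  by apply: measurable_rVZ => //; exact: measurable_rVD.
apply: cmeasurableM.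
  by apply: cmeasurable_cis; apply: measurable_dot => //; exact: measurable_rVB.
exact: (cmeasurable_comp cmeasurable_flux_phase measurable_fst).
Qed.

(** The momentum integral of a truncated symbol converges absolutely on
    almost every slice; it is there the Fourier integral in the definition
    of the kernel. *)
Lemma Op_int_ker n f u : L2 P f -> L2 leb u ->
  Op_int A (cutoff n f) u =
  kernel_op leb (mkker (fourier_snd leb (@dot R N) (cut in_ball n f))) u %[ae leb].
Proof.
move=> fi ui.
have ci := L2_cut measurable_in_ball n fi.
have si := slice_cut measurable_in_ball in_ball_fin n fi.
have Fi := L2_fourier_snd planck_gt0 (plancherel_rV N) ci si.
have Ki := L2_mkker Fi.
have aeQ : {ae P, forall z, L1 leb (fun xi => cut in_ball n f ((mid z).1, xi))}.
  exact: (mpres_ae mpres_mid (ae_prod_fst leb si)).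
apply: filterS2 (kernel_op_L1 Ki ui) (ae_section aeQ) => x x1 x2 _.
rewrite /Op_int /kernel_op.
pose G y := flux_phase (x, y) * fourier_snd leb (@dot R N) (cut in_ball n f) (mid (x, y)) * u y.
have GE y : mkker (fourier_snd leb (@dot R N) (cut in_ball n f)) (x, y) * u y = hc^-1%:C * G y.
  by rewrite /mkker /G !mulrA.
have Gi : L1 leb G.
  have -> : G = (fun y => hc%:C * (mkker (fourier_snd leb (@dot R N) (cut in_ball n f)) (x, y) * u y)).
    apply/funext => y; rewrite GE mulrA (_ : hc%:C * hc^-1%:C = 1) ?mul1r//.
    transitivity (hc * hc^-1)%:C; first by rewrite rmorphM.
    by rewrite mulfV// gt_eqF// planck_gt0.
  exact: L1Z.
rewrite (eq_cintegral _ GE) cintegralZ//; congr (_ * _).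
apply: ae_eq_cintegral => //; last first.
- apply: filterS x2 => y y1 _; rewrite /G mulrAC /fourier_snd /fourier.
  rewrite -cintegralZ; last exact: (L1_phase (plancherel_rV N).1).
  apply: eq_cintegral => xi; rewrite /= (dotC xi) /flux_phase /= cutoffE.
  by ring.
- exact: Gi.1.
pose F w := cis (dot (x - w.1) w.2) *
  cis (- circulation A x w.1) * cutoff n f (2^-1 *: (x + w.1), w.2) * u w.1.
apply: (cmeasurable_cintegral1 leb (F := F)).
apply: cmeasurableM; last exact: (cmeasurable_comp (L2_measurable ui) measurable_fst).
apply: cmeasurableM; last first.
  apply: (cmeasurable_comp (L2_measurable ci)); apply: measurable_fun_pair => //.
  by apply: measurable_rVZ => //; exact: measurable_rVD.
apply: cmeasurableM.
  by apply: cmeasurable_cis; apply: measurable_dot => //; exact: measurable_rVB.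
apply: (cmeasurable_comp cmeasurable_flux_phase (h := fun w : X * X => (x, w.1))).
exact: measurable_fun_pair.
Qed.

(** An operator is bounded by the L^2 norm of its kernel, and the kernels
    of the truncations converge. *)
Lemma L2cvg_Op_int f K u : isKer f K -> L2 leb u ->
  (forall n, L2 leb (Op_int A (cutoff n f) u)) /\
  L2cvg leb (fun n => Op_int A (cutoff n f) u) (kernel_op leb K u).
Proof.
move=> [g [fi gi fg] ->] ui.
have ci n := L2_cut measurable_in_ball n fi.
have si n := slice_cut measurable_in_ball in_ball_fin n fi.
have Fi n := L2_fourier_snd planck_gt0 (plancherel_rV N) (ci n) (si n).
have Ki n := L2_mkker (Fi n).
have Ti n := L2_kernel_op (Ki n) ui.
have mO n : cmeasurable (Op_int A (cutoff n f) u).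
  by apply: cmeasurable_Op_int; [exact: (L2_measurable (ci n))|exact: (L2_measurable ui)].
have TO n : kernel_op leb (mkker (fourier_snd leb (@dot R N) (cut in_ball n f))) u =
    Op_int A (cutoff n f) u %[ae leb].
  by apply: filterS (Op_int_ker n fi ui) => x /= /[apply].
have gK := L2_mkker gi.
split; first by move=> n; exact: ae_eq_L2 (Ti n) (mO n) (TO n).
apply: (L2cvg_ae Ti mO (L2_kernel_op gK ui) TO).
apply: (@squeeze_cvgr _ _ _ _ (fun=> 0) (fun n => hc^-1 *
   hnorm P (fun p => fourier_snd leb (@dot R N) (cut in_ball n f) p - g p) * hnorm leb u)).
- apply: nearW => n; rewrite hnorm_ge0/=.
  rewrite -hnorm_mkker; last exact: L2B.
  have di := L2B (Ki n) gK.
  rewrite (@ae_eq_hnorm _ _ _ leb (fun x => kernel_op leb (mkker (fourier_snd leb (@dot R N) (cut in_ball n f))) u x - kernel_op leb (mkker g) u x) (kernel_op leb (fun p =>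
     mkker (fourier_snd leb (@dot R N) (cut in_ball n f)) p - mkker g p) u)).
  + have H := hnorm_kernel_op_le di ui. apply: (le_trans H).
    rewrite le_eqVlt; apply/orP; left; apply/eqP; congr (hnorm _ _ * _).
    by apply/funext => p; exact: mkkerB.
  + exact: (L2_measurable (L2B (Ti n) (L2_kernel_op gK ui))).
  + exact: (L2_measurable (L2_kernel_op di ui)).
  + by apply: filterS (kernel_opB (Ki n) gK ui) => x /= /[apply] ->.
- exact: cvg_cst.
- rewrite -[X in _ --> X](_ : hc^-1 * 0 * hnorm leb u = 0); last by rewrite mulr0 mul0r.
  by apply: cvgM; [apply: cvgM => //|]; exact: cvg_cst.
Qed.

(** Limits in L^2 are unique almost everywhere, so the function selected in
    the definition of [Op] is the one given by the kernel. *)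
Lemma Op_ker f K u : isKer f K -> L2 leb u ->
  L2 leb (Op A f u) /\ Op A f u = kernel_op leb K u %[ae leb].
Proof.
move=> fK ui; have [Oi Oc] := L2cvg_Op_int fK ui.
have Ti := L2_kernel_op (ker_L2 fK) ui.
have conv v : L2 leb v ->
  ((fun n => L2norm leb (fun x => v x - Op_int A (cutoff n f) u x)) @ \oo --> 0%E <->
   L2cvg leb (fun n => Op_int A (cutoff n f) u) v).
  move=> vi; rewrite (_ : (fun n => L2norm _ _) = EFin \o (fun n =>
     hnorm leb (fun x => Op_int A (cutoff n f) u x - v x))); last first.
    apply/funext => n /=; rewrite L2norm_hnorm; last exact: L2B.
    congr EFin; rewrite -hnormN; congr hnorm.
    by apply/funext => x; rewrite opprB.
  split; first by move=> /fine_cvg.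
  by move=> h; apply: cvg_EFin => //; exact: nearW.
rewrite /Op; case: xgetP => [v _ [vi /(conv _ vi) vc]|h]; last first.
  by exfalso; apply: (h (kernel_op leb K u)); split => //; apply/conv.
split => //.
have z : hnorm leb (fun x => v x - kernel_op leb K u x) = 0.
  have h0 : (fun=> hnorm leb (fun x => v x - kernel_op leb K u x)) @ \oo --> (0 : R).
    apply: (@squeeze_cvgr _ _ _ _ (fun=> 0) (fun n : nat =>
       hnorm leb (fun x => Op_int A (cutoff n f) u x - kernel_op leb K u x) +
       hnorm leb (fun x => Op_int A (cutoff n f) u x - v x))).
    - apply: nearW => n; rewrite hnorm_ge0/=.
      have := hnormD (L2B (Oi n) Ti) (L2N (L2B (Oi n) vi)); rewrite hnormN.
      apply: le_trans; rewrite le_eqVlt; apply/orP; left; apply/eqP.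
      by congr hnorm; apply/funext => x; ring.
    - exact: cvg_cst.
    - by rewrite -[X in _ --> X](addr0 0); exact: cvgD.
  by apply: (cvg_unique _ _ h0) => //; exact: cvg_cst.
have := hnorm0_ae (L2B vi Ti) z.
by apply: filterS => x /= /[apply] /eqP; rewrite subr_eq0 => /eqP.
Qed.

(** Applied to the truncated character y |-> e^{i y.eta}, |y| <= n, the
    operator yields at x the partial Fourier transform of the truncation of
    K at (x, eta). If this vanishes for every eta, then so does the
    truncation, by Plancherel. *)
Lemma kernel_op_inj K : L2 P K -> (forall u, L2 leb u -> kernel_op leb K u = (fun=> 0) %[ae leb]) ->
  K = (fun=> 0) %[ae P].
Proof.
move=> Ki K0.
have ci n := L2_cut measurable_in_ball n Ki.
have si n := slice_cut measurable_in_ball in_ball_fin n Ki.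
have z n : hnorm P (cut in_ball n K) = 0.
  have Fi := L2_fourier_snd planck_gt0 (plancherel_rV N) (ci n) (si n).
  have : sqn P (fourier_snd leb (@dot R N) (cut in_ball n K)) = 0%E.
    rewrite sqn_prod2; last exact: (L2_measurable Fi).
    rewrite (eq_integral (fun=> 0%E)) ?integral0// => eta _.
    (* The truncated character of frequency eta. *)
    pose w y : R[i] := cis (dot y eta) * (if in_ball n y then 1 else 0).
    have wi : L2 leb w.
      apply: L2_phase; last by move=> y; exact: nsq_cis.
      - apply/L2P; split.
          by apply: cmeasurable_if; [exact: measurable_in_ball|exact: cmeasurable_cst|exact: cmeasurable_cst].
        rewrite /sqn (_ : (fun x => _) = (fun x => (\1_[set x | in_ball n x] x)%:E)).
          have mB : measurable [set x | in_ball n x].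
            by have /(_ measurableT [set true]) := measurable_in_ball n; rewrite setTI => h; exact: h.
          by rewrite integral_indic// setIT; exact: in_ball_fin.
        apply/funext => x; rewrite indicE; case: ifPn => Anx.
          by rewrite mem_set// /nsq /= expr1n expr0n addr0.
        by rewrite memNset ?nsq0//; exact/negP.
      - by apply: cmeasurable_cis; exact: measurable_dot.
    rewrite (@ae_eq_sqn _ _ _ leb _ (fun=> 0)).
    - by rewrite /sqn; under eq_integral do rewrite nsq0; rewrite integral0.
    - exact: (cmeasurable_sec2 eta (L2_measurable Fi)).
    - exact: cmeasurable_cst.
    - apply: filterS (K0 w wi) => x /= /[apply] <-.
      apply: eq_cintegral => y; rewrite /cut /w /=.
      by case: ifP => _; rewrite ?mulr0// mulr1 mulrC.
  rewrite (sqn_fourier_snd planck_gt0 (plancherel_rV N) (ci n) (si n)) (sqn_hnorm (ci n)) -EFinM => -[/eqP].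
  by rewrite mulf_eq0 sqrf_eq0 (gt_eqF planck_gt0) => /eqP.
apply: hnorm0_ae => //.
have := L2cvg_hnorm ci Ki (cut_cvg measurable_in_ball in_ball_near Ki).
rewrite (_ : (fun n => _) = (fun=> 0)); last by apply/funext => n; exact: z.
by move=> h; apply: (cvg_unique _ h) => //; exact: cvg_cst.
Qed.

Lemma kernel_op_eq K K' : L2 P K -> L2 P K' ->
  (forall u, L2 leb u -> kernel_op leb K u = kernel_op leb K' u %[ae leb]) -> K = K' %[ae P].
Proof.
move=> Ki Ki' KK; have h : (fun p => K p - K' p) = (fun=> 0) %[ae P].
  apply: (kernel_op_inj (L2B Ki Ki')) => u ui.
  by apply: filterS2 (kernel_opB Ki Ki' ui) (KK u ui) => x /= h1 h2 _; rewrite h1// h2// subrr.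
by apply: filterS h => p /= /[apply] /eqP; rewrite subr_eq0 => /eqP.
Qed.

End kernels.

(** * Products with the Weyl unitaries *)

Section weyl_products.
Context {R : realType} {N : nat}.
Local Notation X := 'rV[R]_N.
Local Notation leb := (@lebesgue_rV R N).
Local Notation P := (prodm leb leb).
Local Notation muN := (@mu R N).
Variable A : X -> X.
Hypothesis cA : forall j, continuous (fun x => A x ord0 j).

Definition op_phase (Z : X * X) (x : X) : R[i] :=
  cis (- dot (x + 2^-1 *: Z.1) Z.2) * cis (- circulation A x (x + Z.1)).

Lemma nsq_op_phase Z x : nsq (op_phase Z x) = 1.
Proof. by rewrite nsqM !nsq_cis mulr1. Qed.

Lemma cmeasurable_op_phase Z : cmeasurable (op_phase Z).
Proof.
have mD (a : X) : measurable_fun setT (fun x : X => x + a).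
  by apply: measurable_rVD => //; exact: measurable_cst.
apply: cmeasurableM.
  apply: cmeasurable_cis; apply: measurable_funN; apply: measurable_dot => //.
apply: (cmeasurable_comp (cmeasurable_flux_phase cA) (h := fun x : X => (x, x + Z.1))).
exact: measurable_fun_pair.
Qed.

Lemma L2_op Z u : L2 leb u -> L2 leb (op A Z u).
Proof.
move=> ui; apply: (L2_phase (mpres_L2 (mpres_translation Z.1) ui)).
  exact: cmeasurable_op_phase.
exact: nsq_op_phase.
Qed.

(** Kernel of the composition of [op A Z] after the operator with kernel K. *)
Definition left_ker (Z : X * X) (K : X * X -> R[i]) (z : X * X) : R[i] :=
  op_phase Z z.1 * K (z.1 + Z.1, z.2).

(** Kernel of the composition of [op A Z] before the operator with kernel
    K: the phase is evaluated at the translated point because of the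
    substitution in the integral. *)
Definition right_ker (Z : X * X) (K : X * X -> R[i]) (z : X * X) : R[i] :=
  op_phase Z (z.2 - Z.1) * K (z.1, z.2 - Z.1).

Lemma mpres_shift1 (a : X) : mpres P P (fun z => (z.1 + a, z.2)).
Proof. by apply: (mpres_fst_shift (h := fun=> a)); exact: measurable_cst. Qed.

Lemma mpres_shift2 (a : X) : mpres P P (fun z => (z.1, z.2 - a)).
Proof. by apply: (mpres_snd_shift (h := fun=> - a)); exact: measurable_cst. Qed.

Lemma measurable_subr (a : X) : measurable_fun setT (fun x : X => x - a).
Proof. by apply: measurable_rVB => //; exact: measurable_cst. Qed.

Lemma L2_left_ker Z K : L2 P K -> L2 P (left_ker Z K).
Proof.
move=> Ki; apply: (L2_phase (mpres_L2 (mpres_shift1 Z.1) Ki)).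
  exact: cmeasurable_comp (cmeasurable_op_phase Z) measurable_fst.
by move=> z; exact: nsq_op_phase.
Qed.

Lemma L2_right_ker Z K : L2 P K -> L2 P (right_ker Z K).
Proof.
move=> Ki; apply: (L2_phase (mpres_L2 (mpres_shift2 Z.1) Ki)).
  apply: (cmeasurable_comp (cmeasurable_op_phase Z) (h := fun z : X * X => z.2 - Z.1)).
  exact: (measurableT_comp (measurable_subr Z.1)).
by move=> z; exact: nsq_op_phase.
Qed.

Lemma kernel_op_left_ker Z K u : cmeasurable K -> L2 leb u ->
  {ae leb, forall x, L1 leb (fun y => K (x, y) * u y)} ->
  kernel_op leb (left_ker Z K) u = op A Z (kernel_op leb K u) %[ae leb].
Proof.
move=> mK ui h.
apply: filterS (mpres_ae (mpres_translation Z.1) h) => x hx _.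
rewrite /kernel_op /op -cintegralZ//; apply: eq_cintegral => y.
by rewrite /left_ker /op_phase /= !mulrA.
Qed.

Lemma kernel_op_right_ker Z K u : cmeasurable K -> L2 leb u ->
  kernel_op leb (right_ker Z K) u = kernel_op leb K (op A Z u).
Proof.
move=> mK ui; apply/funext => x; rewrite /kernel_op.
rewrite [RHS](mpres_cintegral (mpres_translation (- Z.1))
  (f := fun y => K (x, y) * op A Z u y)); last first.
  apply: cmeasurableM; first exact: (cmeasurable_sec1 x mK).
  exact: (L2_measurable (L2_op Z ui)).
apply: eq_cintegral => y; rewrite /right_ker /op /op_phase /= subrK.
by ring.
Qed.

(** Surjectivity of f |-> K provides a symbol with kernel [left_ker Z K],
    so that the product exists; whichever symbol is selected has this
    kernel almost everywhere, since kernels are determined by their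
    operators. *)
Lemma moyal_el_ker Z f K : isKer A f K ->
  exists2 K', isKer A (moyal_el A Z f) K' & K' = left_ker Z K %[ae P].
Proof.
move=> fK; have Ki := ker_L2 cA fK; have KLi := L2_left_ker Z Ki.
have KT u : L2 leb u -> kernel_op leb (left_ker Z K) u = op A Z (Op A f u) %[ae leb].
  move=> ui; have [_ Oe] := Op_ker cA fK ui.
  apply: filterS2 (kernel_op_left_ker Z (L2_measurable Ki) ui (kernel_op_L1 Ki ui))
    (mpres_ae (mpres_translation Z.1) Oe) => x h1 h2 _.
  by rewrite h1// /op h2.
rewrite /moyal_el; case: xgetP => [k _ [ki kE]|h].
  have [K' kK'] := ker_ex A ki; exists K' => //.
  apply: kernel_op_eq => //; first exact: (ker_L2 cA kK').
  move=> u ui; have [_ Oe] := Op_ker cA kK' ui.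
  apply: filterS3 (kE u ui) Oe (KT u ui) => x h1 h2 h3 _.
  exact: etrans (esym (h2 I)) (etrans (h1 I) (esym (h3 I))).
have [k kK] := ker_surj cA KLi.
exfalso; apply: (h k); split; first exact: (ker_L2l kK).
move=> u ui; have [_ Oe] := Op_ker cA kK ui.
by apply: filterS2 Oe (KT u ui) => x h1 h2 _; rewrite h1// h2.
Qed.

Lemma moyal_er_ker Z f K : isKer A f K ->
  exists2 K', isKer A (moyal_er A f Z) K' & K' = right_ker Z K %[ae P].
Proof.
move=> fK; have Ki := ker_L2 cA fK; have KLi := L2_right_ker Z Ki.
have KT u : L2 leb u -> kernel_op leb (right_ker Z K) u = Op A f (op A Z u) %[ae leb].
  move=> ui; have [_ Oe] := Op_ker cA fK (L2_op Z ui).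
  apply: filterS Oe => x h _; rewrite h// kernel_op_right_ker//; exact: (L2_measurable Ki).
rewrite /moyal_er; case: xgetP => [k _ [ki kE]|h].
  have [K' kK'] := ker_ex A ki; exists K' => //.
  apply: kernel_op_eq => //; first exact: (ker_L2 cA kK').
  move=> u ui; have [_ Oe] := Op_ker cA kK' ui.
  apply: filterS3 (kE u ui) Oe (KT u ui) => x h1 h2 h3 _.
  exact: etrans (esym (h2 I)) (etrans (h1 I) (esym (h3 I))).
have [k kK] := ker_surj cA KLi.
exfalso; apply: (h k); split; first exact: (ker_L2l kK).
move=> u ui; have [_ Oe] := Op_ker cA kK ui.
by apply: filterS2 Oe (KT u ui) => x h1 h2 _; rewrite h1// h2.
Qed.

(** The pairing with h is the inner product with the conjugate of h, and
    inner products can be computed on kernels. *)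
Lemma modulation_ker h f H K : isKer A (fun Z => conjc (h Z)) H -> isKer A f K ->
  forall p, modulation A h f p =
    ip P H (right_ker (p.1 - p.2) (left_ker (- p.1) K)).
Proof.
move=> hH fK p; have Ki := ker_L2 cA fK; have Hi := ker_L2 cA hH.
rewrite /modulation; have [K1 fK1 K1E] := moyal_el_ker (- p.1) fK.
have [K2 fK2 K2E] := moyal_er_ker (p.1 - p.2) fK1.
have K2i := ker_L2 cA fK2.
transitivity (ip muN (fun Z => conjc (h Z)) (moyal_er A (moyal_el A (- p.1) f) (p.1 - p.2))).
  by apply: eq_cintegral => Z; rewrite conjcK mulrC.
rewrite -(ker_ip cA hH fK2).
have KKi := L2_right_ker (p.1 - p.2) (L2_left_ker (- p.1) Ki).
apply: ae_eq_cintegral.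
- exact: (ip_L1 Hi K2i).1.
- exact: (ip_L1 Hi KKi).1.
- apply: filterS2 K2E (mpres_ae (mpres_shift2 (p.1 - p.2).1) K1E) => z h1 h2 _.
  by rewrite h1// /right_ker h2.
Qed.

End weyl_products.

(** * Norm of the modulation mapping *)

Section exchange.
Context {R : realType} d1 d2 d3 d4 (T1 : measurableType d1) (T2 : measurableType d2)
  (T3 : measurableType d3) (T4 : measurableType d4).
Variables (m1 : {sigma_finite_measure set T1 -> \bar R}).
Variables (m2 : {sigma_finite_measure set T2 -> \bar R}).
Variables (m3 : {sigma_finite_measure set T3 -> \bar R}).
Variables (m4 : {sigma_finite_measure set T4 -> \bar R}).

(** Used to gather the two positions on one side and the two momenta on the
    other. *)
Lemma mpres_exchange : mpres (prodm (prodm m1 m2) (prodm m3 m4))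
  (prodm (prodm m1 m3) (prodm m2 m4)) (fun w => ((w.1.1, w.2.1), (w.1.2, w.2.2))).
Proof.
have me : measurable_fun setT (fun w : (T1 * T2) * (T3 * T4) =>
    ((w.1.1, w.2.1), (w.1.2, w.2.2))).
  by do 2 apply: measurable_fun_pair; apply: measurableT_comp.
split => // f mf f0; have mfe := measurableT_comp mf me.
rewrite (tonelli1 (prodm m1 m3) (prodm m2 m4))//.
rewrite (tonelli1 (prodm m1 m2) (prodm m3 m4))//=.
rewrite (tonelli1 m1 m3 (f := fun p => (\int[prodm m2 m4]_r f (p, r))%E)); last 2 first.
- exact: (measurable_fun_fubini_tonelli_F f).
- by move=> p; exact: integral_ge0.
rewrite (tonelli1 m1 m2 (f := fun p => (\int[prodm m3 m4]_r f ((p.1, r.1), (p.2, r.2)))%E)); last 2 first.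
- apply: (measurable_fun_fubini_tonelli_F (fun w : (T1 * T2) * (T3 * T4) =>
    f ((w.1.1, w.2.1), (w.1.2, w.2.2)))); do ?[exact: mfe|by move=> ?; exact: f0].
- by move=> p; exact: integral_ge0.
apply: eq_integral => x1 _.
pose G (q : T3 * T2) : \bar R := (\int[m4]_x4 f ((x1, q.1), (q.2, x4)))%E.
have mG : measurable_fun setT G.
  apply: (measurable_fun_fubini_tonelli_F (fun w : (T3 * T2) * T4 =>
    f ((x1, w.1.1), (w.1.2, w.2)))) => //.
  apply: (measurableT_comp mf (g := fun w : (T3 * T2) * T4 => ((x1, w.1.1), (w.1.2, w.2)))).
  apply: measurable_fun_pair; apply: measurable_fun_pair => //;
    by apply: measurableT_comp.
have G0 q : (0 <= G q)%E by exact: integral_ge0.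
transitivity (\int[m3]_x3 \int[m2]_x2 G (x3, x2))%E.
  apply: eq_integral => x3 _.
  rewrite (tonelli1 m2 m4 (f := fun r => f ((x1, x3), r)))//.
  exact: (measurableT_comp mf (pair1_measurable _)).
rewrite -(tonelli1 m3 m2 (f := G))// (tonelli2 m3 m2 (f := G))//.
apply: eq_integral => x2 _.
rewrite (tonelli1 m3 m4 (f := fun s => f ((x1, s.1), (x2, s.2))))//.
apply: (measurableT_comp mf (g := fun s : T3 * T4 => ((x1, s.1), (x2, s.2)))).
by do 2 apply: measurable_fun_pair => //.
Qed.

End exchange.

Section norm_modulation.
Context {R : realType} {N : nat}.
Local Notation X := 'rV[R]_N.
Local Notation leb := (@lebesgue_rV R N).
Local Notation P := (prodm leb leb).
Local Notation muN := (@mu R N).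
Local Notation hc := (@planck R N).
Variable A : X -> X.
Hypothesis cA : forall j, continuous (fun x => A x ord0 j).

Definition dot2 (z w : X * X) : R := dot z.1 w.1 + dot z.2 w.2.

Lemma plancherel_dot2 : plancherel P P dot2 (hc * hc).
Proof.
exact: (plancherel_prod (ltW planck_gt0) (ltW planck_gt0) (plancherel_rV N) (plancherel_rV N)).
Qed.

Lemma sqn_mumu (f : (X * X) * (X * X) -> R[i]) : cmeasurable f ->
  (sqn (prodm muN muN) f = (hc^-1 * hc^-1)%:E * sqn (prodm P P) f)%E.
Proof.
move=> mf; rewrite !sqn_prod1// EFinM -muleA.
rewrite integral_mu; [|exact: measurable_sqn1|by move=> x; exact: sqn_ge0].
congr (_ * _)%E; rewrite -ge0_integralZl//; last 3 first.
- exact: measurable_sqn1.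
- by move=> x _; exact: sqn_ge0.
- by rewrite lee_fin ltW// planckV_gt0.
by apply: eq_integral => x _; rewrite sqn_mu//; exact: cmeasurable_sec1.
Qed.

(** The function of z = (x, y) whose Fourier transform is the modulation
    mapping at the positions w = (p, q), up to a phase. *)
Definition correlation (H K : X * X -> R[i]) (w z : X * X) : R[i] :=
  (H z)^* * (flux_phase A (z.1, z.1 - w.1) *
    (flux_phase A (z.2 - (w.1 - w.2), z.2) * K (z.1 - w.1, z.2 - (w.1 - w.2)))).

Lemma op_phaseE (Z : X * X) (x : X) : op_phase A Z x =
  cis (- dot x Z.2) * (cis (- dot (2^-1 *: Z.1) Z.2) * flux_phase A (x, x + Z.1)).
Proof. by rewrite /op_phase /flux_phase /= dotDl opprD cisD !mulrA. Qed.

Lemma nsq_corr H K w z : nsq (correlation H K w z) =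
  nsq (H z) * nsq (K (z.1 - w.1, z.2 - (w.1 - w.2))).
Proof. by rewrite nsqM nsqJ nsqM nsq_flux mul1r nsqM nsq_flux mul1r. Qed.

Lemma L1_correlation H K w : L2 P H -> L2 P K -> L1 P (correlation H K w).
Proof.
move=> Hi Ki.
have mf (a : X) (g : X * X -> X * X) : measurable_fun setT g ->
    cmeasurable (fun z => flux_phase A (g z)).
  by move=> mg; exact: (cmeasurable_comp (cmeasurable_flux_phase cA) mg).
apply: L2M; first exact: L2J.
have m1 : measurable_fun setT (fun z : X * X => z.1 - w.1).
  by apply: measurable_rVB => //; exact: measurable_cst.
have m2 : measurable_fun setT (fun z : X * X => z.2 - (w.1 - w.2)).
  by apply: measurable_rVB => //; exact: measurable_cst.
apply: (@L2_phase _ _ _ P _ (fun z => flux_phase A (z.1, z.1 - w.1))); last by move=> z; exact: nsq_flux.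
  apply: (@L2_phase _ _ _ P _ (fun z => flux_phase A (z.2 - (w.1 - w.2), z.2))); last by move=> z; exact: nsq_flux.
    apply: (mpres_L2 _ Ki); apply: (mpres_comp (mpres_shift1 (- w.1)) (mpres_shift2 (w.1 - w.2))).
  by apply: (mf 0); exact: measurable_fun_pair.
by apply: (mf 0); exact: measurable_fun_pair.
Qed.

Lemma cmeasurable_correlation H K : cmeasurable H -> cmeasurable K ->
  cmeasurable (fun q : (X * X) * (X * X) => correlation H K q.1 q.2).
Proof.
move=> mH mK; pose V := ((X * X) * (X * X))%type.
have m11 : measurable_fun setT (fun v : V => v.1.1) by apply: measurableT_comp.
have m12 : measurable_fun setT (fun v : V => v.1.2) by apply: measurableT_comp.
have m21 : measurable_fun setT (fun v : V => v.2.1) by apply: measurableT_comp.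
have m22 : measurable_fun setT (fun v : V => v.2.2) by apply: measurableT_comp.
have mw := measurable_rVB m11 m12.
have mf := cmeasurable_flux_phase cA.
apply: cmeasurableM.
  by apply: cmeasurableJ; apply: (cmeasurable_comp mH measurable_snd).
apply: cmeasurableM.
  apply: (cmeasurable_comp mf (h := fun v : V => (v.2.1, v.2.1 - v.1.1))).
  by apply: measurable_fun_pair => //; exact: measurable_rVB.
apply: cmeasurableM.
  apply: (cmeasurable_comp mf (h := fun v : V => (v.2.2 - (v.1.1 - v.1.2), v.2.2))).
  by apply: measurable_fun_pair => //; exact: measurable_rVB.
apply: (cmeasurable_comp mK (h := fun v : V => (v.2.1 - v.1.1, v.2.2 - (v.1.1 - v.1.2)))).
by apply: measurable_fun_pair => //; exact: measurable_rVB.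
Qed.

(** In the kernel of the two-sided product the momenta occur in phases that
    are constant in (x, y) and in the characters e^{i x.a}, from the left
    factor, and e^{i y.(b - a)}, from the right factor. *)
Lemma modulation_fourier h f H K : isKer A (fun Z => conjc (h Z)) H -> isKer A f K ->
  forall p q a b, exists2 c : R[i], nsq c = 1 &
   modulation A h f ((p, a), (q, b)) =
   c * fourier P dot2 (correlation H K (p, q)) (a, b - a).
Proof.
move=> hH fK p q a b; have Hi := ker_L2 cA hH; have Ki := ker_L2 cA fK.
pose w := p - q; pose z := a - b.
exists (cis (- dot (2^-1 *: w) z) * cis (dot w z) * cis (- dot (2^-1 *: (- p)) (- a))).
  by rewrite !nsqM !nsq_cis !mulr1.
rewrite (modulation_ker cA hH fK) /fourier -cintegralZ; last first.
  exact: (L1_phase plancherel_dot2.1 _ (L1_correlation (p, q) Hi Ki)).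
apply: eq_cintegral => -[x y]; rewrite /right_ker /left_ker !op_phaseE /correlation /dot2 /= -/w -/z.
have e1 : cis (- dot x (- a)) = cis (dot x a) by rewrite dotNr opprK.
have e2 : cis (- dot (y - w) z) = cis (dot w z) * cis (- dot y z).
  by rewrite dotBl opprB cisD.
have e3 : b - a = - z by rewrite opprB.
rewrite subrK cisD e1 e2 e3 (dotNr z).
have comm (s t c1 c2 c3 d1 d2 f1 f2 : R[i]) :
    s * (c2 * d2 * (c1 * f2) * (d1 * (c3 * f1) * t)) =
    c1 * c2 * c3 * (d1 * d2 * (s * (f1 * (f2 * t)))) by ring.
exact: comm.
Qed.

(** A reflection of the first position, followed by a translation of the
    second one by an amount that depends on the first. *)
Lemma mpres_correlation (x y : X) : mpres P P (fun w => (x - w.1, y - (w.1 - w.2))).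
Proof.
have h1 : mpres P P (fun w => (x - w.1, w.2)).
  apply: (@mpres_shear1 _ _ _ _ _ leb leb (fun w => x - w.1)).
    by apply: measurable_rVB => //; exact: measurable_cst.
  by move=> b; exact: mpres_reflection.
have h2 : mpres P P (fun w => (w.1, w.2 + (y - x + w.1))).
  apply: (mpres_snd_shift (h := fun u => y - x + u)).
  by apply: measurable_rVD => //; exact: measurable_cst.
have := mpres_comp h1 h2.
rewrite (_ : (fun w => _) = (fun w => (x - w.1, y - (w.1 - w.2))))//.
apply/funext => -[p q] /=; congr pair.
by rewrite subrKA opprB addrCA.
Qed.

(** For fixed (x, y), the integral over the positions is ||K||^2 by
    [mpres_correlation]. *)
Lemma sqn_correlation H K : cmeasurable H -> cmeasurable K ->
  (sqn (prodm P P) (fun q => correlation H K q.1 q.2) = sqn P H * sqn P K)%E.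
Proof.
move=> mH mK; have mC := cmeasurable_correlation mH mK.
rewrite sqn_prod2// [RHS]muleC /sqn -/(sqn P K) -ge0_integralZl//; last 3 first.
- exact: cmeasurable_ensq.
- by move=> z _; rewrite lee_fin nsq_ge0.
- exact: sqn_ge0.
apply: eq_integral => z _; rewrite (mpres_sqn (mpres_correlation z.1 z.2) mK) muleC.
have mK' := cmeasurable_comp mK (mpres_correlation z.1 z.2).1.
rewrite [in RHS]/sqn -ge0_integralZl//.
- by apply: eq_integral => w _; rewrite nsq_corr EFinM.
- exact: cmeasurable_ensq.
- by move=> w _; rewrite lee_fin nsq_ge0.
- by rewrite lee_fin nsq_ge0.
Qed.

Lemma cmeasurable_modulation h f H K : isKer A (fun Z => conjc (h Z)) H -> isKer A f K ->
  cmeasurable (modulation A h f).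
Proof.
move=> hH fK.
have mH := L2_measurable (ker_L2 cA hH); have mK := L2_measurable (ker_L2 cA fK).
rewrite (_ : modulation A h f = (fun p => cintegral P (fun z =>
   (H z)^* * right_ker A (p.1 - p.2) (left_ker A (- p.1) K) z))); last first.
  by apply/funext => p; rewrite (modulation_ker cA hH fK).
pose V := (((X * X) * (X * X)) * (X * X))%type.
have m11 : measurable_fun setT (fun v : V => v.1.1) by apply: measurableT_comp.
have m12 : measurable_fun setT (fun v : V => v.1.2) by apply: measurableT_comp.
have f1 (u : V -> X * X) : measurable_fun setT u -> measurable_fun setT (fun v => (u v).1).
  by move=> mu; exact: measurableT_comp.
have f2 (u : V -> X * X) : measurable_fun setT u -> measurable_fun setT (fun v => (u v).2).
  by move=> mu; exact: measurableT_comp.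
have mop (Z : V -> X * X) (a : V -> X) : measurable_fun setT (fun v => (Z v).1) ->
    measurable_fun setT (fun v => (Z v).2) -> measurable_fun setT a ->
    cmeasurable (fun v => op_phase A (Z v) (a v)).
  move=> mZ1 mZ2 ma; apply: cmeasurableM.
    apply: cmeasurable_cis; apply: measurable_funN; apply: measurable_dot => //.
    by apply: measurable_rVD => //; apply: measurable_rVZ.
  apply: (cmeasurable_comp (cmeasurable_flux_phase cA) (h := fun v : V => (a v, a v + (Z v).1))).
  by apply: measurable_fun_pair => //; exact: measurable_rVD.
have ms2 : measurable_fun setT (fun v : V => v.2) by exact: measurable_snd.
have mp := f1 _ m11; have mpi := f2 _ m11; have mq := f1 _ m12; have mk := f2 _ m12.
have mx := f1 _ ms2; have my := f2 _ ms2.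
have mpq := measurable_rVB mp mq.
have myw := measurable_rVB my mpq.
apply: (cmeasurable_cintegral1 P (F := fun v : V =>
   (H v.2)^* * right_ker A (v.1.1 - v.1.2) (left_ker A (- v.1.1) K) v.2)).
apply: cmeasurableM; first by apply: cmeasurableJ; exact: cmeasurable_comp mH ms2.
apply: cmeasurableM.
  by apply: mop => //; exact: measurable_rVB.
apply: cmeasurableM.
  by apply: mop => //; exact: measurable_rVN.
apply: (cmeasurable_comp mK (h := fun v : V => (v.2.1 + - v.1.1.1, v.2.2 - (v.1.1.1 - v.1.2.1)))).
by apply: measurable_fun_pair => //; exact: measurable_rVB.
Qed.

(** Plancherel in the momenta for fixed positions, then [sqn_correlation].
    The constant planck^2 of Plancherel is cancelled by the factor
    planck^-1 of each of the two copies of mu. *)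
Lemma sqn_modulation_ker h f H K : isKer A (fun Z => conjc (h Z)) H -> isKer A f K ->
  (sqn (prodm muN muN) (modulation A h f) = sqn P H * sqn P K)%E.
Proof.
move=> hH fK; have Hi := ker_L2 cA hH; have Ki := ker_L2 cA fK.
have mH := L2_measurable Hi; have mK := L2_measurable Ki.
have mM := cmeasurable_modulation hH fK.
rewrite sqn_mumu//.
pose F (w : (X * X) * (X * X)) := fourier P dot2 (correlation H K w.1) w.2.
have mF : cmeasurable F.
  apply: (cmeasurable_cintegral1 P (F := fun v : ((X * X) * (X * X)) * (X * X) =>
    cis (dot2 v.2 v.1.2) * correlation H K v.1.1 v.2)).
  apply: cmeasurableM.
    apply: cmeasurable_cis; apply: measurable_funD; apply: measurable_dot.
    - by apply: measurableT_comp.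
    - by apply: (measurableT_comp measurable_fst); apply: measurableT_comp.
    - by apply: measurableT_comp.
    - by apply: (measurableT_comp measurable_snd); apply: measurableT_comp.
  apply: (cmeasurable_comp (cmeasurable_correlation mH mK)
    (h := fun v : ((X * X) * (X * X)) * (X * X) => (v.1.1, v.2))).
  by apply: measurable_fun_pair => //; apply: measurableT_comp.
(* The second frequency is b - a instead of b. *)
have ms : mpres (prodm P P) (prodm P P) (fun w => (w.1, (w.2.1, w.2.2 - w.2.1))).
  apply: (@mpres_shear2 _ _ _ _ _ P P (fun w => (w.2.1, w.2.2 - w.2.1))).
    have m21 : measurable_fun setT (fun w : (X * X) * (X * X) => w.2.1) by apply: measurableT_comp.
    have m22 : measurable_fun setT (fun w : (X * X) * (X * X) => w.2.2) by apply: measurableT_comp.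
    by apply: measurable_fun_pair => //; exact: measurable_rVB.
  move=> w; apply: (mpres_snd_shift (h := fun x => - x)).
  exact: measurable_rVN.
have -> : sqn (prodm P P) (modulation A h f) = sqn (prodm P P) F.
  have mx := mpres_comp (mpres_exchange leb leb leb leb) ms.
  rewrite [RHS](mpres_sqn mx mF).
  apply: eq_integral => -[[p a] [q b]] _ /=.
  by have [c c1 ->] := modulation_fourier hH fK p q a b; rewrite nsqM c1 mul1r.
rewrite sqn_prod1//.
transitivity ((hc^-1 * hc^-1)%:E * \int[P]_w ((hc * hc)%:E * sqn P (correlation H K w)))%E.
  congr (_ * _)%E; apply: ae_eq_integral => //.
  - exact: measurable_sqn1.
  - apply: emeasurable_funM => //.
    exact: (measurable_sqn1 P (cmeasurable_correlation mH mK)).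
  - have : {ae P, forall w, (sqn P (correlation H K w) < +oo)%E}.
      apply: ae_lty.
      + exact: (measurable_sqn1 P (cmeasurable_correlation mH mK)).
      + by move=> w; exact: sqn_ge0.
      + rewrite -(sqn_prod1 P P (cmeasurable_correlation mH mK)) sqn_correlation//.
        by rewrite !sqn_hnorm// -EFinM ltry.
    apply: filterS => w wi _.
    have C1 := L1_correlation w Hi Ki; have C2 : L2 P (correlation H K w) by apply/L2P; split => //; exact: C1.1.
    exact: (plancherel_dot2.2 _ C1 C2).
rewrite ge0_integralZl//; last 3 first.
- exact: (measurable_sqn1 P (cmeasurable_correlation mH mK)).
- by move=> w _; exact: sqn_ge0.
- by rewrite lee_fin mulr_ge0// ltW// planck_gt0.
rewrite -(sqn_prod1 P P (cmeasurable_correlation mH mK)) sqn_correlation// muleA -EFinM.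
rewrite (_ : hc^-1 * hc^-1 * (hc * hc) = 1) ?mul1e//.
have := @planck_gt0 R N; move: (@planck R N) => c c0; field; by rewrite gt_eqF.
Qed.

End norm_modulation.

(** The scalars s1, s2, s3, s4 are the values S(h, h), S(h, k), S(k, h),
    S(k, k) of a sesquilinear form whose value at (h + c k, h + c k) is a
    scalar q times a fixed F; i is the imaginary unit. *)
Lemma sesquilinear_polarization (C : comPzRingType) (i q1 q2 q3 q4 F s1 s2 s3 s4 : C) :
  i * i = -1 ->
  q1 * F = s1 + 1 * s2 + 1 * s3 + 1 * 1 * s4 ->
  q2 * F = s1 + -1 * s2 + -1 * s3 + -1 * -1 * s4 ->
  q3 * F = s1 + i * s2 + - i * s3 + - i * i * s4 ->
  q4 * F = s1 + - i * s2 + i * s3 + i * - i * s4 ->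
  4%:R * s2 = (q1 - q2 - i * q3 + i * q4) * F.
Proof.
move=> i2 l1 l2 l3 l4; rewrite !mulrDl !mulNr -!mulrA l1 l2 l3 l4.
by ring: i2.
Qed.

(** * The orthogonality relation *)

Section modulation.
Context {R : realType} {N : nat}.
Local Notation X := 'rV[R]_N.
Local Notation leb := (@lebesgue_rV R N).
Local Notation P := (prodm leb leb).
Local Notation muN := (@mu R N).
Local Notation mumu := (prodm muN muN).
Variable A : X -> X.
Hypothesis cA : forall j, continuous (fun x => A x ord0 j).
Implicit Types f g h k : X * X -> R[i].

Lemma modulation_linr (a : R[i]) h f g : L2 muN h -> L2 muN f -> L2 muN g ->
  modulation A h (fun Z => f Z + a * g Z) =
  (fun p => modulation A h f p + a * modulation A h g p).
Proof.
move=> hi fi gi.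
have [H hH] := ker_ex A (L2J hi); have [K fK] := ker_ex A fi; have [L gL] := ker_ex A gi.
have Hi := ker_L2 cA hH; have Ki := ker_L2 cA fK; have Li := ker_L2 cA gL.
have Ti M (p : (X * X) * (X * X)) : L2 P M ->
    L2 P (right_ker A (p.1 - p.2) (left_ker A (- p.1) M)).
  by move=> Mi; apply: L2_right_ker => //; exact: L2_left_ker.
apply/funext => p.
have E : right_ker A (p.1 - p.2) (left_ker A (- p.1) (fun z => K z + a * L z)) =
    (fun z => right_ker A (p.1 - p.2) (left_ker A (- p.1) K) z +
       a * right_ker A (p.1 - p.2) (left_ker A (- p.1) L) z).
  have alg (c d x y : R[i]) : c * (d * (x + a * y)) = c * (d * x) + a * (c * (d * y)).
    by ring.
  by apply/funext => z; exact: alg.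
rewrite (modulation_ker cA hH fK) (modulation_ker cA hH gL).
rewrite (modulation_ker cA hH (ker_lin a fK gL)) E.
rewrite -(ipZr a Hi (Ti L p Li)) -(ipDr Hi (Ti K p Ki) (L2Z a (Ti L p Li))).
by [].
Qed.

Lemma modulation_linl (a : R[i]) h k f : L2 muN h -> L2 muN k -> L2 muN f ->
  modulation A (fun Z => h Z + a * k Z) f =
  (fun p => modulation A h f p + a * modulation A k f p).
Proof.
move=> hi ki fi; apply/funext => p; have [K fK] := ker_ex A fi.
have [K1 fK1 _] := moyal_el_ker cA (- p.1) fK.
have [K2 fK2 _] := moyal_er_ker cA (p.1 - p.2) fK1.
have ui := ker_L2l fK2; rewrite /modulation /pairing -cintegralZ; last exact: L2M.
rewrite -cintegralD; [|exact: L2M|by apply: L1Z; exact: L2M].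
by apply: eq_cintegral => Z; ring.
Qed.

Lemma L2_modulation h f : L2 muN h -> L2 muN f ->
  L2 mumu (modulation A h f) /\
  hnorm mumu (modulation A h f) = hnorm muN h * hnorm muN f.
Proof.
move=> hi fi; have [H hH] := ker_ex A (L2J hi); have [K fK] := ker_ex A fi.
have Hi := ker_L2 cA hH; have Ki := ker_L2 cA fK.
have s := sqn_modulation_ker cA hH fK.
split.
  apply/L2P; split; first exact: (cmeasurable_modulation cA hH fK).
  by rewrite s !sqn_hnorm// -EFinM ltry.
rewrite /hnorm s fineM ?sqn_fin// (ker_sqn cA hH) (ker_sqn cA fK) sqnJ.
by rewrite sqrtrM// fine_ge0// sqn_ge0.
Qed.

Lemma sqn_modulation h f : L2 muN h -> L2 muN f ->
  fine (sqn mumu (modulation A h f)) = fine (sqn muN h) * fine (sqn muN f).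
Proof. by move=> hi fi; rewrite -!hnorm_sqr (L2_modulation hi fi).2 exprMn. Qed.

(** Polarization in f of the equality of norms. *)
Lemma ip_modulation_same h f g : L2 muN h -> L2 muN f -> L2 muN g ->
  ip mumu (modulation A h f) (modulation A h g) = (fine (sqn muN h))%:C * ip muN f g.
Proof.
move=> hi fi gi.
have four0 : (4%:R : R[i]) != 0 by rewrite pnatr_eq0.
apply: (mulfI four0).
have lin (a : R[i]) :
    (fine (sqn mumu (fun p => modulation A h f p + a * modulation A h g p)))%:C =
    (fine (sqn muN h))%:C * (fine (sqn muN (fun Z => f Z + a * g Z)))%:C.
  rewrite -modulation_linr// sqn_modulation//; first by rewrite rmorphM.
  by apply: L2D => //; exact: L2Z.
rewrite mulrCA !ip_polarization//; do ?exact: (L2_modulation _ _).1.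
rewrite (lin 1) (lin (-1)) (lin 'i) (lin (- 'i)).
by rewrite mulrDr !mulrBr !(mulrCA _%:C 'i).
Qed.

(** Polarization in h: <M_h f, M_k g> is sesquilinear in (h, k), and
    [ip_modulation_same] gives its values on the diagonal. *)
Lemma ip_modulation h k f g : L2 muN h -> L2 muN k -> L2 muN f -> L2 muN g ->
  ip mumu (modulation A h f) (modulation A k g) = ip muN h k * ip muN f g.
Proof.
move=> hi ki fi gi.
have four0 : (4%:R : R[i]) != 0 by rewrite pnatr_eq0.
apply: (mulfI four0); rewrite mulrA (ip_polarization hi ki).
have Mi u v : L2 muN u -> L2 muN v -> L2 mumu (modulation A u v).
  by move=> ui vi; exact: (L2_modulation ui vi).1.
pose S u v := ip mumu (modulation A u f) (modulation A v g).
have expand (c : R[i]) : (fine (sqn muN (fun Z => h Z + c * k Z)))%:C * ip muN f g =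
    S h h + c * S h k + c^* * S k h + c^* * c * S k k.
  have ci : L2 muN (fun Z => h Z + c * k Z) by apply: L2D => //; exact: L2Z.
  rewrite -ip_modulation_same// !modulation_linl//.
  have Mh := Mi h f hi fi; have Mk := Mi k f ki fi.
  have Mh' := Mi h g hi gi; have Mk' := Mi k g ki gi.
  rewrite (ipDl (L2D Mh' (L2Z c Mk')) Mh (L2Z c Mk)).
  rewrite (ipZl c (L2D Mh' (L2Z c Mk')) Mk).
  rewrite (ipDr Mh Mh' (L2Z c Mk')) (ipDr Mk Mh' (L2Z c Mk')).
  rewrite (ipZr c Mh Mk') (ipZr c Mk Mk').
  have alg (s1 s2 s3 s4 d : R[i]) :
    s1 + c * s2 + d * (s3 + c * s4) = s1 + c * s2 + d * s3 + d * c * s4 by ring.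
  exact: alg.
have iJ : ('i : R[i])^* = - 'i by apply/eqP; rewrite eq_complex /= oppr0 !eqxx.
have n1J : (-1 : R[i])^* = -1 by rewrite rmorphN rmorph1.
have c1J : (1 : R[i])^* = 1 by rewrite rmorph1.
have niJ : (- 'i : R[i])^* = 'i by rewrite -iJ conjcK.
have l1 := expand 1; rewrite c1J in l1; have l2 := expand (-1); rewrite n1J in l2.
have l3 := expand 'i; rewrite iJ in l3; have l4 := expand (- 'i); rewrite niJ in l4.
by apply: (sesquilinear_polarization _ l1 l2 l3 l4); rewrite -expr2 sqr_i.
Qed.

End modulation.

Theorem theorem2p2 (R : realType) (N : nat) (N_gt0 : (0 < N)%N)
    (B : 'rV[R]_N -> 'M[R]_N) (A : 'rV[R]_N -> 'rV[R]_N)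
    (B_magnetic : magnetic_field B) (A_potential : vector_potential B A) :
  (forall f g h k : 'rV[R]_N * 'rV[R]_N -> R[i],
     L2 mu f -> L2 mu g -> L2 mu h -> L2 mu k ->
     [/\ L2 (mu \x mu)%E (modulation A h f),
         L2 (mu \x mu)%E (modulation A k g)
       & pairing (mu \x mu)%E
           (fun P => conjc (modulation A h f P)) (modulation A k g) =
         pairing mu (fun Z => conjc (h Z)) k *
         pairing mu (fun Z => conjc (f Z)) g]) /\
  (forall h : 'rV[R]_N * 'rV[R]_N -> R[i],
     L2 mu h -> ~ (h = cst 0 %[ae mu]) ->
     L2_isometry mu (mu \x mu)%E
       (fun f P => ((fine (L2norm mu h))^-1)%:C * modulation A h f P)).
Proof.
have cA := A_potential.1; split=> [f g h k fi gi hi ki|h hi h0].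
  split; first exact: (L2_modulation cA hi fi).1.
    exact: (L2_modulation cA ki gi).1.
  exact: ip_modulation.
have n0 : 0 < hnorm mu h.
  rewrite lt_neqAle hnorm_ge0 andbT; apply/eqP => /esym n0; apply: h0.
  exact: (hnorm0_ae hi n0).
rewrite L2norm_hnorm//=; split=> [f fi|a f g fi gi|f fi].
- exact: (L2Z _ (L2_modulation cA hi fi).1).
- apply: aeW => p _.
  rewrite (_ : (fun x => a * f x + g x) = (fun x => g x + a * f x)); last first.
    by apply/funext => x; rewrite addrC.
  rewrite (modulation_linr cA a hi gi fi).
  by rewrite mulrDr addrC mulrCA.
- have [Mi Mn] := L2_modulation cA hi fi.
  transitivity (L2norm (prodm mu mu) (fun p => ((hnorm mu h)^-1)%:C * modulation A h f p)) => //.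
  rewrite L2norm_hnorm; last exact: L2Z.
  rewrite hnormZ// Mn nsqR sqrtr_sqr ger0_norm ?invr_ge0 ?hnorm_ge0//.
  by rewrite mulKf ?gt_eqF// L2norm_hnorm.
Qed.
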